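(* Let $A=[A(i,j)]_{i,j=1}^N$ be an irreducible non-permutation matrix with entries in $\{0,1\}$, and let $\bar{A}$ be the $(N+3)\times(N+3)$ matrix $$ \bar{A}= \begin{bmatrix} A(1,1) & \dots & A(1,N-1) & A(1,N) & 0 & 0 & 0 \\ \vdots & & \vdots & \vdots & \vdots & \vdots & \vdots \\ A(N-1,1)& \dots & A(N-1,N-1)& A(N-1,N)& 0 & 0 & 0 \\ 0 & \dots & 0 & 0 & 1 & 0 & 0 \\ A(N,1) & \dots & A(N,N-1) & A(N,N) & 0 & 1 & 0 \\ 0 & \dots & 0 & 0 & 1 & 1 & 1 \\ 0 & \dots & 0 & 0 & 0 & 1 & 1 \end{bmatrix}. $$ Then the Cuntz--Krieger algebra $\mathcal{O}_A$ is isomorphic to $\mathcal{O}_{\bar{A}}$, and $\det(1-A)=-\det(1-\bar{A})$.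
   Context: An $n\times n$ matrix $M$ with entries in $\{0,1\}$ is irreducible if for all $i,j$ there is $k\ge 1$ with $M^k(i,j)>0$. For an irreducible non-permutation $n\times n$ matrix $M$ with entries in $\{0,1\}$, the Cuntz--Krieger algebra $\mathcal{O}_M$ is the universal unital $C^*$-algebra generated by partial isometries $S_1,\dots,S_n$ satisfying $\sum_{j=1}^n S_jS_j^*=1$ and $S_i^*S_i=\sum_{j=1}^n M(i,j)S_jS_j^*$ for $i=1,\dots,n$. Isomorphism means isomorphism of $C^*$-algebras. In the displayed matrix $\bar A$, the rows $1,\dots,N-1$ are the rows $1,\dots,N-1$ of $A$ followed by three zeros; row $N$ has a single nonzero entry $1$ in column $N+1$; row $N+1$ is the $N$th row of $A$ followed by $(0,1,0)$; row $N+2$ has entries $1$ exactly in columns $N+1,N+2,N+3$; row $N+3$ has entries $1$ exactly in columns $N+2,N+3$. *)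

(* Defs.v *)
From HB Require Import structures.
From mathcomp Require Import all_boot all_order all_algebra.
From mathcomp Require Import complex.
From mathcomp Require Import all_classical all_reals.

Set Implicit Arguments.
Unset Strict Implicit.
Unset Printing Implicit Defensive.

Import Order.TTheory GRing.Theory Num.Theory.

Local Open Scope complex_scope.
Local Open Scope ring_scope.

(* Unital complex C*-algebras.  The real-valued norm is part of this mixin
   because Hierarchy Builder rejects the join of GRing.Algebra with
   CompleteNormedModule.  An algType satisfies 1 != 0, so the zero algebra is
   excluded. *)
HB.mixin Record isCStarAlgebra (R : realType) A of GRing.Algebra R[i] A := {
  star : A -> A ;
  starD : {morph star : x y / x + y} ;
  starZ : forall (c : R[i]) (x : A), star (c *: x) = conjc c *: star x ;
  starM : forall x y : A, star (x * y) = star y * star x ;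
  starK : involutive star ;
  cnorm : A -> R ;
  cnormD : forall x y : A, cnorm (x + y) <= cnorm x + cnorm y ;
  cnormZ : forall (c : R[i]) (x : A), (cnorm (c *: x))%:C = `|c| * (cnorm x)%:C ;
  cnorm_eq0 : forall x : A, cnorm x = 0 -> x = 0 ;
  cnormM : forall x y : A, cnorm (x * y) <= cnorm x * cnorm y ;
  cnorm_star : forall x : A, cnorm (star x * x) = cnorm x ^+ 2 ;
  cnorm_complete : forall u : nat -> A,
    (forall e : R, 0 < e -> exists N : nat, forall m n : nat,
       (N <= m)%N -> (N <= n)%N -> cnorm (u m - u n) < e) ->
    exists l : A, forall e : R, 0 < e -> exists N : nat, forall n : nat,
       (N <= n)%N -> cnorm (u n - l) < e
}.

#[short(type="cstarAlgType")]
HB.structure Definition CStarAlgebra (R : realType) :=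
  {A of isCStarAlgebra R A & GRing.Algebra R[i] A}.

Section CStar.
Variable R : realType.

Definition star_morphism (A B : cstarAlgType R) (f : A -> B) : Prop :=
  {morph f : x / star x}.

(* A bijective *-homomorphism between C*-algebras is automatically isometric. *)
Definition cstar_isomorphic (A B : cstarAlgType R) : Prop :=
  exists f : {lrmorphism A -> B}, star_morphism f /\ bijective f.

Definition partial_isometry (A : cstarAlgType R) (s : A) : Prop :=
  s * star s * s = s.

Definition cnorm_closed (A : cstarAlgType R) (D : {pred A}) : Prop :=
  forall x : A,
    (forall e : R, 0 < e -> exists2 y, y \in D & cnorm (x - y) < e) -> x \in D.

Definition cstar_subalgebra (A : cstarAlgType R) (D : {pred A}) : Prop :=
  [/\ subalg_closed D, {in D, forall x, star x \in D} & cnorm_closed D].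

Definition cstar_generated n (A : cstarAlgType R) (S : 'I_n -> A) : Prop :=
  forall D : {pred A},
    cstar_subalgebra D -> (forall i, S i \in D) -> forall x, x \in D.

Definition ck_family n (M : 'M[int]_n) (A : cstarAlgType R) (S : 'I_n -> A)
    : Prop :=
  [/\ forall i, partial_isometry (S i),
      \sum_(j < n) S j * star (S j) = 1
    & forall i, star (S i) * S i =
                \sum_(j < n) (S j * star (S j)) *~ M i j].

(* A is a copy of the Cuntz-Krieger algebra of M: a C*-algebra generated by a
   family satisfying the relations and universal among such families.  The
   homomorphism f is unique, since S generates A and *-homomorphisms between
   C*-algebras are continuous.  These properties determine A up to
   isomorphism. *)
Definition is_cuntz_krieger n (M : 'M[int]_n) (A : cstarAlgType R) : Prop :=
  exists S : 'I_n -> A,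
    [/\ ck_family M S,
        cstar_generated S
      & forall (B : cstarAlgType R) (T : 'I_n -> B), ck_family M T ->
          exists f : {lrmorphism A -> B},
            star_morphism f /\ forall i, f (S i) = T i].

End CStar.

Definition mx01 n (M : 'M[int]_n) : Prop :=
  forall i j, M i j = 0 \/ M i j = 1.

Definition irreducible_mx n (M : 'M[int]_n) : Prop :=
  forall i j, exists2 k : nat, (1 <= k)%N & 0 < (M ^+ k) i j.

(* For A of size N = m.+1, the blocks split the rows and columns of the
   extended matrix into the first N and the last 3. *)
Definition bar_mx m (A : 'M[int]_m.+1) : 'M[int]_(m.+1 + 3) :=
  block_mx
    (\matrix_(i, j) if i == ord_max then 0 else A i j)
    (delta_mx ord_max 0)
    (\matrix_(i, j) if i == 0 then A ord_max j else 0)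
    (\matrix_(i, j) (nth [::] [:: [:: 0; 1; 0];
                                  [:: 1; 1; 1];
                                  [:: 0; 1; 1]] i)`_j).

(* Main.v *)
(* The determinant identity is a Schur complement.  For the isomorphism, write u, v, w
   for the three new vertices.  In the algebra of the extended matrix, s_v and s_w give
   isometries of the corner of p_v with range projections summing to p_v, a copy of the
   generators of O_2, so p_v can be absorbed under any projection containing a copy of
   it; this turns a family for the extended matrix into one for A.  Conversely,
   orthogonal isometries in the corner of p_N turn a family for A into one for the
   extended matrix.  Up to unitary conjugation both round trips replace the generators
   S_i by W S_i, where the unitary W commutes with the projections p_i = S_i S_i^*.

   The Cuntz-Krieger endomorphism lam x = sum_i S_i x S_i^* of the commutant of the p_i
   has, because the graph is strongly connected and not a cycle, isometries that almost
   intertwine it with any of its unitary twists (a Rokhlin-type average over long words).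
   Absorption then shows that (W S_i) and (S_i) are approximately unitarily equivalent as
   soon as all W p_i are stably homotopic to p_i, that is, have class 0 in K_1, here the
   group of unitaries modulo homotopy in the corner of an isometry.  For the round trip
   on A the class of W is killed by twisting s_w by a unitary; for the other round trip
   the classes satisfy the one relation that allows to remove them by conjugation.  So both
   composites are approximately inner, and Elliott's intertwining argument produces the
   isomorphism. *)

Require Import Defs.
From HB Require Import structures.
From mathcomp Require Import all_boot all_order all_algebra.
From mathcomp Require Import complex.
From mathcomp Require Import all_classical all_reals.
From mathcomp Require Import perm generic_quotient ring lra.

Set Implicit Arguments.
Unset Strict Implicit.
Unset Printing Implicit Defensive.

Import Order.TTheory GRing.Theory Num.Theory.

Local Open Scope complex_scope.
Local Open Scope ring_scope.

(** The obstacle is that neither construction is canonical: both depend on chosen isometries, so the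
    round trips return the generators only up to a twist. Two features keep this under control. The
    reduction is given by explicit formulas in the ring operations and the involution, so it
    commutes with homomorphisms and with conjugation by unitaries, and twists can be traced through
    it. And twists [Wu], [Wv], [Ww] of the three new generators change the new last generator by a
    unitary of class [cl Wu - cl Ww]. On one side every class can thus be reached by a choice of
    [Ww]; on the other, the vanishing achieved for the first round trip becomes [cl Wu = cl Ww],
    which is the solvability condition of the class equations at the new vertices. All analysis
    starts from the C*-identity and completeness: square roots come from an iteration, paths of
    unitaries become chains of small steps, and orthogonal isometries supply the room that matrices
    over the algebra supply in the usual definition of K_1. *)

Section Abel.
Variable V : zmodType.

Inductive zexp := Zzero | Zatom of nat | Zadd of zexp & zexp | Zopp of zexp.

Fixpoint zeval (env : seq V) e : V := match e with
  | Zzero => 0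
  | Zatom n => nth 0 env n
  | Zadd a b => zeval env a + zeval env b
  | Zopp a => - zeval env a end.

(** Positive and negative occurrences are counted separately in [nat]; comparing crosswise sums
    keeps integers out of the reflected check. *)
Fixpoint zcoef (n : nat) e : nat * nat := match e with
  | Zzero => (0, 0)%N
  | Zatom m => (nat_of_bool (m == n), 0)%N
  | Zadd a b => ((zcoef n a).1 + (zcoef n b).1, (zcoef n a).2 + (zcoef n b).2)%N
  | Zopp a => ((zcoef n a).2, (zcoef n a).1) end.

Lemma zevalE env e : zeval env e =
  \sum_(n < size env) (nth 0 env n *+ (zcoef n e).1 - nth 0 env n *+ (zcoef n e).2).
Proof.
elim: e => [|m|a iha b ihb|a iha] /=.
- by rewrite big1 // => n _; rewrite subrr.
- have [lt|le] := ltnP m (size env); last first.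
    rewrite nth_default // big1 // => n _; rewrite mulr0n subr0.
    case: eqVneq => [E|_]; last by rewrite mulr0n.
    by have := ltn_ord n; rewrite -E ltnNge le.
  rewrite (bigD1 (Ordinal lt)) //= eqxx mulr1n subr0 big1 ?addr0 // => n.
  by rewrite -val_eqE /= eq_sym => /negPf->; rewrite mulr0n subr0.
- by rewrite iha ihb -big_split; apply: eq_bigr => n _; rewrite !mulrnDr opprD addrACA.
- by rewrite iha -sumrN; apply: eq_bigr => n _; rewrite opprB.
Qed.

Fixpoint zcheck k e1 e2 := if k is n.+1 then
  ((zcoef n e1).1 + (zcoef n e2).2 == (zcoef n e1).2 + (zcoef n e2).1)%N && zcheck n e1 e2
  else true.

Lemma zcheckP env e1 e2 : zcheck (size env) e1 e2 -> zeval env e1 = zeval env e2.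
Proof.
move=> h; rewrite !zevalE; apply: eq_bigr => n _.
have {h} : ((zcoef n e1).1 + (zcoef n e2).2)%N = ((zcoef n e1).2 + (zcoef n e2).1)%N.
  case: n => n /=; elim: (size env) h => [//|k ih] /= /andP[/eqP h /ih {}ih].
  by rewrite ltnS leq_eqVlt => /predU1P[->|/ih].
move=> h; apply/eqP; rewrite subr_eq addrAC eq_sym subr_eq -!mulrnDr; apply/eqP; congr (_ *+ _).
by rewrite h addnC.
Qed.

End Abel.

(* Syntactic equality up to the canonical structures used to elaborate the
   operations. *)
Ltac zeq x y := lazymatch x with
  | GRing.mul ?a ?b => lazymatch y with GRing.mul ?c ?d => zeq a c; zeq b d end
  | star ?a => lazymatch y with star ?b => zeq a b end
  | GRing.scale ?a ?b => lazymatch y with GRing.scale ?c ?d => unify a c; zeq b d end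
  | GRing.one => lazymatch y with GRing.one => idtac end
  | _ => constr_eq x y end.
Ltac zmem x l := match l with
  | nil => constr:(false)
  | ?y :: ?t => match goal with
      | _ => let _ := match goal with _ => zeq x y end in constr:(true)
      | _ => zmem x t end end.
Ltac zatoms l t := lazymatch t with
  | GRing.zero => l
  | GRing.add ?a ?b => let l1 := zatoms l a in zatoms l1 b
  | GRing.opp ?a => zatoms l a
  | _ => match zmem t l with true => l | false => constr:(cons t l) end end.
Ltac zindex x l := match l with
  | ?y :: ?t => match goal with
      | _ => let _ := match goal with _ => zeq x y end in constr:(O)
      | _ => let n := zindex x t in constr:(S n) end end.
Ltac zreify l t := lazymatch t with
  | GRing.zero => constr:(Zzero)
  | GRing.add ?a ?b => let x := zreify l a in let y := zreify l b in constr:(Zadd x y)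
  | GRing.opp ?a => let x := zreify l a in constr:(Zopp x)
  | _ => let n := zindex t l in constr:(Zatom n) end.
(* Decides equalities in an abelian group. *)
Ltac abel := lazymatch goal with |- @eq ?T ?a ?b =>
  let l0 := zatoms (@nil T) a in let l := zatoms l0 b in
  let x := zreify l a in let y := zreify l b in
  apply: (@zcheckP _ l x y); vm_compute; reflexivity end.

(** * Norm, projections and partial isometries *)

Section Basics.
Variables (R : realType) (D : cstarAlgType R).
Implicit Types x y z : D.

(* An equation [a * b = c] in the form that rewrites inside right-associated
   products. *)
Lemma mulKx x y z : x * y = z -> forall w, x * (y * w) = z * w.
Proof. by move=> <- w; rewrite mulrA. Qed.

Lemma mulKx0 x y : x * y = 0 -> forall w, x * (y * w) = 0.
Proof. by move=> h w; rewrite mulrA h mul0r. Qed.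

Lemma mulKx1 x y : x * y = 1 -> forall w, x * (y * w) = w.
Proof. by move=> h w; rewrite mulrA h mul1r. Qed.

Lemma star0 : star (0 : D) = 0.
Proof. by apply: (addIr (star 0)); rewrite -starD !add0r. Qed.

Lemma starN x : star (- x) = - star x.
Proof. by apply/eqP; rewrite -subr_eq0 opprK -starD addNr star0. Qed.

Lemma starB x y : star (x - y) = star x - star y.
Proof. by rewrite starD starN. Qed.

Lemma star1 : star (1 : D) = 1.
Proof. by rewrite -[LHS]mulr1 -{2}[1]starK -starM mulr1 starK. Qed.

Lemma star_sum I (r : seq I) (P : pred I) (F : I -> D) :
  star (\sum_(i <- r | P i) F i) = \sum_(i <- r | P i) star (F i).
Proof. by elim/big_rec2: _ => [|i a b _ <-]; rewrite ?star0 ?starD. Qed.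

Lemma cnormZr (r : R) x : cnorm (r%:C *: x) = `|r| * cnorm x.
Proof.
have := cnormZ r%:C x; rewrite normc_def /= expr0n addr0 sqrtr_sqr.
by rewrite -rmorphM /= => -[].
Qed.

Lemma cnorm0 : cnorm (0 : D) = 0.
Proof. by rewrite -(scale0r (0 : D)) -[0]/(0%:C) cnormZr normr0 mul0r. Qed.

Lemma cnormN x : cnorm (- x) = cnorm x.
Proof.
have -> : - x = (- 1)%:C *: x by rewrite rmorphN /= scaleNr scale1r.
by rewrite cnormZr normrN1 mul1r.
Qed.

Lemma cnorm_ge0 x : 0 <= cnorm x.
Proof.
have := cnormD x (- x); rewrite subrr cnorm0 cnormN -mulr2n.
by rewrite pmulrn_lge0.
Qed.

Lemma cnormB x y : cnorm (x - y) <= cnorm x + cnorm y.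
Proof. by rewrite -(cnormN y) cnormD. Qed.

Lemma cnormC x y : cnorm (x - y) = cnorm (y - x).
Proof. by rewrite -cnormN opprB. Qed.

Lemma cnorm_tri z x y : cnorm (x - y) <= cnorm (x - z) + cnorm (z - y).
Proof. by rewrite -[x - y](subrKA z) cnormD. Qed.

Lemma cnorm_sum I (r : seq I) (P : pred I) (F : I -> D) :
  cnorm (\sum_(i <- r | P i) F i) <= \sum_(i <- r | P i) cnorm (F i).
Proof.
elim/big_rec2: _ => [|i a b _ h]; first by rewrite cnorm0.
by apply: le_trans (cnormD _ _) _; rewrite lerD2l.
Qed.

(** From [cnorm y ^+ 2 = cnorm (star y * y) <= cnorm (star y) * cnorm y], used for [x] and for
    [star x]. *)
Lemma cnorm_starE x : cnorm (star x) = cnorm x.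
Proof.
have le y : cnorm y <= cnorm (star y).
  have [->|ny] := eqVneq (cnorm y) 0; first exact: cnorm_ge0.
  have y0 : 0 < cnorm y by rewrite lt_neqAle eq_sym ny cnorm_ge0.
  by rewrite -(ler_pM2r y0) -expr2 -cnorm_star cnormM.
by apply/le_anti; rewrite le andbT -{2}[x]starK le.
Qed.

Lemma cnorm1 : cnorm (1 : D) = 1.
Proof.
have : cnorm (1 : D) = cnorm (1 : D) ^+ 2 by rewrite -cnorm_star star1 mulr1.
rewrite expr2 => /eqP; rewrite -{1}[cnorm _]mulr1 -subr_eq0 -mulrBr mulf_eq0.
case/orP=> /eqP; last by move=> /eqP; rewrite subr_eq0 => /eqP.
by move=> /cnorm_eq0 /eqP; rewrite oner_eq0.
Qed.

Lemma star_mul_eq0 x : star x * x = 0 -> x = 0.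
Proof.
move=> h; apply: cnorm_eq0; apply/eqP.
by rewrite -[_ == 0](expf_eq0 _ 2) -cnorm_star h cnorm0.
Qed.

Lemma cnorm_le1 x : cnorm (star x * x) <= 1 -> cnorm x <= 1.
Proof. by rewrite cnorm_star expr_le1 // cnorm_ge0. Qed.

Lemma cnormM_le1 x y : cnorm x <= 1 -> cnorm y <= 1 -> cnorm (x * y) <= 1.
Proof.
move=> hx hy; apply: le_trans (cnormM _ _) _.
by rewrite mulr_ile1 ?cnorm_ge0.
Qed.

Lemma cnormMl_le x y : cnorm x <= 1 -> cnorm (x * y) <= cnorm y.
Proof.
move=> hx; apply: le_trans (cnormM _ _) _.
by rewrite ler_piMl ?cnorm_ge0.
Qed.

Lemma cnormMr_le x y : cnorm y <= 1 -> cnorm (x * y) <= cnorm x.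
Proof.
move=> hx; apply: le_trans (cnormM _ _) _.
by rewrite ler_piMr ?cnorm_ge0.
Qed.

Lemma cnorm_le0 x : (forall e : R, 0 < e -> cnorm x <= e) -> x = 0.
Proof.
move=> h; apply: cnorm_eq0; apply/le_anti; rewrite cnorm_ge0 andbT.
by apply/ler_addgt0Pr => e e0; rewrite add0r h.
Qed.

Definition is_proj x := star x = x /\ x * x = x.

Lemma cnorm_proj x : is_proj x -> cnorm x <= 1.
Proof.
case=> sx xx; have [->|nx] := eqVneq (cnorm x) 0; first exact: ler01.
have x0 : 0 < cnorm x by rewrite lt_neqAle eq_sym nx cnorm_ge0.
by rewrite -(ler_pM2r x0) -expr2 -cnorm_star sx xx mul1r.
Qed.

Lemma is_proj1 : is_proj 1.
Proof. by split; rewrite ?star1 ?mulr1. Qed.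

Lemma is_proj0 : is_proj 0.
Proof. by split; rewrite ?star0 ?mulr0. Qed.

Lemma proj_mul_sym x y : is_proj x -> is_proj y -> x * y = x -> y * x = x.
Proof. by move=> [sx _] [sy _] h; rewrite -[y]sy -{1}[x]sx -starM h. Qed.

Lemma proj_ortho_sym x y : is_proj x -> is_proj y -> x * y = 0 -> y * x = 0.
Proof. by move=> [sx _] [sy _] h; rewrite -[y]sy -{1}[x]sx -starM h star0. Qed.

Lemma projB x y : is_proj x -> is_proj y -> y * x = y -> is_proj (x - y).
Proof.
move=> px py h; have h' := proj_mul_sym py px h.
case: px py => [sx xx] [sy yy]; split; first by rewrite starB sx sy.
by rewrite mulrBr !mulrBl xx h h' yy subrr subr0.
Qed.

Lemma projC x : is_proj x -> is_proj (1 - x).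
Proof. by move=> px; apply: projB => //; [exact: is_proj1|rewrite mulr1]. Qed.

Lemma projD x y : is_proj x -> is_proj y -> x * y = 0 -> is_proj (x + y).
Proof.
move=> px py h; have h' := proj_ortho_sym px py h.
case: px py => [sx xx] [sy yy]; split; first by rewrite starD sx sy.
by rewrite mulrDr !mulrDl xx yy h h' addr0 add0r.
Qed.

(* Source [p], range [q]. *)
Definition piso p q y := star y * y = p /\ y * star y = q.

(** By the C*-identity [y * p - y] vanishes: the four terms of [star (y * p - y) * (y * p - y)] all
    equal [p] up to signs that cancel. *)
Lemma piso_proj p q y : is_proj p -> piso p q y ->
  [/\ y * p = y, q * y = y & is_proj q].
Proof.
move=> [sp pp] [h1 h2]; have yp : y * p = y.
  apply/eqP; rewrite -subr_eq0; apply/eqP/star_mul_eq0.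
  by rewrite starB starM sp mulrBr !mulrBl -!mulrA !(mulKx h1) h1 !pp !subrr.
have qy : q * y = y by rewrite -h2 -mulrA h1.
split=> //; split; first by rewrite -h2 starM starK.
by rewrite -{2}h2 mulrA qy h2.
Qed.

Lemma piso_sym p q y : piso p q y -> piso q p (star y).
Proof. by case=> h1 h2; split; rewrite ?starK. Qed.

Definition unitary x := star x * x = 1 /\ x * star x = 1.

Lemma unitary1 : unitary 1.
Proof. by split; rewrite star1 mulr1. Qed.

Lemma unitaryM x y : unitary x -> unitary y -> unitary (x * y).
Proof.
move=> [x1 x2] [y1 y2]; split; rewrite starM mulrA.
  by rewrite -[_ * _ * x]mulrA x1 mulr1.
by rewrite -[_ * star y]mulrA y2 mulr1.
Qed.

Lemma unitaryV x : unitary x -> unitary (star x).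
Proof. by case=> h1 h2; split; rewrite starK. Qed.

Lemma unitaryX x k : unitary x -> unitary (x ^+ k).
Proof.
move=> ux; elim: k => [|k ih]; first exact: unitary1.
by rewrite exprS; exact: unitaryM.
Qed.

Lemma isometry_norm x : star x * x = 1 -> cnorm x <= 1.
Proof. by move=> h; apply: cnorm_le1; rewrite h cnorm1. Qed.

Lemma unitary_norm x : unitary x -> cnorm x <= 1.
Proof. by case=> h _; exact: isometry_norm. Qed.

Lemma unitary_mulKl x y : unitary x -> star x * (x * y) = y.
Proof. by case=> h _; rewrite mulrA h mul1r. Qed.

Lemma unitary_mulKr x y : unitary x -> x * (star x * y) = y.
Proof. by case=> _ h; rewrite mulrA h mul1r. Qed.

Lemma unitary_distl x y z : unitary x -> cnorm (x * y - x * z) = cnorm (y - z).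
Proof.
move=> ux; apply/le_anti; rewrite -mulrBr cnormMl_le ?unitary_norm //=.
rewrite -{1}(unitary_mulKl (y - z) ux) cnormMl_le // cnorm_starE.
exact: unitary_norm.
Qed.

Lemma unitary_distr x y z : unitary x -> cnorm (y * x - z * x) = cnorm (y - z).
Proof.
move=> ux; rewrite -cnorm_starE starB !starM unitary_distl; last exact: unitaryV.
by rewrite -starB cnorm_starE.
Qed.

End Basics.

(** * Limits and square roots *)

Section RealLimits.
Variable R : realType.

Lemma bernoulli (h : R) n : 0 <= h -> 1 + h *+ n <= (1 + h) ^+ n.
Proof.
move=> h0; elim: n => [|n ih]; first by rewrite mulr0n addr0 expr0.
rewrite exprSr mulrDr mulr1 mulrSr addrA lerD //.
rewrite ler_peMl //; apply: le_trans ih.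
by rewrite lerDl mulrn_wge0.
Qed.

Lemma expr_unbounded (q B : R) : 1 < q -> exists n, B < q ^+ n.
Proof.
move=> q1; have h0 : 0 < q - 1 by rewrite subr_gt0.
have [n hn] : exists n, B / (q - 1) < n%:R.
  have [B0|B0] := leP 0 (B / (q - 1)).
    by exists (Num.bound (B / (q - 1))); apply: archi_boundP.
  by exists 0%N.
exists n; have := bernoulli n (ltW h0); rewrite subrKC; apply: lt_le_trans.
rewrite ltr_wpDl // -mulr_natr -ltr_pdivrMl //.
by rewrite mulrC.
Qed.

Lemma expr_small (c e : R) : 0 <= c -> c < 1 -> 0 < e ->
  exists N, forall n, (N <= n)%N -> c ^+ n < e.
Proof.
move=> c0 c1 e0; have [->|nc] := eqVneq c 0.
  by exists 1%N => -[|n] // _; rewrite expr0n.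
have cp : 0 < c by rewrite lt_neqAle eq_sym nc.
have ci : 1 < c^-1 by rewrite invf_gt1.
have [N hN] := expr_unbounded e^-1 ci.
exists N => n le; apply: le_lt_trans (_ : c ^+ N < e).
  by rewrite ler_wiXn2l // ltW.
by rewrite -ltf_pV2 ?posrE ?exprn_gt0 // -exprVn.
Qed.

Lemma inv_small (e : R) : 0 < e -> exists N : nat, forall n, (N <= n)%N -> n.+1%:R^-1 < e.
Proof.
move=> e0; exists (Num.bound e^-1) => n le.
rewrite -ltf_pV2 ?posrE ?invr_gt0 ?ltr0Sn // invrK.
have := @archi_boundP _ e^-1; rewrite invr_ge0 ltW // => /(_ isT) h.
by apply: lt_le_trans h _; rewrite ler_nat (leq_trans le).
Qed.

End RealLimits.

Section Limits.
Variables (R : realType) (D : cstarAlgType R).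
Implicit Types (x y z : D) (u v : nat -> D).

Definition cvto u l :=
  forall e : R, 0 < e -> exists N, forall n, (N <= n)%N -> cnorm (u n - l) < e.

Lemma cvto_cst x : cvto (fun=> x) x.
Proof. by move=> e e0; exists 0%N => n _; rewrite subrr cnorm0. Qed.

Lemma cvto_uniq u x y : cvto u x -> cvto u y -> x = y.
Proof.
move=> hx hy; apply/eqP; rewrite -subr_eq0; apply/eqP/cnorm_le0 => e e0.
have e2 : 0 < e / 2 by rewrite divr_gt0.
have [N hN] := hx _ e2; have [M hM] := hy _ e2; pose n := maxn N M.
have := hN n (leq_maxl _ _); have := hM n (leq_maxr _ _).
rewrite [cnorm (_ - x)]cnormC => h1 h2.
apply: le_trans (cnorm_tri (u n) _ _) _; lra.
Qed.

Lemma cvtoD u v x y : cvto u x -> cvto v y -> cvto (fun n => u n + v n) (x + y).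
Proof.
move=> hx hy e e0; have e2 : 0 < e / 2 by rewrite divr_gt0.
have [N hN] := hx _ e2; have [M hM] := hy _ e2; exists (maxn N M) => n.
rewrite geq_max => /andP[/hN h1 /hM h2]; rewrite opprD addrACA.
by apply: le_lt_trans (cnormD _ _) _; lra.
Qed.

Lemma cvtoMl z u x : cvto u x -> cvto (fun n => z * u n) (z * x).
Proof.
move=> hx e e0; have z0 := cnorm_ge0 z.
have e2 : 0 < e / (cnorm z + 1) by rewrite divr_gt0 ?ltr_wpDl.
have [N hN] := hx _ e2; exists N => n /hN h; rewrite -mulrBr.
apply: le_lt_trans (cnormM _ _) _; move: h; rewrite ltr_pdivlMr ?ltr_wpDl //.
by have := cnorm_ge0 (u n - x); nra.
Qed.

Lemma cvto_star u x : cvto u x -> cvto (fun n => star (u n)) (star x).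
Proof.
by move=> hx e e0; have [N hN] := hx _ e0; exists N => n /hN; rewrite -starB cnorm_starE.
Qed.

Lemma cvtoMr z u x : cvto u x -> cvto (fun n => u n * z) (x * z).
Proof.
move=> /cvto_star/(cvtoMl (star z))/cvto_star h e e0.
by have [N hN] := h _ e0; exists N => n /hN; rewrite !starM !starK.
Qed.

Lemma cvtoM u v x y : cvto u x -> cvto v y -> cvto (fun n => u n * v n) (x * y).
Proof.
move=> hx hy e e0; have e2 : 0 < e / 2 by rewrite divr_gt0.
have [N1 h1] := hx _ ltr01; have y0 := cnorm_ge0 y; have x0 := cnorm_ge0 x.
have e3 : 0 < e / 2 / (cnorm x + 1) by rewrite divr_gt0 ?ltr_wpDl.
have [N2 h2] := hy _ e3; have [N3 h3] := cvtoMr y hx e2.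
exists (maxn N1 (maxn N2 N3)) => n; rewrite !geq_max => /and3P[/h1 a1 /h2 a2 /h3 a3].
rewrite -[_ - _](subrKA (u n * y)) -mulrBr.
apply: le_lt_trans (cnormD _ _) _; rewrite [e]splitr; apply: ler_ltD => //.
apply: le_trans (cnormM _ _) _; move: a2; rewrite ltr_pdivlMr ?ltr_wpDl // => a2.
have : cnorm (u n) <= cnorm x + 1.
  by rewrite -[u n](subrK x); apply: le_trans (cnormD _ _) _; lra.
by have := cnorm_ge0 (v n - y); nra.
Qed.

Lemma geometric_cvto u (c B : R) : 0 <= c -> c < 1 ->
  (forall n, cnorm (u n.+1 - u n) <= B * c ^+ n) -> exists l, cvto u l.
Proof.
move=> c0 c1 hu; have c1' : 0 < 1 - c by rewrite subr_gt0.
have B0 : 0 <= B by have := hu 0%N; rewrite expr0 mulr1; apply: le_trans; exact: cnorm_ge0.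
have hu2 n k : cnorm (u (n + k)%N - u n) <= B * c ^+ n / (1 - c).
  suff : cnorm (u (n + k)%N - u n) <= B * c ^+ n * (1 - c ^+ k) / (1 - c).
    move/le_trans; apply; rewrite ler_pM2r ?invr_gt0 // ler_piMr //.
      by rewrite mulr_ge0 ?exprn_ge0.
    by rewrite gerBl exprn_ge0.
  elim: k => [|k ih]; first by rewrite addn0 subrr cnorm0 expr0 subrr mulr0 mul0r.
  rewrite addnS; apply: le_trans (cnorm_tri (u (n + k)%N) _ _) _.
  apply: le_trans (lerD (hu _) ih) _; rewrite ler_pdivlMr // mulrDl divfK ?gt_eqF //.
  by rewrite exprD exprS le_eqVlt; apply/orP; left; apply/eqP; ring.
apply: cnorm_complete => e e0.
have e2 : 0 < e * (1 - c) / 2 / (B + 1) 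
  by apply: divr_gt0; [apply: divr_gt0 => //; apply: mulr_gt0|rewrite ltr_wpDl].
have [N hN] := expr_small c0 c1 e2; exists N => m n Nm Nn.
have key k : (N <= k)%N -> cnorm (u k - u N) < e / 2.
  move=> Nk; have := hu2 N (k - N)%N; rewrite subnKC // => /le_lt_trans; apply.
  rewrite ltr_pdivrMr //; have := hN N (leqnn _); rewrite ltr_pdivlMr ?ltr_wpDl //.
  by have := exprn_ge0 N c0; nra.
have := key _ Nn; rewrite cnormC => a1; have := key _ Nm => a2.
by apply: le_lt_trans (cnorm_tri (u N) _ _) _; lra.
Qed.

End Limits.

Section SquareRoot.
Variables (R : realType) (D : cstarAlgType R).
Implicit Types x y z : D.

Lemma starZr (r : R) x : star (r%:C *: x) = r%:C *: star x.
Proof. by rewrite starZ conjc_real. Qed.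

Let half := (2^-1 : R)%:C.

Lemma half2 x : half *: (x + x) = x.
Proof.
rewrite -mulr2n -scaler_nat scalerA.
have -> : half * 2%:R = 1.
  by rewrite -(rmorph_nat (real_complex R)) -rmorphM /= mulVf // pnatr_eq0.
by rewrite scale1r.
Qed.

Lemma norm_half x y b : cnorm x <= b -> cnorm y <= b -> cnorm (half *: (x + y)) <= b.
Proof.
move=> hx hy; rewrite cnormZr gtr0_norm ?invr_gt0 ?ltr0n //.
by have := cnormD x y; lra.
Qed.

(** A fixed point [l] satisfies [l + l = x + l * l], so that [1 - l] is a square root of [1 - x]. *)
Fixpoint sqrt_iter x n : D := if n is k.+1 then half *: (x + sqrt_iter x k * sqrt_iter x k) else 0.

Lemma csqrt x (r : R) : star x = x -> cnorm x <= r -> r < 1 ->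
  exists k, [/\ star k = k, k * k = 1 - x & forall z, z * x = x * z -> z * k = k * z].
Proof.
move=> sx xr r1; have r0 : 0 <= r by apply: le_trans xr; exact: cnorm_ge0.
(* [c] is the fixed point of the scalar iteration [t -> (r + t ^+ 2) / 2]. It bounds all iterates
   and is also the ratio by which their differences shrink. *)
pose c := 1 - Num.sqrt (1 - r); pose y := sqrt_iter x.
have s0 : 0 < Num.sqrt (1 - r) by rewrite sqrtr_gt0 subr_gt0.
have ss : Num.sqrt (1 - r) ^+ 2 = 1 - r by rewrite sqr_sqrtr // subr_ge0 ltW.
have cr : r + c ^+ 2 = c + c.
  by rewrite /c sqrrB ss expr1n; ring.
have c1 : c < 1 by rewrite /c; lra.
have c0 : 0 <= c by have := sqr_ge0 c; lra.
have ylt n : cnorm (y n) <= c.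
  rewrite /y; elim: n => [|n ih] /=; first by rewrite cnorm0.
  rewrite cnormZr gtr0_norm ?invr_gt0 ?ltr0n //.
  rewrite -/(y n) in ih *; have := cnormD x (y n * y n); have := cnormM (y n) (y n).
  have := cnorm_ge0 (y n) => a1 a2 a3.
  have : cnorm (y n) * cnorm (y n) <= c ^+ 2 by rewrite expr2 ler_pM.
  by lra.
have ystep n : cnorm (y n.+1 - y n) <= 1 * c ^+ n.
  rewrite mul1r; elim: n => [|n ih].
    rewrite /y /= mulr0 addr0 subr0 expr0 cnormZr gtr0_norm ?invr_gt0 ?ltr0n //.
    by lra.
  have -> : y n.+2 - y n.+1 =
     half *: (y n.+1 * (y n.+1 - y n) + (y n.+1 - y n) * y n).
    rewrite [y n.+2]/= [X in _ - X = _]/= -scalerBr; congr (_ *: _).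
    by rewrite -!/(y _) opprD addrACA subrr add0r mulrBr mulrBl addrA subrK.
  by apply: norm_half; apply: le_trans (cnormM _ _) _; [rewrite exprS|rewrite exprSr];
    rewrite ler_pM ?cnorm_ge0 ?ylt.
have [l hl] := geometric_cvto c0 c1 ystep.
have lE : l + l = x + l * l.
  apply: (@cvto_uniq _ _ (fun n => y n.+1 + y n.+1)).
    have h : cvto (fun n => y n.+1) l.
      by move=> e e0; have [N hN] := hl e e0; exists N => n Nn; apply: hN; apply: leqW.
    exact: cvtoD.
  have h : cvto (fun n => x + y n * y n) (x + l * l).
    by apply: cvtoD; [exact: cvto_cst|exact: cvtoM].
  move=> e e0; have [N hN] := h e e0; exists N => n /hN.
  by rewrite [y n.+1]/= -scalerDr half2.
have sl : star l = l.
  apply: (cvto_uniq (cvto_star hl)) => e e0; have [N hN] := hl e e0; exists N => n /hN.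
  suff -> : star (y n) = y n by [].
  rewrite /y; elim: n => [|n ih] /=; first by rewrite star0.
  by rewrite starZr starD starM sx ih.
exists (1 - l); split; first by rewrite starB star1 sl.
  have -> : x = l + l - l * l by rewrite lE addrK.
  by rewrite mulrBr mulr1 mulrBl mul1r -addrA -opprD addrA.
move=> z zx; rewrite mulrBr mulrBl mulr1 mul1r; congr (_ - _).
apply: (cvto_uniq (cvtoMl z hl)) => e e0; have [N hN] := cvtoMr z hl e0; exists N => n /hN.
suff -> : z * y n = y n * z by [].
rewrite /y; elim: n => [|n ih] /=; first by rewrite mulr0 mul0r.
by rewrite -scalerAr -scalerAl mulrDr mulrDl zx mulrA ih -mulrA ih mulrA.
Qed.

End SquareRoot.

Section CommSquares.
Variable A : pzRingType.
Implicit Types a b : A.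

Lemma comm_diffl a b : a * b = b * a -> (a - b) * (a + b) = a * a - b * b.
Proof. by move=> ab; rewrite mulrDr !mulrBl ab addrA subrK. Qed.

Lemma comm_diffr a b : a * b = b * a -> (a + b) * (a - b) = a * a - b * b.
Proof. by move=> ab; rewrite mulrBr !mulrDl ab opprD addrA addrK. Qed.
End CommSquares.

(** * Homomorphisms are automatically contractive *)

Section Contractive.
Variables (R : realType) (A : cstarAlgType R).
Implicit Types h k : A.

Definition iscale k : A := 'i *: k.

Lemma star_iscale k : star (iscale k) = - iscale (star k).
Proof.
rewrite /iscale starZ; have -> : conjc 'i = - 'i :> R[i].
  by apply/eqP; rewrite eq_complex /= oppr0 !eqxx.
by rewrite scaleNr.
Qed.

Lemma iscaleM k : iscale k * iscale k = - (k * k).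
Proof.
rewrite /iscale -scalerAl -scalerAr scalerA.
have -> : 'i * 'i = -1 :> R[i] by rewrite -expr2 sqr_i.
by rewrite scaleN1r.
Qed.

Lemma iscale_comm h k : h * k = k * h -> h * iscale k = iscale k * h.
Proof. by rewrite /iscale -scalerAl -scalerAr => ->. Qed.

Lemma iscale_starM h k : star h = h -> star k = k -> h * k = k * h ->
  star (h + iscale k) * (h + iscale k) = h * h + k * k
  /\ (h + iscale k) * star (h + iscale k) = h * h + k * k.
Proof.
move=> sh sk /iscale_comm hk; rewrite starD sh star_iscale sk.
by rewrite comm_diffl // comm_diffr // iscaleM opprK.
Qed.

Lemma cnorm_re h k b : star h = h -> star k = k ->
  cnorm (h + iscale k) <= b -> cnorm h <= b.
Proof.
move=> sh sk hb; have -> : h = (2^-1 : R)%:C *: ((h + iscale k) + star (h + iscale k)).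
  by rewrite starD sh star_iscale sk addrACA subrr addr0 half2.
by apply: norm_half; rewrite ?cnorm_starE.
Qed.

End Contractive.

Section Contractive.
Variables (R : realType) (A B : cstarAlgType R) (f : {lrmorphism A -> B}).
Hypothesis fs : star_morphism f.

Lemma rmorph_unitary u : unitary u -> unitary (f u).
Proof. by case=> h1 h2; split; rewrite -fs -rmorphM ?h1 ?h2 rmorph1. Qed.

(* If [k = sqrt (1 - h^2)] then [h + i k] is unitary. *)
Lemma sa_contractive1 h : star h = h -> cnorm h < 1 -> cnorm (f h) <= 1.
Proof.
move=> sh h1; have h0 := cnorm_ge0 h.
have hh : cnorm (h * h) <= cnorm h by apply: cnormMr_le; exact: ltW.
have shh : star (h * h) = h * h by rewrite starM sh.
have [k [sk kk kh]] := csqrt shh hh h1.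
have hk : h * k = k * h by apply: kh; rewrite mulrA.
have [u1 u2] := iscale_starM sh sk hk.
have uu : unitary (h + iscale k) by split; rewrite ?u1 ?u2 kk subrKC.
apply: (@cnorm_re _ _ _ (f k)); rewrite -?fs ?sh ?sk //.
have -> : f h + iscale (f k) = f (h + iscale k) by rewrite rmorphD /= /iscale linearZ.
exact/unitary_norm/rmorph_unitary.
Qed.

Lemma contractive x : cnorm (f x) <= cnorm x.
Proof.
have sa h : star h = h -> cnorm (f h) <= cnorm h.
  move=> sh; rewrite leNgt; apply/negP => hlt.
  (* Strictly between the two norms: after division by [t] the element falls under
     [sa_contractive1], while its image would have norm above [1]. *)
  pose t := (cnorm h + cnorm (f h)) / 2.
  have h0 := cnorm_ge0 h; have t0 : 0 < t by rewrite /t; lra.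
  have : cnorm (f (t^-1%:C *: h)) <= 1.
    apply: sa_contractive1; first by rewrite starZr sh.
    by rewrite cnormZr gtr0_norm ?invr_gt0 // ltr_pdivrMl // mulr1 /t; lra.
  rewrite linearZ /= cnormZr gtr0_norm ?invr_gt0 // ler_pdivrMl // mulr1 /t; lra.
have := sa (star x * x); rewrite starM starK rmorphM /= fs !cnorm_star => /(_ erefl).
by rewrite ler_pXn2r ?nnegrE ?cnorm_ge0.
Qed.

End Contractive.

(** * Projections with sum one are orthogonal *)

Section Projections.
Variables (R : realType) (D : cstarAlgType R).
Implicit Types a b e p : D.

Lemma scalerr (r s : R) a : r%:C *: (s%:C *: a) = (r * s)%:C *: a.
Proof. by rewrite scalerA -rmorphM. Qed.

(* The bounds say that [a] and [- a] are positive in the corner with unit [e]. *)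
Lemma pos_neg_eq0 e a (s : R) : is_proj e -> star a = a -> e * a = a -> a * e = a ->
  0 <= s -> cnorm (e - a) <= 1 -> cnorm (s%:C *: e + a) <= s -> a = 0.
Proof.
move=> pe sa ea ae s0 h1 h2; case: (pe) => se ee.
(* Dividing by [s + 1] makes the two bounds symmetric: both [e - b] and [e + b] become
   contractions. *)
pose K := s + 1; have K0 : 0 < K by rewrite /K; lra.
have ne := cnorm_proj pe.
pose b := K^-1%:C *: a.
have scK r x : cnorm (K%:C *: x) <= r * K -> cnorm x <= r.
  by rewrite cnormZr gtr0_norm // mulrC ler_pM2r.
have Kb : K%:C *: b = a by rewrite /b scalerr mulfV ?gt_eqF // scale1r.
have hm : cnorm (e - b) <= 1.
  apply: scK; rewrite scalerBr Kb mul1r.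
  have -> : K%:C *: e - a = s%:C *: e + (e - a).
    by rewrite /K rmorphD /= scalerDl scale1r addrA.
  apply: le_trans (cnormD _ _) _; rewrite /K lerD //.
  by rewrite cnormZr ger0_norm // ler_piMr.
have hp : cnorm (e + b) <= 1.
  apply: scK; rewrite scalerDr Kb mul1r.
  have -> : K%:C *: e + a = (s%:C *: e + a) + e.
    by rewrite /K rmorphD /= scalerDl scale1r addrAC.
  by apply: le_trans (cnormD _ _) _; rewrite /K lerD.
have sb : star b = b by rewrite /b starZr sa.
have eb : e * b = b by rewrite /b -scalerAr ea.
have be : b * e = b by rewrite /b -scalerAl ae.
clearbody b.
have hb : cnorm (e + b * b) <= 1.
  have -> : e + b * b = (2^-1 : R)%:C *: ((e + b) * (e + b) + (e - b) * (e - b)).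
    rewrite !(mulrDr, mulrDl, mulrN, mulNr) ee eb be -[e + b * b]half2.
    by congr (_ *: _); abel.
  by apply: norm_half; apply: cnormM_le1.
(* For [r > 1] the element [r e - (e + b * b)] has a self-adjoint square root [d] commuting with
   [b]. Then [b + i d] has squared norm at most [r - 1], and [b] is its real part. *)
have bound (r : R) : 1 < r -> cnorm b ^+ 2 <= r - 1.
  move=> r1; have r0 : 0 < r by lra.
  pose x := r^-1%:C *: (e + b * b).
  have sx : star x = x by rewrite /x starZr starD starM sb se.
  have nx : cnorm x <= r^-1.
    by rewrite /x cnormZr gtr0_norm ?invr_gt0 // ler_piMr // invr_ge0 ltW.
  have [|k [sk kk kc]] := csqrt sx nx; first by rewrite invf_lt1.
  have ek : e * k = k * e.
    by apply: kc; rewrite /x -scalerAr -scalerAl mulrDr mulrDl ee mulrA eb -mulrA be.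
  have bk : b * k = k * b.
    by apply: kc; rewrite /x -scalerAr -scalerAl mulrDr mulrDl eb be mulrA.
  pose d := (Num.sqrt r)%:C *: (e * k).
  have sd : star d = d by rewrite /d starZr starM sk se ek.
  have dd : d * d = r%:C *: e - (e + b * b).
    rewrite /d -scalerAl -scalerAr scalerr -expr2 sqr_sqrtr ?ltW //.
    have -> : e * k * (e * k) = e * (k * k) by rewrite -!mulrA (mulrA k) -ek !mulrA ee.
    rewrite kk mulrBr mulr1 scalerBr /x -scalerAr scalerr mulfV ?gt_eqF // scale1r.
    by rewrite mulrDr ee mulrA eb.
  have bd : b * d = d * b by rewrite /d -scalerAl -scalerAr mulrA be -mulrA -bk mulrA eb.
  have [h _] := iscale_starM sb sd bd.
  have hn : cnorm (b + iscale d) ^+ 2 <= r - 1.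
    rewrite -cnorm_star h dd.
    have -> : b * b + (r%:C *: e - (e + b * b)) = (r - 1)%:C *: e.
      by rewrite rmorphB /= scalerBl scale1r; abel.
    rewrite cnormZr gtr0_norm ?subr_gt0 // ler_piMr // subr_ge0 ltW //.
  apply: le_trans hn; rewrite ler_pXn2r ?nnegrE ?cnorm_ge0 //.
  exact: (cnorm_re sb sd).
have : cnorm b ^+ 2 <= 0.
  by apply/ler_addgt0Pr => t t0; rewrite add0r; have := bound (1 + t); rewrite addrAC subrr add0r; apply; lra.
rewrite exprn_even_le0 //= => /eqP /cnorm_eq0 b0.
by rewrite -Kb b0 scaler0.
Qed.

(** Compressing the sum by [p i] shows that [a = p i * p j * p i] is minus the sum of the other
    compressions [p i * p k * p i]. So [a] and [- a] are both positive in the corner of [p i],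
    whence [a = 0]. Orthogonality is not among the relations of a family and is derived from
    this. *)
Lemma projs_ortho (I : finType) (p : I -> D) :
  (forall i, is_proj (p i)) -> \sum_i p i = 1 -> forall i j, i != j -> p i * p j = 0.
Proof.
move=> pp s1 i j ij; have [si ii] := pp i; have ni := cnorm_proj (pp i).
have H k : cnorm (p i - p i * p k * p i) <= 1.
  have -> : p i - p i * p k * p i = p i * (1 - p k) * p i by rewrite mulrBr mulr1 mulrBl ii.
  by rewrite !cnormM_le1 //; apply/cnorm_proj/projC.
have aE : p i * p j * p i = - \sum_(k | (k != i) && (k != j)) p i * p k * p i.
  apply/eqP; rewrite -addr_eq0; apply/eqP.
  have : p i * (\sum_k p k) * p i = p i by rewrite s1 mulr1 ii.
  rewrite mulr_sumr mulr_suml (bigD1 i) //= (bigD1 j) ?[j == i]eq_sym //= !ii.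
  by move=> /(canRL (addKr _)); rewrite addNr.
suff a0 : p i * p j * p i = 0.
  have [sj jj] := pp j.
  suff h : p j * p i = 0 by apply: (proj_ortho_sym (pp j) (pp i)).
  by apply: star_mul_eq0; rewrite starM si sj -mulrA (mulKx jj) mulrA.
pose S := [set k | (k != i) && (k != j)].
apply: (@pos_neg_eq0 (p i) _ #|S|%:R) => //.
- by have [sj jj] := pp j; rewrite !starM si sj mulrA.
- by rewrite !mulrA ii.
- by rewrite -!mulrA ii.
rewrite aE [X in X + _](_ : _ = \sum_(k in S) p i); last first.
  by rewrite sumr_const rmorph_nat scaler_nat.
rewrite [X in - X](eq_bigl [in S]); last by move=> k; rewrite inE.
rewrite -sumrB; apply: le_trans (cnorm_sum _ _ _) _.
by apply: le_trans (ler_sum _ (fun k _ => H k)) _; rewrite sumr_const.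
Qed.

End Projections.

(** * The norm of a diagonal sum *)

Section DiagNorm.
Variables (R : realType) (D : cstarAlgType R) (I : finType).
Implicit Types (s r d : I -> D).

Lemma cnorm_exp2 (x : D) n : star x = x -> cnorm (x ^+ (2 ^ n)) = cnorm x ^+ (2 ^ n).
Proof.
move=> sx; elim: n => [|n ih]; first by rewrite expn0 !expr1.
rewrite expnSr !exprM -ih -cnorm_star expr2.
suff -> : star (x ^+ (2 ^ n)) = x ^+ (2 ^ n) by [].
elim: (2 ^ n)%N => [|k ihk]; first by rewrite expr0 star1.
by rewrite exprSr starM ihk sx -exprS -exprSr.
Qed.

Definition ortho_isometries s := forall i j, star (s i) * s j = (i == j)%:R.

Lemma diag_mul s d d' : ortho_isometries s ->
  (\sum_i s i * d i * star (s i)) * (\sum_i s i * d' i * star (s i))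
  = \sum_i s i * (d i * d' i) * star (s i).
Proof.
move=> os; rewrite mulr_suml; apply: eq_bigr => i _; rewrite mulr_sumr (bigD1 i) //=.
rewrite -!mulrA (mulrA (star (s i)) (s i)) os eqxx mul1r big1 ?addr0 // => j ji.
by rewrite -!mulrA (mulrA (star (s i)) (s j)) os eq_sym (negPf ji) !(mul0r, mulr0).
Qed.

(* The [2^n]-th power of [x^* x] is again a diagonal sum. *)
Lemma diag_norm s r d (e : R) : ortho_isometries s -> ortho_isometries r -> 0 <= e ->
  (forall i, cnorm (d i) <= e) -> cnorm (\sum_i s i * d i * star (r i)) <= e.
Proof.
move=> os or e0 hd; set x := \sum_i _.
have xx : star x * x = \sum_i r i * (star (d i) * d i) * star (r i).
  rewrite /x star_sum mulr_suml; apply: eq_bigr => i _.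
  rewrite mulr_sumr (bigD1 i) //= !starM starK -!mulrA (mulrA (star (s i)) (s i)) os eqxx mul1r.
  rewrite big1 ?addr0 // => j ji.
  by rewrite -!mulrA (mulrA (star (s i)) (s j)) os eq_sym (negPf ji) !(mul0r, mulr0).
have xk k : (star x * x) ^+ k.+1 = \sum_i r i * (star (d i) * d i) ^+ k.+1 * star (r i).
  elim: k => [|k ih]; first by rewrite expr1 xx.
  by rewrite exprS ih xx diag_mul //; apply: eq_bigr => i _; rewrite exprS.
have r1 i : cnorm (r i) <= 1 by apply: isometry_norm; rewrite or eqxx.
(* The triangle inequality costs a factor [#|I|], which does not depend on [n] and is lost as the
   exponent grows. *)
have bnd n : cnorm x ^+ (2 * 2 ^ n) <= #|I|%:R * e ^+ (2 * 2 ^ n).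
  rewrite exprM -cnorm_star -cnorm_exp2; last by rewrite starM starK.
  rewrite -(prednK (expn_gt0 2 n)) xk.
  apply: le_trans (cnorm_sum _ _ _) _; rewrite mulr_natl -sumr_const; apply: ler_sum => i _.
  rewrite -!mulrA; apply: le_trans (cnormMl_le _ _) _ => //.
  apply: le_trans (cnormMr_le _ _) _; first by rewrite cnorm_starE.
  elim: (_.-1) => [|k ih].
    by rewrite expr1 muln1 cnorm_star ler_pXn2r ?nnegrE ?cnorm_ge0.
  rewrite exprS [X in e ^+ X]mulnS exprD; apply: le_trans (cnormM _ _) _.
  by rewrite ler_pM ?cnorm_ge0 // cnorm_star ler_pXn2r ?nnegrE ?cnorm_ge0.
rewrite leNgt; apply/negP => elt.
have x0 : 0 < cnorm x by apply: le_lt_trans elt.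
have [en|en] := eqVneq e 0.
  have := bnd 0%N; rewrite en expr0n /= mulr0 => h.
  by have := exprn_gt0 2 x0; rewrite ltNge h.
have ep : 0 < e by rewrite lt_neqAle eq_sym en.
have q1 : 1 < cnorm x / e by rewrite ltr_pdivlMr // mul1r.
have [n hn] := expr_unbounded #|I|%:R q1.
have := bnd n; rewrite leNgt => /negP; apply; rewrite -ltr_pdivlMr ?exprn_gt0 // -expr_div_n.
apply: lt_le_trans hn _; rewrite ler_weXn2l ?ltW //.
by apply: (@leq_trans (2 ^ n)); [exact/ltnW/ltn_expl|exact: leq_pmull].
Qed.

End DiagNorm.

(** * Homotopies of unitaries and K_1 *)

Section Chains.
Variables (R : realType) (D : cstarAlgType R).
Implicit Types (x y z g h w : D) (P : D -> Prop).

(** Real scalars suffice for the rotations below, and no closedness is asked for. The instances in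
    use are the whole algebra and commutants of range projections. *)
Record star_subalg P : Prop := StarSubalg {
  sa1 : P 1;
  saD : forall x y, P x -> P y -> P (x + y);
  saN : forall x, P x -> P (- x);
  saM : forall x y, P x -> P y -> P (x * y);
  saS : forall x, P x -> P (star x);
  saZ : forall (r : R) x, P x -> P (r%:C *: x) }.

Lemma saB P : star_subalg P -> forall x y, P x -> P y -> P (x - y).
Proof. by move=> h x y px py; apply: saD => //; apply: saN. Qed.

Lemma sa0 P : star_subalg P -> P 0.
Proof. by move=> h; rewrite -(subrr 1); apply: saB => //; apply: sa1. Qed.

Lemma saX P : star_subalg P -> forall x k, P x -> P (x ^+ k).
Proof.
move=> h x k px; elim: k => [|k ih]; first by rewrite expr0; apply: sa1.
by rewrite exprS; apply: saM.
Qed.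

Lemma sa_sum P : star_subalg P -> forall I (r : seq I) (Q : pred I) (F : I -> D),
  (forall i, P (F i)) -> P (\sum_(i <- r | Q i) F i).
Proof.
move=> h I r Q F hF; elim/big_rec: _ => [|i x _ px]; first exact: sa0.
by apply: saD.
Qed.

(** The conditions are imposed on all indices, also beyond [n], so that chains can be spliced and
    reversed without index bounds. *)
Definition chain P (e : R) x y := exists n (w : nat -> D),
  [/\ w 0%N = x, w n = y, forall k, unitary (w k) /\ P (w k)
    & forall k, cnorm (w k - w k.+1) <= e].

Lemma chain_step P e x y : unitary x -> P x -> unitary y -> P y ->
  0 <= e -> cnorm (x - y) <= e -> chain P e x y.
Proof.
move=> ux px uy py e0 h; exists 1%N, (fun k => if k is 0 then x else y).
by split=> // -[|k] //; rewrite subrr cnorm0.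
Qed.

Lemma chain_refl P e x : unitary x -> P x -> 0 <= e -> chain P e x x.
Proof. by move=> ux px e0; apply: chain_step => //; rewrite subrr cnorm0. Qed.

Lemma chain_trans P e y x z : chain P e x y -> chain P e y z -> chain P e x z.
Proof.
move=> [n [w [w0 wn wu we]]] [m [v [v0 vm vu ve]]].
exists (n + m)%N, (fun k => if (k < n)%N then w k else v (k - n)%N); split.
- by case: ltnP => //; rewrite leqn0 => /eqP n0; rewrite n0 subnn v0 -wn n0.
- by rewrite ltnNge leq_addr /= addKn.
- by move=> k; case: ifP.
move=> k; case: (ltnP k n) => kn; last first.
  by rewrite ltnNge (leq_trans kn) //= subSn.
case: (ltnP k.+1 n) => kn'; first exact: we.
by have -> : k.+1 = n; [apply/eqP; rewrite eqn_leq kn|rewrite subnn v0 -wn -(_ : k.+1 = n) ?we //; apply/eqP; rewrite eqn_leq kn].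
Qed.

Lemma chain_sym P e x y : chain P e x y -> chain P e y x.
Proof.
move=> [n [w [w0 wn wu we]]]; exists n, (fun k => w (n - k)%N); split=> //.
- by rewrite subn0.
- by rewrite subnn.
move=> k; case: (ltnP k n) => kn; first by rewrite cnormC subnS -{2}(prednK (_ : 0 < n - k)%N) ?subn_gt0.
rewrite (eqP (_ : (n - k == 0)%N)) ?subn_eq0 // (eqP (_ : (n - k.+1 == 0)%N)) ?subn_eq0 ?leqW //.
by rewrite subrr cnorm0; apply: le_trans (we 0%N); apply: cnorm_ge0.
Qed.

Lemma chain_mull P e z x y : star_subalg P -> unitary z -> P z ->
  chain P e x y -> chain P e (z * x) (z * y).
Proof.
move=> sp uz pz [n [w [w0 wn wu we]]]; exists n, (fun k => z * w k).
split; rewrite ?w0 ?wn // => k; last by rewrite unitary_distl.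
by have [uk pk] := wu k; split; [apply: unitaryM|apply: saM].
Qed.

Lemma chain_mulr P e z x y : star_subalg P -> unitary z -> P z ->
  chain P e x y -> chain P e (x * z) (y * z).
Proof.
move=> sp uz pz [n [w [w0 wn wu we]]]; exists n, (fun k => w k * z).
split; rewrite ?w0 ?wn // => k; last by rewrite unitary_distr.
by have [uk pk] := wu k; split; [apply: unitaryM|apply: saM].
Qed.

(** Stands in for a norm-continuous path of unitaries in [P]: only fine subdivisions are ever used,
    and these may change with [e]. *)
Definition homot P x y := forall e : R, 0 < e -> chain P e x y.

Lemma homot_refl P x : unitary x -> P x -> homot P x x.
Proof. by move=> ux px e /ltW; apply: chain_refl. Qed.

Lemma homot_trans P y x z : homot P x y -> homot P y z -> homot P x z.
Proof. by move=> h1 h2 e e0; apply: chain_trans (h1 e e0) (h2 e e0). Qed.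

Lemma homot_sym P x y : homot P x y -> homot P y x.
Proof. by move=> h e e0; apply/chain_sym/h. Qed.

Lemma homot_mull P z x y : star_subalg P -> unitary z -> P z ->
  homot P x y -> homot P (z * x) (z * y).
Proof. by move=> sp uz pz h e e0; apply: chain_mull => //; apply: h. Qed.

Lemma homot_mulr P z x y : star_subalg P -> unitary z -> P z ->
  homot P x y -> homot P (x * z) (y * z).
Proof. by move=> sp uz pz h e e0; apply: chain_mulr => //; apply: h. Qed.

Lemma homot_unitary P x y : homot P x y -> [/\ unitary x, P x, unitary y & P y].
Proof.
move=> /(_ 1 ltr01) [n [w [<- <- wu _]]].
by have [? ?] := wu 0%N; have [? ?] := wu n.
Qed.

(** The successive powers of a root of [x] close to [1] are the links of the chain. *)
Lemma homot_root P x : star_subalg P ->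
  (forall e : R, 0 < e -> exists y k, [/\ unitary y, P y, y ^+ k = x & cnorm (y - 1) <= e]) ->
  homot P 1 x.
Proof.
move=> sp h e e0; have [y [k [uy py <- ny]]] := h e e0.
elim: k => [|k ih].
  by rewrite expr0; apply: chain_refl; rewrite ?ltW //; [exact: unitary1|exact: sa1].
apply: chain_trans ih _.
apply: (chain_step (unitaryX k uy) (saX sp k py) (unitaryX k.+1 uy) (saX sp k.+1 py) (ltW e0)).
by rewrite exprSr -{1}[y ^+ k]mulr1 (unitary_distl _ _ (unitaryX k uy)) cnormC.
Qed.

Lemma homot_conj P x y : star_subalg P -> homot P 1 x -> unitary y -> P y ->
  homot P y (x * y * star x).
Proof.
move=> sp hx uy py; have [_ _ ux px] := homot_unitary hx.
apply: (@homot_trans _ (x * y)).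
  by rewrite -{1}[y]mul1r; apply: homot_mulr.
rewrite -{1}[x * y]mulr1; apply: homot_mull => //;
  [exact: unitaryM|exact: saM|].
rewrite -{1}(proj2 ux) -[X in homot _ _ X]mul1r; apply: homot_mulr; [| |exact: saS|exact: homot_sym] => //.
exact: unitaryV.
Qed.

Section Rotation.
Variables h J : D.
Hypotheses (ph : is_proj h) (hJ : h * J = J) (Jh : J * h = J)
  (JJ : J * J = - h) (sJ : star J = - J).

(** In the corner of [h] the element [J] is a complex structure; this is the rotation [c + s J]
    there, completed by [1] outside. *)
Definition rot (c s : R) : D := c%:C *: h + s%:C *: J + (1 - h).

Lemma rotM c s c' s' : rot c s * rot c' s' = rot (c * c' - s * s') (c * s' + s * c').
Proof.
have [sh hh] := ph; rewrite /rot.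
have e1 : h * (1 - h) = 0 by rewrite mulrBr mulr1 hh subrr.
have e2 : (1 - h) * h = 0 by rewrite mulrBl mul1r hh subrr.
have e3 : J * (1 - h) = 0 by rewrite mulrBr mulr1 Jh subrr.
have e4 : (1 - h) * J = 0 by rewrite mulrBl mul1r hJ subrr.
have e5 : (1 - h) * (1 - h) = 1 - h by rewrite mulrBr mulr1 e2 subr0.
set k := 1 - h in e1 e2 e3 e4 e5 *; clearbody k.
rewrite !(mulrDr, mulrDl) -!scalerAl -!scalerAr !scalerr ?hh ?hJ ?Jh ?JJ ?e1 ?e2 ?e3 ?e4 ?e5.
rewrite !scaler0 scalerN rmorphB rmorphD /= scalerBl scalerDl; abel.
Qed.

Lemma star_rot c s : star (rot c s) = rot c (- s).
Proof.
have [sh hh] := ph; rewrite /rot !starD !starZr sh sJ starN star1 sh.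
by rewrite rmorphN /= scaleNr scalerN.
Qed.

Lemma rot10 : rot 1 0 = 1.
Proof. by rewrite /rot scale1r scale0r addr0 subrKC. Qed.

Lemma rot_unitary c s : c ^+ 2 + s ^+ 2 = 1 -> unitary (rot c s).
Proof.
move=> cs; rewrite !expr2 in cs.
split; rewrite star_rot rotM -rot10; congr rot; lra.
Qed.

Lemma rot_dist c s : cnorm (rot c s - 1) <= `|c - 1| + `|s|.
Proof.
have -> : rot c s - 1 = (c - 1)%:C *: h + s%:C *: J.
  by rewrite /rot rmorphB /= scalerBl scale1r; abel.
have nh := cnorm_proj ph.
have nJ : cnorm J <= 1.
  by apply: cnorm_le1; rewrite sJ mulNr JJ opprK.
apply: le_trans (cnormD _ _) _; rewrite !cnormZr.
by rewrite lerD // ler_piMr.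
Qed.

(* Iterated half angles starting from the quarter turn. *)
Lemma rot_root m : exists c s : R, [/\ 0 <= c, 0 <= s, c ^+ 2 + s ^+ 2 = 1,
  1 - c <= 2^-1 ^+ m & rot c s ^+ (2 ^ m) = rot 0 1].
Proof.
elim: m => [|m [c [s [c0 s0 cs cm rm]]]].
  by exists 0, 1; rewrite !expr2 expn0 expr1 expr0; split => //; lra.
have p0 : 0 < (1 + c) / 2 by lra.
pose c' := Num.sqrt ((1 + c) / 2); have c'0 : 0 < c' by rewrite sqrtr_gt0.
have c'2 : c' ^+ 2 = (1 + c) / 2 by rewrite sqr_sqrtr // ltW.
pose s' := s / (2 * c').
have cs' : c' * s' = s / 2 by rewrite /s'; field; rewrite gt_eqF.
have s'2 : s' ^+ 2 = (1 - c) / 2.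
  have h1 : s ^+ 2 = (1 - c) * (1 + c) by rewrite !expr2 in cs *; lra.
  rewrite /s' expr_div_n exprMn c'2 h1; field; lra.
have c1 : c' <= 1.
  have : c <= 1 by rewrite -(@ler_pXn2r _ 2) ?nnegrE // expr1n; have := sqr_ge0 s; lra.
  by move=> c1; rewrite -(@ler_pXn2r _ 2) ?nnegrE ?(ltW c'0) // c'2 expr1n; lra.
exists c', s'; split; first exact: ltW.
- by rewrite /s' divr_ge0 // mulr_ge0 // ltW.
- by rewrite c'2 s'2; lra.
- apply: (@le_trans _ _ ((1 - c) / 2)); last by rewrite exprSr ler_pM2r ?invr_gt0.
  by rewrite -s'2; rewrite expr2 in c'2 *; rewrite expr2 in s'2; nra.
rewrite expnS exprM expr2 rotM -rm; congr (_ ^+ _); congr rot.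
  by rewrite -!expr2 c'2 s'2; lra.
by rewrite [s' * c']mulrC cs'; lra.
Qed.

Lemma rot_homot P : star_subalg P -> P h -> P J -> homot P 1 (rot 0 1).
Proof.
move=> sp ph' pJ; apply: homot_root => // e e0.
(* [1 - c <= e ^+ 2 / 8] gives [s <= e / 2], because [s ^+ 2 = (1 - c) * (1 + c)] and [1 + c <= 2];
   the other half of [e] is for [1 - c] itself. *)
have e1 : 0 < e ^+ 2 / 8 by rewrite divr_gt0 ?exprn_gt0.
have e2 : 0 < e / 2 by rewrite divr_gt0.
have m0 : 0 < Num.min (e ^+ 2 / 8) (e / 2) by rewrite lt_min e1.
have h2 : (2^-1 : R) < 1 by lra.
have h0 : (0 : R) <= 2^-1 by lra.
have [N hN] := expr_small h0 h2 m0.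
have [c [s [c0 s0 cs cm rm]]] := rot_root N.
exists (rot c s), (2 ^ N)%N; split => //; first exact: rot_unitary.
  by apply: (saD sp); [apply: (saD sp); apply: (saZ sp)|apply: (saB sp) => //; apply: (sa1 sp)].
have := hN N (leqnn _); rewrite lt_min => /andP[h3 h4].
apply: le_trans (rot_dist _ _) _; rewrite (ger0_norm s0) distrC.
have c1 : c <= 1 by rewrite -(@ler_pXn2r _ 2) ?nnegrE // expr1n; have := sqr_ge0 s; lra.
rewrite ger0_norm ?subr_ge0 //.
have : s <= e / 2; last by lra.
rewrite -(@ler_pXn2r _ 2) ?nnegrE ?(ltW e2) // expr_div_n.
have -> : s ^+ 2 = (1 - c) * (1 + c) by rewrite !expr2 in cs *; lra.
by nra.
Qed.

End Rotation.

End Chains.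

(** * Unitaries of corners and the rotation trick *)

Section PartialUnitaries.
Variables (R : realType) (D : cstarAlgType R).
Implicit Types (x y z g h w : D) (P : D -> Prop).

Definition punit g w := is_proj g /\ piso g g w.

Definition fullu g w := w + (1 - g).

Lemma punit_mul g w : punit g w -> g * w = w /\ w * g = w.
Proof. by case=> pg /(piso_proj pg)[]. Qed.

Lemma punit_star g w : punit g w -> punit g (star w).
Proof. by case=> pg /piso_sym. Qed.

Lemma punit_proj g : is_proj g -> punit g g.
Proof. by move=> [sg gg]; split=> //; split; rewrite sg gg. Qed.

Lemma punitM g w w' : punit g w -> punit g w' -> punit g (w * w').
Proof.
move=> pw pw'; have [gw wg] := punit_mul pw; have [gw' wg'] := punit_mul pw'.
have [sg gg] := proj1 pw; case: pw pw' => pg [w1 w2] [_ [w3 w4]].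
split=> //; split; rewrite starM -mulrA.
  by rewrite (mulKx w1) gw'.
by rewrite (mulKx w4) -{1}sg -starM wg.
Qed.

Lemma punitD g g' w w' : punit g w -> punit g' w' -> g * g' = 0 -> punit (g + g') (w + w').
Proof.
move=> pw pw' gg0; have [gw wg] := punit_mul pw; have [gw' wg'] := punit_mul pw'.
have [gv vg] := punit_mul (punit_star pw); have [gv' vg'] := punit_mul (punit_star pw').
have g0g := proj_ortho_sym (proj1 pw) (proj1 pw') gg0.
have c1 : star w' * w = 0 by rewrite -vg' -gw -mulrA (mulKx0 g0g) mulr0.
have c2 : star w * w' = 0 by rewrite -vg -gw' -mulrA (mulKx0 gg0) mulr0.
have c3 : w * star w' = 0 by rewrite -wg -gv' -mulrA (mulKx0 gg0) mulr0.
have c4 : w' * star w = 0 by rewrite -wg' -gv -mulrA (mulKx0 g0g) mulr0.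
case: pw pw' => pg [w1 w2] [pg' [w3 w4]]; split; first exact: projD.
by split; rewrite starD mulrDr !mulrDl ?w1 ?w2 ?w3 ?w4 ?c1 ?c2 ?c3 ?c4 addr0 add0r.
Qed.

Lemma punit_conj g w y : punit g w -> star y * (y * g) = g ->
  punit (y * g * star y) (y * w * star y).
Proof.
move=> pw yg; have [gw wg] := punit_mul pw; have [gv vg] := punit_mul (punit_star pw).
have yw : star y * (y * w) = w by rewrite -{1}gw (mulrA y) (mulrA (star y)) yg ?gw ?gv.
have yv : star y * (y * star w) = star w by rewrite -{1}gv (mulrA y) (mulrA (star y)) yg ?gw ?gv.
have ygx x : star y * (y * (g * x)) = g * x by rewrite (mulrA y) (mulrA (star y)) yg.
have ywx x : star y * (y * (w * x)) = w * x by rewrite (mulrA y) (mulrA (star y)) yw.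
have yvx x : star y * (y * (star w * x)) = star w * x.
  by rewrite (mulrA y) (mulrA (star y)) yv.
case: pw => [[sg gg] [w1 w2]].
split; split; rewrite ?starM ?starK ?sg -?mulrA //; first by rewrite ygx (mulKx gg).
  by rewrite ywx (mulKx w1).
by rewrite yvx (mulKx w2).
Qed.

Lemma fullu_unitary g w : punit g w -> unitary (fullu g w).
Proof.
move=> pw; have := punitD pw (punit_proj (projC (proj1 pw))).
have [sg gg] := proj1 pw; rewrite mulrBr mulr1 gg subrr => /(_ erefl)[_ [h1 h2]].
by split; [rewrite /fullu h1|rewrite /fullu h2]; rewrite subrKC.
Qed.

(** [J = y - star y] generates the rotations in the plane of [g] and [g']. The quarter turn is
    homotopic to [1], and conjugating by it carries [w] from the corner of [g] to that of [g']. *)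
Lemma swap_homot P g g' w y : star_subalg P -> is_proj g' -> g * g' = 0 ->
  punit g w -> piso g g' y -> P y -> P w -> homot P (fullu g w) (fullu g' (y * w * star y)).
Proof.
move=> sp pg' gg' pw py Py Pw; have pg := proj1 pw.
have Pg : P g by case: py => <- _; apply: (saM sp) => //; apply: (saS sp).
have Pg' : P g' by case: py => _ <-; apply: (saM sp) => //; apply: (saS sp).
have g'g := proj_ortho_sym pg pg' gg'.
have [yg g'y _] := piso_proj pg py; have [gw wg] := punit_mul pw.
have [sg gg] := pg; have [sg' g'g'] := pg'; have [y1 y2] := py.
have g_y : g * y = 0 by rewrite -g'y mulrA gg' mul0r.
have y_g' : y * g' = 0 by rewrite -yg -mulrA gg' mulr0.
have yy : y * y = 0 by rewrite -{2}g'y mulrA y_g' mul0r.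
have ysg : star y * g = 0 by rewrite -sg -starM g_y star0.
have gys : g * star y = star y by rewrite -{1}sg -starM yg.
have ysg' : star y * g' = star y by rewrite -sg' -starM g'y.
have g'ys : g' * star y = 0 by rewrite -sg' -starM y_g' star0.
have ysys : star y * star y = 0 by rewrite -starM yy star0.
have wy : w * y = 0 by rewrite -wg -mulrA g_y mulr0.
have wg' : w * g' = 0 by rewrite -wg -mulrA gg' mulr0.
have g'w : g' * w = 0 by rewrite -gw mulrA g'g mul0r.
have ysw : star y * w = 0 by rewrite -gw mulrA ysg mul0r.
pose rules := (yg, g'y, gw, wg, sg, gg, sg', g'g', y1, y2, g_y, y_g', yy, ysg, gys, ysg',
  g'ys, ysys, wy, wg', g'w, ysw, gg', g'g).
have ph : is_proj (g + g') by apply: projD.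
pose J := y - star y.
have hJ : (g + g') * J = J by rewrite /J !(mulrDr, mulrDl, mulrN, mulNr) !rules; abel.
have Jh : J * (g + g') = J by rewrite /J !(mulrDr, mulrDl, mulrN, mulNr) !rules; abel.
have JJ : J * J = - (g + g') by rewrite /J !(mulrDr, mulrDl, mulrN, mulNr) !rules; abel.
have sJ : star J = - J by rewrite /J starB starK opprB.
have PJ : P J by apply: (saB sp) => //; apply: (saS sp).
have Ph : P (g + g') by apply: (saD sp).
have H := homot_conj sp (rot_homot ph hJ Jh JJ sJ sp Ph PJ) (fullu_unitary pw).
have {H} := H (saD sp Pw (saB sp (sa1 sp) Pg)).
rewrite (star_rot ph sJ) /rot /fullu scale0r add0r scale1r rmorphN /= scaleNr scale1r.
congr homot; rewrite /J opprB.
rewrite !(mulrDr, mulrDl, mulrN, mulNr, mulr1, mul1r) -?mulrA ?(mulKx0 g'ys).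
rewrite ?(mulKx yg, mulKx g'y, mulKx gw, mulKx wg, mulKx gg, mulKx g'g', mulKx y1, mulKx y2,
  mulKx0 g_y, mulKx0 y_g', mulKx0 yy, mulKx0 ysg, mulKx gys, mulKx ysg', mulKx0 g'ys, mulKx0 ysys,
  mulKx0 wy, mulKx0 wg', mulKx0 g'w, mulKx0 ysw, mulKx0 gg', mulKx0 g'g).
rewrite ?rules ?mulr0.
rewrite ?(mulKx yg, mulKx g'y, mulKx gw, mulKx wg, mulKx gg, mulKx g'g', mulKx y1, mulKx y2,
  mulKx0 g_y, mulKx0 y_g', mulKx0 yy, mulKx0 ysg, mulKx gys, mulKx ysg', mulKx0 g'ys, mulKx0 ysys,
  mulKx0 wy, mulKx0 wg', mulKx0 g'w, mulKx0 ysw, mulKx0 gg', mulKx0 g'g).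
rewrite ?rules ?mulr0.
abel.
Qed.

End PartialUnitaries.

Section Corner.
Variables (R : realType) (D : cstarAlgType R).
Implicit Types (a b x y g h w : D) (P : D -> Prop).

Definition corner a x := fullu (a * star a) (a * x * star a).

Lemma iso_proj a : star a * a = 1 -> is_proj (a * star a).
Proof. by move=> h; split; rewrite ?starM ?starK // -mulrA (mulKx1 h). Qed.

Lemma punit_corner a x : star a * a = 1 -> unitary x -> punit (a * star a) (a * x * star a).
Proof.
move=> h [u1 u2]; split; first exact: iso_proj.
by split; rewrite !starM starK -!mulrA (mulKx1 h) ?(mulKx1 u1) ?(mulKx1 u2).
Qed.

Lemma unitary_corner a x : star a * a = 1 -> unitary x -> unitary (corner a x).
Proof. by move=> h ux; apply/fullu_unitary/punit_corner. Qed.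

Lemma corner1 a : corner a 1 = 1.
Proof. by rewrite /corner /fullu mulr1 subrKC. Qed.

Lemma cornerM a x y : star a * a = 1 -> corner a (x * y) = corner a x * corner a y.
Proof.
move=> h; rewrite /corner /fullu !(mulrDr, mulrDl, mulrN, mulNr, mulr1, mul1r) -!mulrA.
by rewrite ?(mulKx1 h); abel.
Qed.

Lemma corner_corner a b x : star a * a = 1 -> corner a (corner b x) = corner (a * b) x.
Proof.
move=> h; rewrite /corner /fullu starM !(mulrDr, mulrDl, mulrN, mulNr, mulr1) -!mulrA.
by abel.
Qed.

Lemma corner_sa P a x : star_subalg P -> P a -> P x -> P (corner a x).
Proof.
move=> sp pa px; have psa := saS sp pa; rewrite /corner /fullu.
apply: (saD sp); first by apply: (saM sp) => //; apply: (saM sp).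
by apply: (saB sp); [apply: (sa1 sp)|apply: (saM sp)].
Qed.

Lemma corner_homot P a b x : star_subalg P -> star a * a = 1 -> star b * b = 1 ->
  star a * b = 0 -> P a -> P b -> P x -> unitary x -> homot P (corner a x) (corner b x).
Proof.
move=> sp ha hb hab pa pb px ux; have psa := saS sp pa; rewrite /corner.
have -> : b * x * star b = b * star a * (a * x * star a) * star (b * star a).
  by rewrite starM starK -!mulrA (mulKx1 ha) (mulKx1 ha).
apply: swap_homot => //; try exact: iso_proj; try exact: punit_corner.
- by rewrite -mulrA (mulKx0 hab) mulr0.
- by split; rewrite starM starK -!mulrA ?(mulKx1 hb) ?(mulKx1 ha).
- exact: saM.
by apply: (saM sp) => //; apply: (saM sp).
Qed.

Lemma fulluD g g' w w' : punit g w -> punit g' w' -> g * g' = 0 ->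
  fullu (g + g') (w + w') = fullu g w * fullu g' w'.
Proof.
move=> pw pw' gg0; have [gw wg] := punit_mul pw; have [gw' wg'] := punit_mul pw'.
have wg0 : w * g' = 0 by rewrite -wg -mulrA gg0 mulr0.
have gw0 : g * w' = 0 by rewrite -gw' mulrA gg0 mul0r.
have ww0 : w * w' = 0 by rewrite -gw' mulrA wg0 mul0r.
rewrite /fullu !(mulrDr, mulrDl, mulrN, mulNr, mulr1, mul1r) wg0 gw0 ww0 gg0.
by abel.
Qed.

End Corner.

Section K1.
Local Open Scope quotient_scope.
Variables (R : realType) (D : cstarAlgType R) (a b : D).
Hypotheses (ha : star a * a = 1) (hb : star b * b = 1) (hab : star a * b = 0).
Implicit Types (x y g h w : D).

Let T := fun _ : D => True.
Definition unitary_t := {x : D | `[< unitary x >]}.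

(** The complement of [a * star a], which contains the range of [b], is the room in which the
    homotopies may move. *)
Definition keq (u v : unitary_t) := `[< homot T (corner a (val u)) (corner a (val v)) >].

Lemma unitary_tP (u : unitary_t) : unitary (val u).
Proof. exact/asboolP/(valP u). Qed.

Lemma keq_refl : reflexive keq.
Proof.
move=> u; apply/asboolP; apply: homot_refl => //; apply: unitary_corner => //.
exact: unitary_tP.
Qed.

Lemma keq_sym : symmetric keq.
Proof. by move=> u v; apply/asboolP/asboolP; apply: homot_sym. Qed.

Lemma keq_trans : transitive keq.
Proof. by move=> u v w /asboolP h1 /asboolP h2; apply/asboolP/(homot_trans h1 h2). Qed.


Canonical keq_equiv := EquivRel keq keq_refl keq_sym keq_trans.

(* The vacuous dependency on [b] lets the group structure, which needs the room
   provided by [b], be inferred from the type. *)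
Definition K1 : Type :=
  (fun _ : star b * b = 1 /\ star a * b = 0 => {eq_quot keq}) (conj hb hab).
HB.instance Definition _ := Choice.on K1.
HB.instance Definition _ := EqQuotient.on K1.

Fact one_subproof : `[< unitary (1 : D) >].
Proof. exact/asboolP/unitary1. Qed.

Definition kcl x : K1 :=
  \pi_{eq_quot keq} (insubd (Sub (1 : D) one_subproof : unitary_t) x).

Lemma kcl_eq x y : unitary x -> unitary y ->
  kcl x = kcl y <-> homot T (corner a x) (corner a y).
Proof.
move=> ux uy; rewrite /kcl; split.
  by move=> /eqP; rewrite eqmodE => /asboolP; rewrite !insubdK //; apply/asboolP.
by move=> h; apply/eqP; rewrite eqmodE; apply/asboolP; rewrite !insubdK //; apply/asboolP.
Qed.

Lemma kcl_surj (p : K1) : exists2 x, unitary x & p = kcl x.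
Proof.
exists (val (repr p)); first exact: unitary_tP.
by rewrite /kcl valKd reprK.
Qed.

Definition kadd (p q : K1) := kcl (val (repr p) * val (repr q)).
Definition kopp (p : K1) := kcl (star (val (repr p))).

Lemma kcl_repr x : unitary x -> homot T (corner a (val (repr (kcl x)))) (corner a x).
Proof.
move=> ux; apply/kcl_eq => //; first exact: unitary_tP.
by rewrite {1}/kcl valKd reprK.
Qed.

Lemma kaddE x y : unitary x -> unitary y -> kadd (kcl x) (kcl y) = kcl (x * y).
Proof.
move=> ux uy; have u1 := unitary_tP (repr (kcl x)); have u2 := unitary_tP (repr (kcl y)).
apply/kcl_eq; [exact: unitaryM|exact: unitaryM|rewrite !cornerM //].
apply: (@homot_trans _ _ _ (corner a x * corner a (val (repr (kcl y))))).
  by apply: homot_mulr => //; [exact: unitary_corner|exact: kcl_repr].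
by apply: homot_mull => //; [exact: unitary_corner|exact: kcl_repr].
Qed.

Lemma koppE x : unitary x -> kopp (kcl x) = kcl (star x).
Proof.
move=> ux; have u1 := unitary_tP (repr (kcl x)).
apply/kcl_eq; [exact: unitaryV|exact: unitaryV|].
set y := val _ in u1 *; have h : homot T (corner a y) (corner a x) by exact: kcl_repr.
have ux' := unitaryV ux; have u1' := unitaryV u1.
have e1 : corner a (star x) * corner a x * corner a (star y) = corner a (star y).
  by rewrite -cornerM // (proj1 ux) corner1 mul1r.
have e2 : corner a (star x) * corner a y * corner a (star y) = corner a (star x).
  by rewrite -mulrA -cornerM // (proj2 u1) corner1 mulr1.
rewrite -[X in homot _ X]e1 -[X in homot _ _ X]e2.
apply: homot_mulr => //; first exact: unitary_corner.
by apply: homot_mull => //; [exact: unitary_corner|exact: homot_sym].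
Qed.

(** Up to homotopy [y] can be moved into the range of [b], where it commutes with the copy of [x] in
    the range of [a]. *)
Lemma kclC x y : unitary x -> unitary y -> kcl (x * y) = kcl (y * x).
Proof.
move=> ux uy; apply/kcl_eq; [exact: unitaryM|exact: unitaryM|rewrite !cornerM //].
have hh : homot T (corner a y) (corner b y) by apply: corner_homot.
have hba : star b * a = 0 by rewrite -[a]starK -starM hab star0.
have comm : corner a x * corner b y = corner b y * corner a x.
  rewrite /corner /fullu !(mulrDr, mulrDl, mulrN, mulNr, mulr1, mul1r) -!mulrA.
  by rewrite ?(mulKx0 hab) ?(mulKx0 hba) !mulr0; abel.
apply: (@homot_trans _ _ _ (corner a x * corner b y)).
  by apply: homot_mull => //; exact: unitary_corner.
rewrite comm; apply: homot_mulr; [by []|exact: unitary_corner|by []|exact: homot_sym].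
Qed.

Fact kaddA : associative kadd.
Proof.
move=> p q r; have [x ux ->] := kcl_surj p; have [y uy ->] := kcl_surj q.
have [z uz ->] := kcl_surj r.
by rewrite !kaddE ?mulrA //; exact: unitaryM.
Qed.

Fact kaddC : commutative kadd.
Proof.
move=> p q; have [x ux ->] := kcl_surj p; have [y uy ->] := kcl_surj q.
by rewrite !kaddE // kclC.
Qed.

Fact kadd0 : left_id (kcl 1) kadd.
Proof.
move=> p; have [x ux ->] := kcl_surj p.
by rewrite kaddE ?mul1r //; exact: unitary1.
Qed.

Fact kaddN : left_inverse (kcl 1) kopp kadd.
Proof.
move=> p; have [x ux ->] := kcl_surj p.
by rewrite koppE // kaddE ?(proj1 ux) //; exact: unitaryV.
Qed.

HB.instance Definition _ := GRing.isZmodule.Build K1 kaddA kaddC kadd0 kaddN.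

Lemma kclM x y : unitary x -> unitary y -> kcl (x * y) = kcl x + kcl y.
Proof. by move=> ux uy; rewrite -kaddE. Qed.

Lemma kcl1 : kcl 1 = 0.
Proof. by []. Qed.

Lemma kcl_eq0 x : unitary x -> kcl x = 0 <-> homot T (corner a x) 1.
Proof. by move=> ux; rewrite -(corner1 a) -kcl1 kcl_eq //; exact: unitary1. Qed.

Definition pcl g w := kcl (fullu g w).

Lemma pclM g w w' : punit g w -> punit g w' -> pcl g (w * w') = pcl g w + pcl g w'.
Proof.
move=> pw pw'; rewrite /pcl -kclM; try exact: fullu_unitary.
have [gw wg] := punit_mul pw; have [gw' wg'] := punit_mul pw'; have [sg gg] := proj1 pw.
by rewrite /fullu !(mulrDr, mulrDl, mulrN, mulNr, mulr1, mul1r) wg gw' gg; congr kcl; abel.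
Qed.

Lemma pclD g g' w w' : punit g w -> punit g' w' -> g * g' = 0 ->
  pcl (g + g') (w + w') = pcl g w + pcl g' w'.
Proof.
by move=> pw pw' gg0; rewrite /pcl fulluD // kclM //; exact: fullu_unitary.
Qed.

Lemma pcl_proj g : pcl g g = 0.
Proof. by rewrite /pcl /fullu subrKC. Qed.

Lemma pcl_star g w : punit g w -> pcl g (star w) = - pcl g w.
Proof.
move=> pw; apply/eqP; rewrite -addr_eq0 -pclM //; last exact: punit_star.
by case: pw => _ [-> _]; rewrite pcl_proj.
Qed.

(* Conjugation by partial isometries does not change the class: move into the
   range of [a], then into that of [b], where there is room, and back. *)
Lemma pcl_conj g w y : punit g w -> star y * (y * g) = g ->
  pcl (y * g * star y) (y * w * star y) = pcl g w.
Proof.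
move=> pw yg; have pw' := punit_conj pw yg.
have sep h v : punit h v -> corner a (fullu h v) = fullu (a * h * star a) (a * v * star a).
  by move=> ph; rewrite /corner /fullu !(mulrDr, mulrDl, mulrN, mulNr, mulr1); abel.
have pa h v : punit h v -> punit (a * h * star a) (a * v * star a).
  by move=> ph; apply: punit_conj => //; rewrite mulrA ha mul1r.
have hba : star b * a = 0 by rewrite -[a]starK -starM hab star0.
apply/kcl_eq; try exact: fullu_unitary.
rewrite !sep //; apply: homot_sym.
have [gw wg] := punit_mul pw; have [sg gg] := proj1 pw.
have ygx x : star y * (y * (g * x)) = g * x by rewrite (mulrA y) (mulrA (star y)) yg.
have pb : is_proj (b * g * star b).
  by split; rewrite ?starM ?starK ?sg -!mulrA // (mulKx1 hb) (mulKx gg).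
apply: (@homot_trans _ _ _ (fullu (b * g * star b) (b * w * star b))).
  have -> : b * w * star b = b * g * star a * (a * w * star a) * star (b * g * star a).
    by rewrite !starM starK sg -!mulrA !(mulKx1 ha) (mulKx gw) (mulKx wg).
  apply: swap_homot => //; [by rewrite -!mulrA (mulKx0 hab) !mulr0|exact: pa|].
  by split; rewrite !starM starK sg -!mulrA ?(mulKx1 ha) ?(mulKx1 hb) (mulKx gg).
have -> : a * (y * w * star y) * star a =
    a * y * g * star b * (b * w * star b) * star (a * y * g * star b).
  by rewrite !starM starK sg -!mulrA !(mulKx1 hb) (mulKx gw) (mulKx wg).
apply: swap_homot => //; first by have [] := pa _ _ pw'.
- by rewrite -!mulrA (mulKx0 hba) !mulr0.
- by apply: punit_conj => //; rewrite mulrA hb mul1r.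
by split; rewrite !starM starK sg -!mulrA ?(mulKx1 ha) ?(mulKx1 hb) ?ygx (mulKx gg).
Qed.

End K1.

(** * Incomparable words *)

Section Words.
Local Open Scope nat_scope.
Variable V : finType.
Implicit Types (u v w : seq V).

Definition incomparable u v := ~~ prefix u v && ~~ prefix v u.

Lemma prefix_comparable u v w : prefix u w -> prefix v w -> ~~ incomparable u v.
Proof.
rewrite !prefixE => /eqP hu /eqP hv; rewrite negb_and !negbK.
have [le|/ltnW le] := leqP (size u) (size v); apply/orP; [left|right]; rewrite prefixE.
  by rewrite -hv take_takel // hu.
by rewrite -hu take_takel // hv.
Qed.

Lemma incomparable_cat u v s t : incomparable u v -> incomparable (u ++ s) (v ++ t).
Proof.
move=> uv; apply/andP; split; apply/negP => /catl_prefix h.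
  by have := prefix_comparable h (prefix_prefix v t); rewrite uv.
by have := prefix_comparable (prefix_prefix u s) h; rewrite uv.
Qed.

Lemma incomparable_size u v : size u < size v -> ~~ prefix u v -> incomparable u v.
Proof.
move=> lt uv; rewrite /incomparable uv /=; apply/negP => /size_prefix.
by rewrite leqNgt lt.
Qed.

Variable e : rel V.
Hypothesis conn : forall x y, connect e x y.
Variables b k1 k2 : V.
Hypotheses (eb1 : e b k1) (eb2 : e b k2) (k12 : k1 != k2).

(** Walk to the branching vertex [b] and leave it by either of its two edges. *)
Lemma branch x : exists s t, [/\ path e x s, path e x t & incomparable s t].
Proof.
have /connectP[p ep bE] := conn x b; exists (rcons p k1), (rcons p k2).
rewrite !rcons_path -bE ep eb1 eb2; split=> //.
have neq (i j : V) : i != j -> ~~ prefix (rcons p i) (rcons p j).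
  move=> ij; rewrite prefixE !size_rcons take_oversize ?size_rcons //.
  by rewrite eqseq_rcons eqxx /= eq_sym.
by rewrite /incomparable !neq // eq_sym.
Qed.

Lemma out_edge x : exists y, e x y.
Proof.
have /connectP[[|y p] /= ep bE] := conn x b; first by exists k1; rewrite -bE.
by exists y; case/andP: ep.
Qed.

Lemma long_path x n : exists2 p, path e x p & n <= size p.
Proof.
elim: n x => [|n ih] x; first by exists [::].
have [y exy] := out_edge x; have [p ep np] := ih y.
by exists (y :: p); rewrite /= ?exy.
Qed.

Lemma return_path x y : exists2 p, path e x p & e (last x p) y.
Proof.
have [z exz] := out_edge x; have /connectP[p ep yE] := conn z y.
have : path e x (z :: p) by rewrite /= exz.
rewrite lastI rcons_path; have -> : last z p = y by [].
by move=> /andP[h1 h2]; exists (belast z p).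
Qed.

Variables (J : finType) (st en : J -> V).
Implicit Types (eta : J -> seq V).

Definition word eta a := st a :: eta a.

Definition wpaths eta := forall a, path e (st a) (eta a).

Definition extends eta eta' := forall a, exists s, eta' a = eta a ++ s.

Lemma incomparable_extends eta eta' a a' nu : extends eta eta' ->
  incomparable (word eta a) (nu ++ word eta a') ->
  incomparable (word eta' a) (nu ++ word eta' a').
Proof.
move=> h; have [s hs] := h a; have [t ht] := h a'.
rewrite /word hs ht -!cat_cons catA; exact: incomparable_cat.
Qed.

Lemma prefix_periodic u nu n : prefix u (nu ++ u) -> prefix u (flatten (nseq n nu) ++ u).
Proof.
move=> h; elim: n => [|n ih] /=; first exact: prefix_refl.
apply: (prefix_trans h); rewrite -catA.
by case/prefixP: ih => r {1}->; rewrite catA prefix_prefix.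
Qed.

(** Every path has two incomparable continuations [s] and [t], and at most one of them can be a
    prefix of a given word. For [a != a'] the other word is first made too long to be a prefix of
    either continuation. *)
Lemma make_incomparable eta a a' nu : wpaths eta -> (a = a' -> nu != [::]) ->
  exists eta', [/\ wpaths eta', extends eta eta' &
    incomparable (word eta' a) (nu ++ word eta' a')].
Proof.
move=> we aa; have [s [t [es et st_]]] := branch (last (st a) (eta a)).
have wcat s1 : path e (last (st a) (eta a)) s1 -> path e (st a) (eta a ++ s1).
  by move=> h; rewrite cat_path we.
have [eqa|neqa] := eqVneq a a'; last first.
  have [p ep np] := long_path (last (st a') (eta a')) (size (eta a) + size s + size t).
  pose E s1 c := if c == a then eta a ++ s1 else if c == a' then eta a' ++ p else eta c.
  have wE s1 : path e (last (st a) (eta a)) s1 -> wpaths (E s1).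
    move=> h c; rewrite /E; case: eqVneq => [->|_]; first exact: wcat.
    by case: eqVneq => [->|_] //; rewrite cat_path we.
  have xE s1 : extends eta (E s1).
    move=> c; rewrite /E; case: eqVneq => [->|_]; first by exists s1.
    by case: eqVneq => [->|_]; [exists p|exists [::]; rewrite cats0].
  have a'a : (a' == a) = false by rewrite eq_sym (negPf neqa).
  have sz s1 : size s1 <= size s + size t ->
      size (word eta a ++ s1) < (size (nu ++ word eta a' ++ p)).+1.
    rewrite !size_cat /= => h; apply: (@leq_ltn_trans (size p).+1).
      by rewrite addSn ltnS (leq_trans _ np) // -addnA leq_add2l.
    by rewrite ltnS addSn addnS ltnS addnA leq_addl.
  have key s1 : size s1 <= size s + size t ->
      ~~ prefix (word eta a ++ s1) (nu ++ word eta a' ++ p) ->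
      incomparable (word (E s1) a) (nu ++ word (E s1) a').
    move=> h np'; rewrite /word /E eqxx a'a eqxx -!cat_cons.
    rewrite /incomparable np' andTb; apply/negP => /prefixP[r hr].
    case: r hr => [|c r] hr; first by move: np'; rewrite hr cats0 prefix_refl.
    by have := sz _ h; rewrite hr [size (_ ++ c :: r)]size_cat addnS ltnS ltnNge leq_addr.
  have [hp|hp] := boolP (prefix (word eta a ++ s) (nu ++ word eta a' ++ p)).
    exists (E t); split; [exact: wE|exact: xE|apply: key; first exact: leq_addl].
    apply/negP => hq; have := prefix_comparable hp hq.
    by rewrite /incomparable !prefix_catr // eqxx -/(incomparable s t) st_.
  by exists (E s); split; [exact: wE|exact: xE|apply: key => //; exact: leq_addr].
pose E s1 c := if c == a then eta a ++ s1 else eta c.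
have wE s1 : path e (last (st a) (eta a)) s1 -> wpaths (E s1).
  by move=> h c; rewrite /E; case: eqVneq => [->|_] //; exact: wcat.
have xE s1 : extends eta (E s1).
  by move=> c; rewrite /E; case: eqVneq => [->|_]; [exists s1|exists [::]; rewrite cats0].
have nu0 : 0 < size nu by rewrite lt0n size_eq0 aa.
have key s1 : ~~ prefix (word eta a ++ s1) (nu ++ word eta a ++ s1) ->
    incomparable (word (E s1) a) (nu ++ word (E s1) a').
  move=> h; rewrite -eqa /word /E eqxx -!cat_cons; apply: incomparable_size => //.
  by rewrite [X in _ < X]size_cat -[X in X < _]add0n ltn_add2r.
have [hp|hp] := boolP (prefix (word eta a ++ s) (nu ++ word eta a ++ s)); last first.
  by exists (E s); split; [exact: wE|exact: xE|exact: key].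
exists (E t); split; [exact: wE|exact: xE|apply: key].
(* If both continuations were prefixes of their own shift by [nu], both would be initial pieces of
   the periodic word [nu nu nu ...], hence comparable. *)
apply/negP => hq; set N := size (word eta a ++ s) + size (word eta a ++ t).
pose W := flatten (nseq N nu).
have WN : N <= size W.
  rewrite /W; elim: (N) => [|n ih] //=.
  by rewrite size_cat -addn1 addnC leq_add.
have cut u : size u <= N -> prefix u (nu ++ u) -> prefix u W.
  move=> le /(prefix_periodic N); rewrite !prefixE -/W takel_cat //.
  exact: leq_trans WN.
have := prefix_comparable (cut _ (leq_addr _ _) hp) (cut _ (leq_addl _ _) hq).
by rewrite /incomparable !prefix_catr // eqxx -/(incomparable s t) st_.
Qed.

(** The finitely many constraints [(a, a', nu)] are met one after the other. Extending words never
    destroys incomparability, so constraints already met stay met, and the final paths towards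
    [en a] do no harm. *)
Lemma incomparable_words m : exists eta,
  (forall a, path e (st a) (eta a) /\ e (last (st a) (eta a)) (en a)) /\
  forall a a' nu, size nu < m -> (a = a' -> nu != [::]) ->
    incomparable (word eta a) (nu ++ word eta a').
Proof.
pose cs := [seq c <- [seq (c1, c2) | c1 <- enum {: J * J},
    c2 <- flatten [seq [seq tval t | t <- enum {: l.-tuple V}] | l <- iota 0 m]]
    | (c.1.1 == c.1.2) ==> (c.2 != [::])].
have [eta [we he]] : exists eta, wpaths eta /\
    forall c, c \in cs -> incomparable (word eta c.1.1) (c.2 ++ word eta c.1.2).
  have : forall c, c \in cs -> c.1.1 = c.1.2 -> c.2 != [::].
    by move=> c; rewrite mem_filter => /andP[/implyP h _] /eqP; apply: h.
  elim: cs => [|[[a a'] nu] cs ih] hc; first by exists (fun=> [::]).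
  have [|eta [we he]] := ih; first by move=> c cin; apply: hc; rewrite inE cin orbT.
  have [|eta' [we' xe' he']] := @make_incomparable eta a a' nu we.
    by move=> aa; apply: (hc ((a, a'), nu)); rewrite ?mem_head.
  exists eta'; split=> // c; rewrite inE => /predU1P[->//|cin].
  exact: incomparable_extends xe' (he _ cin).
have ret a := return_path (last (st a) (eta a)) (en a).
pose r a := s2val (sig2W (ret a)).
exists (fun a => eta a ++ r a); split.
  move=> a; rewrite cat_path we last_cat /r; case: (sig2W _) => p /= -> ->.
  by [].
move=> a a' nu nm aa; apply: (incomparable_extends (eta := eta)); first by move=> c; exists (r c).
apply: (he ((a, a'), nu)); rewrite mem_filter; apply/andP; split.
  by apply/implyP => /eqP; exact: aa.
apply/allpairsP; exists ((a, a'), nu); split=> //=; first by rewrite mem_enum.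
apply/flattenP; exists [seq tval t | t <- enum {: (size nu).-tuple V}].
  by apply/mapP; exists (size nu) => //; rewrite mem_iota add0n.
by apply/mapP; exists (in_tuple nu); rewrite ?mem_enum.
Qed.

End Words.

Definition edge n (M : 'M[int]_n) : rel 'I_n := fun i j => M i j == 1.

(** * Cuntz-Krieger families and the canonical endomorphism *)

Section CKFamily.
Variables (R : realType) (D : cstarAlgType R) (n : nat) (M : 'M[int]_n).
Hypothesis M01 : mx01 M.
Variable S : 'I_n -> D.
Hypothesis fS : ck_family M S.
Implicit Types (x y z : D) (u v w : seq 'I_n).

Definition rproj (T : 'I_n -> D) j := T j * star (T j).
Local Notation p := (rproj S).

Lemma MnE i j x : x *~ M i j = if edge M i j then x else 0.
Proof. by rewrite /edge; case: (M01 i j) => ->; rewrite ?mulr0z ?mulr1z. Qed.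

Lemma ck_pi i : S i * (star (S i) * S i) = S i.
Proof. by rewrite mulrA; case: fS => h _ _; exact: h. Qed.

Lemma ck_pi' i : star (S i) * (S i * star (S i)) = star (S i).
Proof. by have := congr1 star (ck_pi i); rewrite !starM starK -mulrA. Qed.

Lemma ck_proj i : is_proj (p i).
Proof.
by split; rewrite /rproj; [rewrite starM starK|rewrite -mulrA ck_pi'].
Qed.

Lemma ck_sum : \sum_j p j = 1.
Proof. by case: fS. Qed.

Lemma ck_src i : star (S i) * S i = \sum_j (if edge M i j then p j else 0).
Proof. by case: fS => _ _ ->; apply: eq_bigr => j _; rewrite MnE. Qed.

Lemma ck_ortho i j : i != j -> p i * p j = 0.
Proof. by move=> ij; apply: projs_ortho ij; [exact: ck_proj|exact: ck_sum]. Qed.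

Lemma ck_pS i : p i * S i = S i.
Proof. by rewrite /rproj -mulrA ck_pi. Qed.

Lemma ck_Sp i : star (S i) * p i = star (S i).
Proof. exact: ck_pi'. Qed.

Lemma ck_pS0 i j : i != j -> p i * S j = 0.
Proof. by move=> ij; rewrite -ck_pS mulrA ck_ortho // mul0r. Qed.

Lemma ck_SS0 i j : i != j -> star (S i) * S j = 0.
Proof. by move=> ij; rewrite -ck_Sp -mulrA ck_pS0 // mulr0. Qed.

Lemma ck_srcp i j : star (S i) * S i * p j = if edge M i j then p j else 0.
Proof.
rewrite ck_src mulr_suml (bigD1 j) //= big1 ?addr0; last first.
  by move=> k kj; case: ifP; rewrite ?mul0r // ck_ortho.
by case: ifP; rewrite ?mul0r // (proj2 (ck_proj j)).
Qed.

Lemma ck_srcS i j : star (S i) * S i * S j = if edge M i j then S j else 0.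
Proof. by rewrite -[in LHS](ck_pS j) mulrA ck_srcp; case: ifP; rewrite ?mul0r // ck_pS. Qed.

Lemma ck_ext x y : (forall i, x * S i = y * S i) -> x = y.
Proof.
move=> h; rewrite -[x]mulr1 -[y]mulr1 -ck_sum !mulr_sumr.
by apply: eq_bigr => i _; rewrite /rproj !mulrA h.
Qed.

(** The commutant of the range projections is the domain on which [lam] is multiplicative. *)
Definition pcomm x := forall j, x * p j = p j * x.

Lemma pcomm_sa : star_subalg pcomm.
Proof.
split.
- by move=> j; rewrite mulr1 mul1r.
- by move=> x y hx hy j; rewrite mulrDl mulrDr hx hy.
- by move=> x hx j; rewrite mulNr mulrN hx.
- by move=> x y hx hy j; rewrite -mulrA hy mulrA hx mulrA.
- by move=> x hx j; rewrite -(proj1 (ck_proj j)) -!starM hx.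
by move=> r x hx j; rewrite -scalerAl -scalerAr hx.
Qed.

Lemma pcomm_src i x : pcomm x -> star (S i) * S i * x = x * (star (S i) * S i).
Proof.
move=> hx; rewrite ck_src mulr_suml mulr_sumr; apply: eq_bigr => j _.
by case: ifP; rewrite ?mul0r ?mulr0 // hx.
Qed.

Definition lam x := \sum_i S i * x * star (S i).

(** The source projection of [S i] is a sum of range projections, so it commutes with [x]. *)
Lemma lamS x i : pcomm x -> lam x * S i = S i * x.
Proof.
move=> hx; rewrite /lam mulr_suml (bigD1 i) //= big1 ?addr0; last first.
  by move=> j ji; rewrite -mulrA ck_SS0 ?mulr0.
by rewrite -!mulrA -pcomm_src // !mulrA -[S i * _ * _]mulrA ck_pi.
Qed.

Lemma lam_pcomm x : pcomm (lam x).
Proof.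
move=> j; rewrite /lam mulr_suml mulr_sumr; apply: eq_bigr => i _.
have [->|ij] := eqVneq i j; first by rewrite -mulrA ck_Sp !mulrA ck_pS.
have h0 : star (S i) * p j = 0.
  by rewrite -(proj1 (ck_proj j)) -starM ck_pS0 ?star0 // eq_sym.
by rewrite -mulrA h0 mulr0 !mulrA ck_pS0 ?mul0r // eq_sym.
Qed.

Lemma lamD x y : lam (x + y) = lam x + lam y.
Proof. by rewrite /lam -big_split; apply: eq_bigr => i _; rewrite mulrDr mulrDl. Qed.

Lemma lamN x : lam (- x) = - lam x.
Proof. by rewrite /lam -sumrN; apply: eq_bigr => i _; rewrite mulrN mulNr. Qed.

Lemma lamB x y : lam (x - y) = lam x - lam y.
Proof. by rewrite lamD lamN. Qed.

Lemma lam0 : lam 0 = 0.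
Proof. by rewrite /lam big1 // => i _; rewrite mulr0 mul0r. Qed.

Lemma lamZ (r : R) x : lam (r%:C *: x) = r%:C *: lam x.
Proof. by rewrite /lam scaler_sumr; apply: eq_bigr => i _; rewrite -scalerAr -scalerAl. Qed.

Lemma lam_sum I (r : seq I) (F : I -> D) :
  lam (\sum_(i <- r) F i) = \sum_(i <- r) lam (F i).
Proof. by elim/big_rec2: _ => [|i a b _ <-]; rewrite ?lam0 ?lamD. Qed.

Lemma lam1 : lam 1 = 1.
Proof. by rewrite /lam -[RHS]ck_sum; apply: eq_bigr => i _; rewrite mulr1. Qed.

Lemma lam_star x : lam (star x) = star (lam x).
Proof. by rewrite /lam star_sum; apply: eq_bigr => i _; rewrite !starM starK mulrA. Qed.

Lemma lamM x y : pcomm x -> pcomm y -> lam (x * y) = lam x * lam y.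
Proof.
move=> hx hy; apply: ck_ext => i.
rewrite (lamS _ (saM pcomm_sa hx hy)) -[RHS]mulrA (lamS _ hy) [RHS]mulrA (lamS _ hx).
by rewrite mulrA.
Qed.

Lemma lam_iso x : pcomm x -> star x * x = 1 -> star (lam x) * lam x = 1.
Proof. by move=> hx h; rewrite -lam_star -lamM ?h ?lam1 //; apply: (saS pcomm_sa). Qed.

Lemma lam_unitary x : pcomm x -> unitary x -> unitary (lam x).
Proof.
move=> hx [h1 h2]; have hs := saS pcomm_sa hx.
by split; rewrite -lam_star -lamM ?h1 ?h2 ?lam1.
Qed.

Definition Sw u := \prod_(i <- u) S i.

Lemma Sw_cons i u : Sw (i :: u) = S i * Sw u.
Proof. by rewrite /Sw big_cons. Qed.

Lemma Sw_cat u v : Sw (u ++ v) = Sw u * Sw v.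
Proof. by rewrite /Sw big_cat. Qed.

Lemma Sw_incomparable u v : incomparable u v -> star (Sw u) * Sw v = 0.
Proof.
elim: u v => [|i u ih] [|j v]; rewrite /incomparable ?prefix0s ?andbF //.
rewrite !prefix_cons !Sw_cons starM => h.
have [ij|ij] := eqVneq i j; last by rewrite -mulrA (mulKx0 (ck_SS0 ij)) mulr0.
rewrite -{}ij eqxx /= in h *; case: v h => [|k v] h; first by rewrite prefix0s andbF in h.
rewrite Sw_cons -!mulrA (mulrA (S i)) (mulrA (star (S i))) (mulrA (star (S i))) ck_srcS.
by case: ifP => _; rewrite ?mul0r ?mulr0 // -Sw_cons ih.
Qed.

Lemma Sw_path i u : path (edge M) i u ->
  star (Sw (i :: u)) * Sw (i :: u) = star (S (last i u)) * S (last i u).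
Proof.
elim: u i => [|j u ih] i /=; first by rewrite /Sw big_seq1.
move=> /andP[eij pu]; rewrite -(ih _ pu) [Sw (i :: _)]Sw_cons starM -mulrA.
by rewrite (mulrA (star (S i))) Sw_cons (mulrA _ (S j)) ck_srcS eij.
Qed.

Lemma Sw_head i u : p i * Sw (i :: u) = Sw (i :: u).
Proof. by rewrite Sw_cons mulrA ck_pS. Qed.

Lemma lam_iter_Sw l x w : pcomm x -> size w = l -> iter l lam x * Sw w = Sw w * x.
Proof.
move=> hx; elim: l w => [|l ih] [|i w] //=; first by rewrite /Sw big_nil mulr1 mul1r.
move=> [sw]; rewrite Sw_cons mulrA lamS; first by rewrite -!mulrA ih.
by case: l {ih sw} => [|l] //=; exact: lam_pcomm.
Qed.

Lemma Sw_ext l x : (forall w, size w = l -> x * Sw w = 0) -> x = 0.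
Proof.
elim: l x => [|l ih] x h; first by have := h [::] erefl; rewrite /Sw big_nil mulr1.
apply: ck_ext => i; rewrite mul0r; apply: ih => w sw.
by rewrite -mulrA -Sw_cons h //= sw.
Qed.

End CKFamily.

Arguments pcomm {R D n} S x.

(** The graph form of being irreducible and not a permutation; it follows from these by
    [irreducible_ck_graph] and passes to the extended matrix by [bar_ck_graph]. *)
Definition ck_graph n (M : 'M[int]_n) :=
  (forall i j, connect (edge M) i j) /\
  exists b k1 k2, [/\ edge M b k1, edge M b k2 & k1 != k2].

Section Room.
Variables (R : realType) (D : cstarAlgType R) (n : nat) (M : 'M[int]_n).
Hypotheses (M01 : mx01 M) (gM : ck_graph M).
Variable S : 'I_n -> D.
Hypothesis fS : ck_family M S.
Implicit Types (x y z : D) (w : 'I_n -> seq 'I_n).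

Local Notation p := (rproj S).
Local Notation P := (pcomm S).

Lemma words_mul w w' z :
  (forall i j, star (Sw S (w i)) * (z * Sw S (w' j)) = 0) ->
  star (\sum_i Sw S (w i) * p i) * (z * \sum_j Sw S (w' j) * p j) = 0.
Proof.
move=> h; rewrite star_sum mulr_suml big1 // => i _; rewrite !mulr_sumr big1 // => j _.
rewrite starM -!mulrA (mulrA z) (mulrA _ _ (p j)) h mul0r mulr0 //.
Qed.

Lemma words_iso w : (forall i j, i != j -> star (Sw S (w i)) * Sw S (w j) = 0) ->
  (forall i, star (Sw S (w i)) * Sw S (w i) * p i = p i) ->
  star (\sum_i Sw S (w i) * p i) * (\sum_j Sw S (w j) * p j) = 1.
Proof.
move=> h1 h2; rewrite star_sum mulr_suml -(ck_sum fS); apply: eq_bigr => i _.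
rewrite mulr_sumr (bigD1 i) //= big1 ?addr0; last first.
  move=> j ji; rewrite starM -!mulrA (mulrA _ _ (p j)) h1 ?mul0r ?mulr0 //.
  by rewrite eq_sym.
rewrite starM -!mulrA (mulrA _ _ (p i)) h2 (proj1 (ck_proj fS i)).
exact: (proj2 (ck_proj fS i)).
Qed.

Lemma word_src (st en : 'I_n) (u : seq 'I_n) : path (edge M) st u -> edge M (last st u) en ->
  star (Sw S (st :: u)) * Sw S (st :: u) * p en = p en.
Proof. by move=> pu eu; rewrite (Sw_path M01 fS pu) (ck_srcp M01 fS) eu. Qed.

Lemma room m k : exists x : 'I_k -> D, (forall a, P (x a)) /\
  forall a a' l, (l < m)%N ->
    star (x a) * iter l (lam S) (x a') = ((l == 0%N) && (a == a'))%:R.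
Proof.
have [conn [b [k1 [k2 [e1 e2 k12]]]]] := gM.
have [eta [h1 h2]] := @incomparable_words _ _ conn b k1 k2 e1 e2 k12 ('I_n * 'I_k)%type
  (fun c => c.1) (fun c => c.1) m.
pose w a i := word (fun c : 'I_n * 'I_k => c.1) eta (i, a).
pose x a := \sum_i Sw S (w a i) * p i.
have Px a : P (x a).
  move=> j; rewrite /x mulr_suml mulr_sumr (bigD1 j) //= [RHS](bigD1 j) //=.
  rewrite !big1 ?addr0; last 2 first.
  - by move=> i ij; rewrite mulrA /w /word /= Sw_cons mulrA (ck_pS0 fS) ?mul0r // eq_sym.
  - by move=> i ij; rewrite -mulrA (ck_ortho fS ij) mulr0.
  by rewrite -mulrA (proj2 (ck_proj fS j)) mulrA /w /word /= (Sw_head fS).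
exists x; split=> // a a' l lm.
have src i b0 : star (Sw S (w b0 i)) * Sw S (w b0 i) * p i = p i.
  by have [pa ea] := h1 (i, b0); apply: word_src.
have [/andP[/eqP-> /eqP<-]|] := boolP ((l == 0%N) && (a == a')).
  apply: words_iso => // i j ij; apply: (Sw_incomparable M01 fS).
  have := h2 (i, a) (j, a) [::]; rewrite cat0s; apply; first by apply: leq_ltn_trans lm.
  by move=> [E]; rewrite E eqxx in ij.
rewrite negb_and => na; rewrite mulr0n.
apply: (@Sw_ext _ _ _ _ _ fS l) => nu snu.
rewrite -mulrA (lam_iter_Sw M01 fS (Px a') snu).
apply: words_mul => i j; rewrite -Sw_cat; apply: (Sw_incomparable M01 fS).
apply: h2; first by rewrite snu.
by move=> [_ aa]; rewrite -size_eq0 snu; move: na; rewrite aa eqxx orbF.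
Qed.

(** As in [room], except that all words start at [j], which puts the range under [p j]. *)
Lemma corner_isometry j : exists c, star c * c = 1 /\ p j * c = c.
Proof.
have [conn [b [k1 [k2 [e1 e2 k12]]]]] := gM.
have [eta [h1 h2]] := @incomparable_words _ _ conn b k1 k2 e1 e2 k12 'I_n (fun=> j) id 1.
exists (\sum_i Sw S (word (fun=> j) eta i) * p i); split.
  apply: words_iso => [i k ik|i].
    apply: (Sw_incomparable M01 fS); have := h2 i k [::]; rewrite cat0s; apply => // E.
    by rewrite E eqxx in ik.
  by have [pa ea] := h1 i; apply: word_src.
by rewrite mulr_sumr; apply: eq_bigr => i _; rewrite mulrA /word (Sw_head fS).
Qed.

(* Rokhlin-type averaging: with [La y = lam y * star (W a)], the sums of the
   iterates of [La] on the isometries of [room] telescope. *)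
Lemma intertwiners k (W : 'I_k -> D) (d : R) : 0 < d ->
  (forall a, unitary (W a) /\ P (W a)) ->
  exists s : 'I_k -> D, [/\ forall a, P (s a), ortho_isometries s &
    forall a, cnorm (lam S (s a) - s a * W a) <= d].
Proof.
move=> d0 hW; have sa := pcomm_sa fS.
(* Telescoping leaves the difference of two isometries divided by [sqrt (m + 1)]; this [m] makes
   [2 / sqrt (m + 1)] at most [d]. *)
pose m := Num.bound ((2 / d) ^+ 2).
have hm : 2 / Num.sqrt m.+1%:R <= d.
  have s0 : 0 < Num.sqrt (m.+1%:R : R) by rewrite sqrtr_gt0 ltr0Sn.
  rewrite ler_pdivrMr // mulrC -ler_pdivrMr // -(@ler_pXn2r _ 2) ?nnegrE ?(ltW s0) //;
    last by rewrite divr_ge0 // ltW.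
  rewrite sqr_sqrtr ?ler0n // ltW //; apply: lt_le_trans (archi_boundP _) _.
    exact: sqr_ge0.
  by rewrite ler_nat leqnSn.
have [x [Px xo]] := room m.+1 k.
pose La a y := lam S y * star (W a).
have PW a : P (star (W a)) by apply: (saS sa); have [] := hW a.
have uW a : unitary (star (W a)) by apply: unitaryV; have [] := hW a.
have PLa a y : P (La a y) by apply: (saM sa) => //; exact: (lam_pcomm fS).
have PLi a l y : P y -> P (iter l (La a) y).
  by move=> Py; elim: l => [|l ih] //=.
have LaM a a' y z : P y -> P z ->
    star (La a y) * La a' z = W a * lam S (star y * z) * star (W a').
  move=> Py Pz; rewrite /La starM starK (lamM M01 fS) ?(lam_star S) ?mulrA //.
  exact: (saS sa).
(* Iterates of [La] differ from those of [lam] by a unitary factor on the right only, so the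
   orthogonality relations of [room] carry over. *)
have itE a l y : P y ->
    exists U, [/\ unitary U, P U & iter l (La a) y = iter l (lam S) y * U].
  move=> Py; elim: l => [|l [U [uU PU E]]].
    by exists 1; rewrite mulr1; split=> //; [exact: unitary1|exact: (sa1 sa)].
  exists (lam S U * star (W a)); split.
  - by apply: unitaryM => //; apply: (lam_unitary M01 fS).
  - by apply: (saM sa) => //; exact: (lam_pcomm fS).
  rewrite /= E /La (lamM M01 fS) ?mulrA //.
  by elim: l {E} => [|l ih] //=; exact: (lam_pcomm fS).
(* Applying [La a] on one side and [La a'] on the other preserves orthogonality, so only the
   difference of the two exponents matters. *)
have orth0 a a' l d' y z : P y -> P z -> star y * iter d' (La a') z = 0 ->
    star (iter l (La a) y) * iter (l + d')%N (La a') z = 0.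
  move=> Py Pz h; elim: l => [|l ih] //=.
  by rewrite LaM ?ih ?lam0 ?mulr0 ?mul0r //; exact: PLi.
have base a a' d' : (d' < m.+1)%N -> ~~ ((d' == 0%N) && (a == a')) ->
    star (x a) * iter d' (La a') (x a') = 0.
  move=> dm nd; have [U [_ _ ->]] := itE a' d' (x a') (Px a').
  by rewrite mulrA xo // (negPf nd) mul0r.
have iso a l : star (iter l (La a) (x a)) * iter l (La a) (x a) = 1.
  elim: l => [|l ih] /=; first by rewrite (xo a a 0%N) ?eqxx.
  rewrite LaM; [|exact: PLi|exact: PLi].
  by rewrite ih (lam1 fS) mulr1; have [[]] := hW a.
have orth a a' (l l' : 'I_m.+1) :
    star (iter l (La a) (x a)) * iter l' (La a') (x a') = ((l == l') && (a == a'))%:R.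
  have [/andP[/eqP-> /eqP->]|nla] := boolP ((l == l') && (a == a')); first exact: iso.
  have [le|lt] := leqP l l'.
    rewrite -(subnKC le); apply: orth0 => //; apply: base.
      by rewrite (leq_ltn_trans (leq_subr _ _)).
    apply: contra nla => /andP[]; rewrite subn_eq0 => le' ->; rewrite andbT.
    by rewrite -val_eqE eqn_leq le.
  rewrite -[RHS]star0 -[LHS]starK starM starK; congr star.
  rewrite -(subnKC (ltnW lt)); apply: orth0 => //; apply: base.
    by rewrite (leq_ltn_trans (leq_subr _ _)).
  by rewrite subn_eq0 leqNgt lt.
pose c : R := (Num.sqrt m.+1%:R)^-1.
pose s a := c%:C *: \sum_(l < m.+1) iter l (La a) (x a).
have Ps a : P (s a).
  by apply: (saZ sa); apply: (sa_sum sa) => l; apply: PLi.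
exists s; split=> //.
  move=> a a'; rewrite /s starZr -scalerAl -scalerAr scalerr star_sum mulr_suml.
  under eq_bigr => l _ do rewrite mulr_sumr.
  have -> : \sum_(l < m.+1) \sum_(l' < m.+1)
      star (iter l (La a) (x a)) * iter l' (La a') (x a') = m.+1%:R * (a == a')%:R.
    rewrite -[m.+1 in RHS]card_ord -sum1_card natr_sum mulr_suml; apply: eq_bigr => l _.
    rewrite (bigD1 l) //= big1 ?addr0 => [|l' ll']; first by rewrite orth eqxx mul1r.
    by rewrite orth eq_sym (negPf ll').
  rewrite mulr_natl -scaler_nat scalerA.
  rewrite -(rmorph_nat (real_complex R)) -rmorphM -invfM -expr2 sqr_sqrtr ?ler0n //.
  by rewrite mulVf ?pnatr_eq0 // scale1r.
move=> a; have [[w1 w2] _] := hW a.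
have -> : lam S (s a) - s a * W a = (La a (s a) - s a) * W a.
  by rewrite mulrBl /La -mulrA w1 mulr1.
apply: le_trans (cnormMr_le _ _) _; first by apply: unitary_norm.
have -> : La a (s a) - s a = c%:C *: (iter m.+1 (La a) (x a) - x a).
  rewrite /La /s lamZ -scalerAl -scalerBr lam_sum mulr_suml -sumrB; congr (_ *: _).
  by rewrite -(big_mkord xpredT (fun l => iter l.+1 (La a) (x a) - iter l (La a) (x a)))
     telescope_sumr.
rewrite cnormZr ger0_norm ?invr_ge0 ?sqrtr_ge0 // mulrC.
apply: le_trans hm; rewrite ler_pM2r ?invr_gt0 ?sqrtr_gt0 ?ltr0Sn //.
apply: le_trans (cnormB _ _) _; rewrite -[2]/(1 + 1 : R); apply: lerD.
  by apply: isometry_norm; rewrite iso.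
by apply: isometry_norm; have := iso a 0%N.
Qed.

End Room.

(** * Approximate uniqueness of twisted families *)

Section Perturbation.
Variables (R : realType) (D : cstarAlgType R).
Implicit Types x y z t : D.

Lemma pert_mul x x' y y' (d d' : R) : cnorm y <= 1 -> cnorm x' <= 1 ->
  cnorm (x - x') <= d -> cnorm (y - y') <= d' -> cnorm (x * y - x' * y') <= d + d'.
Proof.
move=> ny nx' h h'; have -> : x * y - x' * y' = (x - x') * y + x' * (y - y').
  by rewrite mulrBl mulrBr; abel.
apply: le_trans (cnormD _ _) _; apply: lerD.
  by apply: le_trans h; apply: cnormMr_le.
by apply: le_trans h'; apply: cnormMl_le.
Qed.

Lemma pert_add x x' y y' (d d' : R) :
  cnorm (x - x') <= d -> cnorm (y - y') <= d' -> cnorm (x + y - (x' + y')) <= d + d'.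
Proof.
by move=> h h'; rewrite opprD addrACA; apply: le_trans (cnormD _ _) _; apply: lerD.
Qed.

Lemma pert_opp x x' (d : R) : cnorm (x - x') <= d -> cnorm (- x - - x') <= d.
Proof. by move=> h; rewrite -opprD cnormN. Qed.

Lemma pert_star x x' (d : R) : cnorm (x - x') <= d -> cnorm (star x - star x') <= d.
Proof. by rewrite -starB cnorm_starE. Qed.

Lemma isometryM x y : star x * x = 1 -> star y * y = 1 -> star (x * y) * (x * y) = 1.
Proof. by move=> h1 h2; rewrite starM -mulrA (mulKx1 h1). Qed.

(* Maps [y y^*]-by-[y] and the rest by the identity, after absorbing one copy
   of [t]: the unitary behind [q = p + b = p + x + b = q + x]. *)
Definition swindle y t :=
  y - y * (t * star t) + y * (t * (star y * star t)) + star t - y * (star y * star t).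

Lemma swindle_unitary y t : star y * y = 1 -> star t * t = 1 -> unitary (swindle y t).
Proof.
move=> hy ht; split; rewrite /swindle !(starB, starD, starM, starK);
  rewrite !(mulrDr, mulrDl, mulrN, mulNr, mulr1, mul1r) -!mulrA;
  by rewrite !(mulKx1 hy, mulKx1 ht, hy, ht, mulr1); abel.
Qed.

(** The constant is the number of factors in the five terms of [swindle]: 1 + 3 + 4 + 1 + 3. *)
Lemma swindle_pert y t y' t' (d : R) : star y * y = 1 -> star t * t = 1 ->
  star y' * y' = 1 -> star t' * t' = 1 -> cnorm (y - y') <= d -> cnorm (t - t') <= d ->
  cnorm (swindle y t - swindle y' t') <= 12 * d.
Proof.
move=> hy ht hy' ht' dy dt.
have ny := isometry_norm hy; have nt := isometry_norm ht.
have ny' := isometry_norm hy'; have nt' := isometry_norm ht'.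
have nys : cnorm (star y) <= 1 by rewrite cnorm_starE.
have nts : cnorm (star t) <= 1 by rewrite cnorm_starE.
have nys' : cnorm (star y') <= 1 by rewrite cnorm_starE.
have nts' : cnorm (star t') <= 1 by rewrite cnorm_starE.
have dys := pert_star dy; have dts := pert_star dt.
have nyt : cnorm (star y * star t) <= 1 by apply: cnormM_le1.
have ntt : cnorm (t * star t) <= 1 by apply: cnormM_le1.
have ntyt : cnorm (t * (star y * star t)) <= 1 by apply: cnormM_le1.
have h1 := pert_mul nts nt' dt dts.
have h2 := pert_mul nts nys' dys dts.
have h3 := pert_mul nyt nt' dt h2.
have k1 := pert_opp (pert_mul ntt ny' dy h1).
have k2 := pert_mul ntyt ny' dy h3.
have k3 := pert_opp (pert_mul nyt ny' dy h2).
apply: le_trans (pert_add (pert_add (pert_add (pert_add dy k1) k2) dts) k3) _.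
lra.
Qed.

(** When [lam] nearly fixes [y] and moves [t] close to [star w * t], this identity says that the
    swindle nearly intertwines [w] with [corner y w]. *)
Lemma swindle_twist y t w : star y * y = 1 -> unitary w ->
  corner y w * swindle y (star w * t) = swindle y t * w.
Proof.
move=> hy [h1 h2]; rewrite /swindle /corner /fullu !starM !starK.
rewrite !(mulrDr, mulrDl, mulrN, mulNr, mulr1, mul1r) -!mulrA.
by rewrite !(mulKx1 hy, mulKx1 h2, hy, h2, mulr1); abel.
Qed.

End Perturbation.

Section Uniqueness.
Variables (R : realType) (D : cstarAlgType R) (n : nat) (M : 'M[int]_n).
Hypotheses (M01 : mx01 M) (gM : ck_graph M).
Implicit Types (x y z t W X Y : D) (S : 'I_n -> D).

Definition tw W S i := W * S i.

Lemma tw_rproj S W : ck_family M S -> unitary W -> pcomm S W ->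
  forall j, rproj (tw W S) j = rproj S j.
Proof.
move=> fS [w1 w2] hW j; rewrite /rproj /tw starM mulrA -[W * _ * _]mulrA.
by rewrite hW -mulrA w2 mulr1.
Qed.

Lemma tw_family S W : ck_family M S -> unitary W -> pcomm S W -> ck_family M (tw W S).
Proof.
move=> fS uW hW; have pE := tw_rproj fS uW hW; have [w1 w2] := uW.
have sE i : star (tw W S i) * tw W S i = star (S i) * S i.
  by rewrite /tw starM -mulrA (mulKx1 w1).
split=> [i||i].
- by rewrite /partial_isometry -mulrA sE /tw -mulrA (ck_pi fS).
- by rewrite -(ck_sum fS); apply: eq_bigr => j _; exact: pE.
rewrite sE; case: (fS) => _ _ ->; apply: eq_bigr => j _.
by congr (_ *~ _); have := pE j.
Qed.

Lemma tw_pcomm S W x : ck_family M S -> unitary W -> pcomm S W ->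
  pcomm (tw W S) x <-> pcomm S x.
Proof. by move=> fS uW hW; split=> h j; have := h j; rewrite (tw_rproj fS uW hW). Qed.

Lemma tw_lam S W x : lam (tw W S) x = W * lam S x * star W.
Proof.
rewrite /lam mulr_sumr mulr_suml; apply: eq_bigr => i _.
by rewrite /tw starM !mulrA.
Qed.

(** Since [star (lam S u) * S i = S i * star u], conjugation by [u] moves the family [W * S i] to
    within [e] of the family [W' * S i]. *)
Definition aeqd S (e : R) W W' :=
  exists u, [/\ unitary u, pcomm S u & cnorm (u * W * star (lam S u) - W') <= e].

Definition aeq S W W' := forall e : R, 0 < e -> aeqd S e W W'.

Lemma aeqd_trans S e e' W W' W'' : ck_family M S ->
  aeqd S e W W' -> aeqd S e' W' W'' -> aeqd S (e + e') W W''.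
Proof.
move=> fS [u [uu Pu hu]] [v [uv Pv hv]]; exists (v * u).
split; [exact: unitaryM|exact: (saM (pcomm_sa fS))|].
rewrite (lamM M01 fS) // starM; apply: le_trans (cnorm_tri (v * W' * star (lam S v)) _ _) _.
apply: lerD => //.
have -> : v * u * W * (star (lam S u) * star (lam S v)) = v * (u * W * star (lam S u)) * star (lam S v).
  by rewrite !mulrA.
by rewrite unitary_distr ?unitary_distl //; apply: unitaryV; apply: (lam_unitary M01 fS).
Qed.

Lemma aeqd_sym S e W W' : ck_family M S -> aeqd S e W W' -> aeqd S e W' W.
Proof.
move=> fS [u [uu Pu hu]]; have Pu' := saS (pcomm_sa fS) Pu.
exists (star u); split=> //; first exact: unitaryV.
have ul := lam_unitary M01 fS Pu uu.
rewrite (lam_star S) starK -(unitary_distl _ _ uu) -(unitary_distr _ _ (unitaryV ul)).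
by rewrite -!mulrA (unitary_mulKr _ uu) (proj2 ul) mulr1 !mulrA cnormC.
Qed.

Lemma aeq_trans S W W' W'' : ck_family M S -> aeq S W W' -> aeq S W' W'' -> aeq S W W''.
Proof.
move=> fS h1 h2 e e0; rewrite [e]splitr; have e2 : 0 < e / 2 by rewrite divr_gt0.
exact: (aeqd_trans fS (h1 _ e2) (h2 _ e2)).
Qed.

Lemma aeq_sym S W W' : ck_family M S -> aeq S W W' -> aeq S W' W.
Proof. by move=> fS h e e0; apply/(aeqd_sym fS)/h. Qed.

(** For the family [W * S i] the endomorphism is [W lam(x) W^*]. An isometry [t] nearly intertwining
    it with its twist by [star W] satisfies [W lam(t) W^* ~ t W^*]; cancel [W^*]. *)
Lemma target_intertwiner S W (d : R) : ck_family M S -> unitary W -> pcomm S W -> 0 < d ->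
  exists t, [/\ pcomm S t, star t * t = 1 & cnorm (W * lam S t - t) <= d].
Proof.
move=> fS uW hW d0; have fW := tw_family fS uW hW.
have uW' := unitaryV uW; have hW' : pcomm (tw W S) (star W).
  by apply/tw_pcomm => //; apply: (saS (pcomm_sa fS)).
have [s [Ps os hs]] := intertwiners M01 gM fW d0 (fun a : 'I_1 => conj uW' hW').
exists (s ord0); split; [by apply/(tw_pcomm _ fS uW hW)|by rewrite os eqxx|].
by have := hs ord0; rewrite tw_lam unitary_distr.
Qed.

(** The conjugating unitary is [swindle y t] with [t] from [target_intertwiner]. In effect [W]
    absorbs a trivial summand placed on the complement of the range of [y]. *)
Lemma absorb S W y (d : R) : ck_family M S -> unitary W -> pcomm S W -> 0 < d ->
  pcomm S y -> star y * y = 1 -> cnorm (lam S y - y) <= d ->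
  aeqd S (12 * d) W (corner y W).
Proof.
move=> fS uW hW d0 Py iy hy; have sa := pcomm_sa fS.
have [t [Pt it ht]] := target_intertwiner fS uW hW d0.
have [w1 w2] := uW; have uu := swindle_unitary iy it.
have Pu : pcomm S (swindle y t).
  have Py' := saS sa Py; have Pt' := saS sa Pt.
  by rewrite /swindle; repeat (first [exact: Py|exact: Pt|exact: Py'|exact: Pt'|
    apply: (saB sa)|apply: (saD sa)|apply: (saM sa)]).
have lE : lam S (swindle y t) = swindle (lam S y) (lam S t).
  have Py' := saS sa Py; have Pt' := saS sa Pt.
  by rewrite /swindle !(lamB, lamD, lamM M01 fS, lam_star) //;
    repeat (first [exact: Py|exact: Pt|exact: Py'|exact: Pt'|apply: (saM sa)]).
exists (swindle y t); split=> //.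
have ul := lam_unitary M01 fS Pu uu.
rewrite -(unitary_distr _ _ ul) -[X in X - _]mulrA (proj1 ul) mulr1.
rewrite -(swindle_twist _ iy uW) unitary_distl; last exact: unitary_corner.
rewrite lE cnormC; apply: swindle_pert => //; try exact: (lam_iso M01 fS).
  by rewrite starM starK -mulrA (mulKx1 w2).
by rewrite -(unitary_distl _ _ uW) (unitary_mulKr _ uW).
Qed.

End Uniqueness.

(** * From homotopies and vanishing classes to approximate equivalence *)

Section Stability.
Variables (R : realType) (D : cstarAlgType R) (n : nat) (M : 'M[int]_n).
Hypotheses (M01 : mx01 M) (gM : ck_graph M).
Implicit Types (x y z t W X Y : D) (S : 'I_n -> D).

(* The family attached to the chain [w 0 = 1, ..., w N = W] absorbs the direct
   sum of the families [w 0, ..., w N.-1]; exchanging the first summand for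
   [w N] amounts, up to [e], to a cyclic permutation of the summands. *)
Lemma chain_aeqd S W (e d : R) : ck_family M S -> chain (pcomm S) e 1 W -> 0 < d ->
  aeqd S (e + d) W 1.
Proof.
move=> fS [N [w [w0 wN wu we]]] d0; have sa := pcomm_sa fS.
have e0 : 0 <= e by apply: le_trans (we 0%N); exact: cnorm_ge0.
case: N wN => [|N] wN.
  exists 1; split; [exact: unitary1|exact: (sa1 sa)|].
  by rewrite (lam1 fS) star1 mul1r mulr1 -wN w0 subrr cnorm0 addr_ge0 // ltW.
have [uW PW] : unitary W /\ pcomm S W by rewrite -wN.
(* The absorption costs [12 * del]; replacing [lam S (s k)] by [s k * w k] in both factors of two
   sums of [N.+1] terms costs [4 * N.+1 * del]. Together this is [d]. *)
pose del := d / (12 + 4 * N.+1%:R).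
have dn0 : 0 < 12 + 4 * N.+1%:R :> R by rewrite addr_gt0 ?mulr_gt0 ?ltr0Sn.
have del0 : 0 < del by rewrite divr_gt0.
have [s [Ps os hs]] := intertwiners M01 gM fS del0 (fun a : 'I_N.+1 => wu a).
have is_ a : star (s a) * s a = 1 by rewrite os eqxx.
have Pss a : pcomm S (star (s a)) by apply: (saS sa).
set y := s ord0.
have hy : cnorm (lam S y - y) <= del by have := hs ord0; rewrite w0 mulr1.
have A := absorb M01 gM fS uW PW del0 (Ps ord0) (is_ ord0) hy.
pose f := \sum_k s k * star (s k).
pose X := \sum_k s k * star (s (ordS k)).
have oo i j : star (s i) * s j = (i == j)%:R by [].
have sf k : star (s k) * f = star (s k).
  rewrite /f mulr_sumr (bigD1 k) //= mulrA is_ mul1r big1 ?addr0 // => j jk.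
  by rewrite mulrA oo eq_sym (negPf jk) mul0r.
have pf : is_proj f.
  split; first by rewrite /f star_sum; apply: eq_bigr => k _; rewrite starM starK.
  by rewrite {1}/f mulr_suml; apply: eq_bigr => k _; rewrite -mulrA sf.
have fE : f = \sum_k s (ordS k) * star (s (ordS k)).
  by rewrite /f (reindex_inj (@ordS_inj N.+1)).
have starX : star X = \sum_k s (ordS k) * star (s k).
  by rewrite /X star_sum; apply: eq_bigr => k _; rewrite starM starK.
have pX : punit f X.
  split=> //; split; rewrite starX /X mulr_suml.
    rewrite fE; apply: eq_bigr => k _; rewrite mulr_sumr (bigD1 k) //= big1 ?addr0.
      by rewrite -mulrA (mulKx1 (is_ k)).
    by move=> j jk; rewrite -mulrA (mulrA (star (s k))) oo eq_sym (negPf jk) mul0r mulr0.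
  apply: eq_bigr => k _; rewrite mulr_sumr (bigD1 k) //= big1 ?addr0.
    by rewrite -mulrA (mulKx1 (is_ _)).
  move=> j jk; rewrite -mulrA (mulrA (star (s _))) oo (inj_eq (@ordS_inj _)) eq_sym.
  by rewrite (negPf jk) mul0r mulr0.
pose v := fullu f X; have uv : unitary v := fullu_unitary pX.
have PX : pcomm S X by apply: (sa_sum sa) => k; apply: (saM sa).
have Pf : pcomm S f by apply: (sa_sum sa) => k; apply: (saM sa).
have Pv : pcomm S v by apply: (saD sa) => //; apply: (saB sa) => //; exact: (sa1 sa).
pose Z := corner y W.
(* Only the summand that wraps around to [ord0] meets [W]; there [w N] gets compared with
   [W = w N.+1], so this step of the chain is short like all the others. *)
pose Dk (k : 'I_N.+1) := if ordS k == ord0 then W else 1.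
have sZ k : star (s (ordS k)) * Z = Dk k * star (s (ordS k)).
  rewrite /Z /Dk /corner /fullu mulrDr mulrBr mulr1 !mulrA /y oo.
  case: eqP => [->|_]; first by rewrite !mul1r subrr addr0.
  by rewrite !mul0r subr0 add0r mul1r.
have fZ : (1 - f) * Z = 1 - f.
  have sy : (1 - f) * y = 0.
    apply: (can_inj (@starK R D)); rewrite starM starB star1 (proj1 pf) mulrBr mulr1.
    by rewrite sf subrr star0.
  by rewrite /Z /corner /fullu mulrDr mulrBr mulr1 !mulrA sy !mul0r subr0 add0r.
have vZ : v * Z = (\sum_k s k * Dk k * star (s (ordS k))) + (1 - f).
  rewrite /v /fullu mulrDl fZ /X mulr_suml; congr (_ + _); apply: eq_bigr => k _.
  by rewrite -!mulrA sZ.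
pose v' := (\sum_k s k * (w k * star (w (ordS k))) * star (s (ordS k))) + (1 - f).
have uw k : unitary (w k) by have [] := wu k.
have nw (k : nat) : cnorm (w k) <= 1 by apply: unitary_norm.
have d1 : cnorm (v' - v * Z) <= e.
  have -> : v' - v * Z =
      \sum_k s k * (w k * star (w (ordS k)) - Dk k) * star (s (ordS k)).
    rewrite vZ /v' opprD addrACA subrr addr0 -sumrB; apply: eq_bigr => k _.
    by rewrite mulrBr mulrBl.
  apply: diag_norm => //; first by move=> i j; rewrite oo (inj_eq (@ordS_inj _)).
  move=> k; rewrite /Dk.
  have [lt|ge] := ltnP k.+1 N.+1.
    have kE : ordS k = k.+1 :> nat by rewrite /= modn_small.
    case: eqP => [k0|_]; first by move: kE; rewrite k0.
    rewrite kE -(proj2 (uw k.+1)) unitary_distr //; exact: unitaryV.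
  have kN : k = N :> nat by apply/eqP; rewrite eqn_leq -ltnS ltn_ord -ltnS ge.
  have k0 : ordS k = ord0 by apply: val_inj; rewrite /= kN modnn.
  by rewrite k0 eqxx /= w0 star1 mulr1 -wN kN.
have ls k : cnorm (lam S (s k)) <= 1 by apply/isometry_norm/(lam_iso M01 fS).
have sw k : cnorm (s k * w k) <= 1 by apply/isometry_norm/isometryM => //; have [] := uw k.
have pr k j : cnorm (lam S (s k) * lam S (star (s j)) -
     s k * (w k * star (w j)) * star (s j)) <= del + del.
  have -> : s k * (w k * star (w j)) * star (s j) = s k * w k * star (s j * w j).
    by rewrite starM !mulrA.
  rewrite (lam_star S); apply: pert_mul => //; first by rewrite cnorm_starE.
  exact: pert_star.
have lv : lam S v = \sum_k lam S (s k) * lam S (star (s (ordS k))) +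
    (1 - \sum_k lam S (s k) * lam S (star (s k))).
  rewrite /v /fullu lamD lamB (lam1 fS) /X /f !lam_sum.
  by congr (_ + (_ - _)); apply: eq_bigr => k _; rewrite (lamM M01 fS).
have sumb (F G : 'I_N.+1 -> D) : (forall k, cnorm (F k - G k) <= del + del) ->
    cnorm (\sum_k F k - \sum_k G k) <= 2 * N.+1%:R * del.
  move=> h; rewrite -sumrB; apply: le_trans (cnorm_sum _ _ _) _.
  apply: le_trans (ler_sum _ (fun k _ => h k)) _.
  rewrite sumr_const card_ord -mulr_natl le_eqVlt; apply/orP; left; apply/eqP; ring.
have d2 : cnorm (lam S v - v') <= 4 * N.+1%:R * del.
  have -> : v' = (\sum_k s k * (w k * star (w (ordS k))) * star (s (ordS k))) +
      (1 - \sum_k s k * (w k * star (w k)) * star (s k)).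
    congr (_ + (_ - _)); rewrite /f; apply: eq_bigr => k _.
    by rewrite (proj2 (uw k)) mulr1.
  rewrite lv; apply: le_trans (pert_add (sumb _ _ _) (_ : _ <= 2 * N.+1%:R * del)) _ => //.
    by rewrite opprD addrACA subrr add0r; apply/pert_opp/sumb => k; exact: pr.
  by rewrite le_eqVlt; apply/orP; left; apply/eqP; ring.
have B : aeqd S (e + 4 * N.+1%:R * del) Z 1.
  exists v; split=> //; have ul := lam_unitary M01 fS Pv uv.
  rewrite -(unitary_distr _ _ ul) -mulrA (proj1 ul) mulr1 mul1r.
  apply: le_trans (cnorm_tri v' _ _) _; rewrite cnormC.
  by apply: lerD; [|rewrite cnormC].
have := aeqd_trans M01 fS A B.
have -> : d = del * (12 + 4 * N.+1%:R) by rewrite /del divfK // gt_eqF.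
by congr (aeqd _ _ _ _); ring.
Qed.

(** Multiplying by [star X] reduces to chains that start at [1], for the family [X * S i], which has
    the same commutant. *)
Lemma homot_aeq S X Y : ck_family M S -> homot (pcomm S) X Y -> aeq S X Y.
Proof.
move=> fS hXY e e0; have sa := pcomm_sa fS.
have [uX PX uY PY] := homot_unitary hXY.
have fX := tw_family fS uX PX.
have h : homot (pcomm (tw X S)) 1 (Y * star X).
  have := homot_mulr sa (unitaryV uX) (saS sa PX) hXY; rewrite (proj2 uX) => h e1 /h.
  move=> [N [w [w0 wN wu we]]]; exists N, w; split=> // k; have [u1 p1] := wu k.
  by split=> //; apply/(tw_pcomm _ fS uX PX).
have e2 : 0 < e / 2 by rewrite divr_gt0.
have [u [uu Pu hu]] := chain_aeqd fX (h _ e2) e2.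
move/(tw_pcomm _ fS uX PX): Pu => Pu.
apply: (aeqd_sym M01 fS); exists u; split=> //.
move: hu; rewrite tw_lam !starM starK !mulrA -splitr.
rewrite -(mulrA _ (star X) X) (proj1 uX) mulr1.
by rewrite -(proj2 uX) unitary_distr //; exact: unitaryV.
Qed.

(** Absorption leads from [corner j W] to [corner (y * j) W], homotopies through the spare isometry
    [y2] lead to [corner y W], and absorption backwards to [W]. With [e / 48] each of the two
    absorptions costs [e / 4]. *)
Lemma corner_aeq S W j : ck_family M S -> unitary W -> pcomm S W ->
  star j * j = 1 -> pcomm S j -> aeq S (corner j W) W.
Proof.
move=> fS uW PW ij Pj e e0; have sa := pcomm_sa fS.
have d0 : 0 < e / 48 by rewrite divr_gt0.
have e4 : 0 < e / 4 by rewrite divr_gt0.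
have [s [Ps os hs]] := intertwiners M01 gM fS d0
  (fun a : 'I_2 => conj (@unitary1 R D) (sa1 sa)).
have is_ a : star (s a) * s a = 1 by rewrite os eqxx.
set y := s ord0; set y2 := s ord_max.
have hy : cnorm (lam S y - y) <= e / 48 by have := hs ord0; rewrite mulr1.
have uj := unitary_corner ij uW; have Pc := corner_sa sa Pj PW.
have A1 := absorb M01 gM fS uj Pc d0 (Ps ord0) (is_ ord0) hy.
have A2 := absorb M01 gM fS uW PW d0 (Ps ord0) (is_ ord0) hy.
rewrite (corner_corner _ _ (is_ ord0)) in A1.
have iy : star y * y = 1 := is_ ord0; have iy2 : star y2 * y2 = 1 := is_ ord_max.
have yy2 : star y * y2 = 0 by rewrite /y /y2 os.
have y2y : star y2 * y = 0 by rewrite /y /y2 os.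
have Py : pcomm S y := Ps _; have Py2 : pcomm S y2 := Ps _.
have iyj : star (y * j) * (y * j) = 1 := isometryM iy ij.
have h1 : homot (pcomm S) (corner (y * j) W) (corner y2 W).
  apply: corner_homot => //; [|exact: (saM sa)].
  by rewrite starM -mulrA yy2 mulr0.
have h2 : homot (pcomm S) (corner y2 W) (corner y W).
  by apply: corner_homot.
have B := homot_aeq fS (homot_trans h1 h2) e4.
have [u [uu Pu hu]] := aeqd_trans M01 fS (aeqd_trans M01 fS A1 B) (aeqd_sym M01 fS A2).
by exists u; split=> //; apply: le_trans hu _; lra.
Qed.

(* Isometries [c j] into the corners of the [p j] carry a homotopy in the whole
   algebra to one commuting with the [p j]. *)
Lemma class_aeq (a b : D) (ha : star a * a = 1) (hb : star b * b = 1) (hab : star a * b = 0)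
    S W : ck_family M S -> unitary W -> pcomm S W ->
  (forall j, pcl ha hb hab (rproj S j) (W * rproj S j) = 0) -> aeq S W 1.
Proof.
move=> fS uW PW h0; have sa := pcomm_sa fS.
have [c hc] := boolp.choice (corner_isometry M01 gM fS).
have [p [pE pp po ps]] : exists p : 'I_n -> D, [/\ p = rproj S, forall j, is_proj (p j),
    forall i j, i != j -> p i * p j = 0 & \sum_j p j = 1].
  by exists (rproj S); split=> //; [exact: ck_proj fS|exact: ck_ortho fS|exact: ck_sum fS].
have PE x : (forall j, x * p j = p j * x) -> pcomm S x by rewrite /pcomm -pE.
have {}PW j : W * p j = p j * W by rewrite pE; exact: PW.
have PWS := PE _ PW; rewrite -{}pE in h0 hc.
have pu j : punit (p j) (W * p j).
  have [w1 w2] := uW; have [sp ppp] := pp j.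
  split=> //; split; rewrite starM sp -mulrA; first by rewrite (mulKx1 w1).
  by rewrite (mulKx ppp) mulrA PW -mulrA w2 mulr1.
(* An isometry in the commutant that moves the block of [p j] into the range of [c j * a], where the
   homotopy behind the zero class lives; [corner r W] is then contracted block by block. *)
pose r := \sum_j c j * a * p j.
have pc i j : i != j -> p i * c j = 0.
  by move=> ij; rewrite -(proj2 (hc j)) mulrA po // mul0r.
have cc i j : i != j -> star (c i) * c j = 0.
  by move=> ij; rewrite -(proj2 (hc i)) starM (proj1 (pp i)) -mulrA pc // mulr0.
have irr : star r * r = 1.
  rewrite /r star_sum mulr_suml -ps; apply: eq_bigr => j _.
  rewrite mulr_sumr (bigD1 j) //= big1 ?addr0; last first.
    move=> k kj; rewrite [star (_ * p j)]starM [star (c j * a)]starM -!mulrA (mulrA (star (c j))) cc 1?eq_sym //.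
    by rewrite mul0r !mulr0.
  rewrite [star (_ * p j)]starM (proj1 (pp j)) [star (c j * a)]starM -!mulrA (mulKx1 (proj1 (hc j))) (mulKx1 ha).
  exact: (proj2 (pp j)).
have Pr : pcomm S r.
  apply: PE => j; rewrite /r mulr_suml mulr_sumr (bigD1 j) //= [RHS](bigD1 j) //= !big1 ?addr0.
  - by rewrite -mulrA (proj2 (pp j)) !mulrA (proj2 (hc j)).
  - by move=> k kj; rewrite !mulrA pc ?mul0r // eq_sym.
  by move=> k kj; rewrite -mulrA (po _ _ kj) mulr0.
pose g j := c j * a * p j * star (c j * a).
pose v j := c j * a * (W * p j) * star (c j * a).
have ica j : star (c j * a) * (c j * a) = 1 by apply: isometryM => //; have [] := hc j.
have pv j : punit (g j) (v j).
  by apply: punit_conj; rewrite // (mulKx1 (ica j)).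
have gg i j : i != j -> g i * g j = 0.
  move=> ij; rewrite /g [star (c i * a)]starM -!mulrA (mulrA (star (c i))) cc //.
  by rewrite mul0r !mulr0.
have hg j : homot (pcomm S) (fullu (g j) (v j)) 1.
  have h1 := proj1 (kcl_eq0 ha hb hab (fullu_unitary (pu j))) (h0 j).
  (* Compressed to the range of [c j], the chain is trivial outside [p j] and therefore stays in the
     commutant. *)
  move=> e /h1 [N [w [w0 wN wu we]]]; exists N, (fun k => corner (c j) (w k)).
  have [ic pcj] := hc j.
  split.
  - rewrite w0 corner_corner // /corner /fullu /g /v.
    by rewrite !(mulrDr, mulrDl, mulrN, mulNr, mulr1, mul1r); abel.
  - by rewrite wN corner1.
  - move=> k; have [uk _] := wu k; split; first exact: unitary_corner.
    have Pc x : pcomm S (c j * x * star (c j)).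
      apply: PE => i; have [->|ij] := eqVneq i j.
        rewrite !mulrA pcj -[_ * star (c j) * _]mulrA; congr (_ * _).
        by rewrite -{2}pcj starM (proj1 (pp j)).
      rewrite !mulrA -[p i * _]/(p i * c j) pc // !mul0r -mulrA.
      have -> : star (c j) * p i = 0 by rewrite -(proj1 (pp i)) -starM pc ?star0.
      by rewrite mulr0.
    apply: (saD sa) => //; apply: (saB sa); first exact: (sa1 sa).
    by have := Pc 1; rewrite mulr1.
  move=> k; have -> : corner (c j) (w k) - corner (c j) (w k.+1)
      = c j * (w k - w k.+1) * star (c j).
    by rewrite /corner /fullu !(mulrDr, mulrDl, mulrN, mulNr); abel.
  apply: le_trans (we k); apply: le_trans (cnormMr_le _ _) _.
    by rewrite cnorm_starE isometry_norm.
  by apply: cnormMl_le; apply: isometry_norm.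
have hs (l : seq 'I_n) : uniq l -> punit (\sum_(j <- l) g j) (\sum_(j <- l) v j) /\
    homot (pcomm S) (fullu (\sum_(j <- l) g j) (\sum_(j <- l) v j)) 1.
  elim: l => [|j l ih] /=.
    rewrite !big_nil => _; split; first exact: (punit_proj (is_proj0 D)).
    by rewrite /fullu add0r subr0; apply: homot_refl; [exact: unitary1|exact: (sa1 sa)].
  move=> /andP[jl /ih [pl hl]]; rewrite !big_cons.
  have jl0 : g j * (\sum_(k <- l) g k) = 0.
    rewrite mulr_sumr big_seq big1 // => k kl; apply: gg.
    by apply: contraNneq jl => ->.
  split; first exact: punitD.
  rewrite fulluD //; have [uj Pj _ _] := homot_unitary (hg j).
  apply: homot_trans (hg j); rewrite -[X in homot _ _ X]mulr1.
  exact: homot_mull.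
have [_ hr] := hs (index_enum 'I_n) (index_enum_uniq _).
have rr : r * star r = \sum_j g j.
  rewrite {1}/r mulr_suml; apply: eq_bigr => j _; rewrite /r star_sum mulr_sumr.
  rewrite (bigD1 j) //= big1 ?addr0; last first.
    move=> k kj; rewrite [star (_ * p k)]starM (proj1 (pp k)) -!mulrA (mulrA (p j)).
    by rewrite po 1?eq_sym // mul0r !mulr0.
  by rewrite [star (_ * p j)]starM (proj1 (pp j)) /g -!mulrA (mulKx (proj2 (pp j))).
have rWr : r * W * star r = \sum_j v j.
  rewrite {1}/r !mulr_suml; apply: eq_bigr => j _; rewrite /r star_sum mulr_sumr.
  rewrite (bigD1 j) //= big1 ?addr0; last first.
    move=> k kj; rewrite [star (_ * p k)]starM (proj1 (pp k)) -!mulrA (mulrA W) PW.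
    by rewrite -mulrA (mulrA (p j) (p k)) po 1?eq_sym // mul0r !mulr0.
  rewrite [star (_ * p j)]starM (proj1 (pp j)) /v -!mulrA (mulrA W) PW -mulrA.
  by rewrite (mulKx (proj2 (pp j))) (mulrA (p j)) -PW -mulrA.
apply: (aeq_trans M01 fS (aeq_sym M01 fS (corner_aeq fS uW PWS irr Pr))).
by apply: homot_aeq => //; rewrite /corner rr rWr.
Qed.

End Stability.

(** * Approximate intertwining *)

Section Generation.
Variables (R : realType) (A : cstarAlgType R) (n : nat) (S : 'I_n -> A).
Hypothesis gS : cstar_generated S.

Lemma generated_ind (Q : A -> Prop) : Q 1 ->
  (forall (c : R[i]) x y, Q x -> Q y -> Q (c *: x + y)) ->
  (forall x y, Q x -> Q y -> Q (x * y)) ->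
  (forall x, Q x -> Q (star x)) ->
  (forall x, (forall e : R, 0 < e -> exists2 y, Q y & cnorm (x - y) < e) -> Q x) ->
  (forall i, Q (S i)) -> forall x, Q x.
Proof.
move=> q1 ql qm qs qc qS x; pose E : {pred A} := fun y => `[< Q y >].
have Ein y : (y \in E) = `[< Q y >] by [].
suff : x \in E by rewrite Ein => /asboolP.
apply: gS => [|i]; last by rewrite Ein; apply/asboolP.
split; first split.
- by rewrite Ein; apply/asboolP.
- by move=> c y z; rewrite !Ein => /asboolP hy /asboolP hz; apply/asboolP/ql.
- by move=> y z; rewrite !Ein => /asboolP hy /asboolP hz; apply/asboolP/qm.
- by move=> y; rewrite !Ein => /asboolP hy; apply/asboolP/qs.
move=> y hy; rewrite Ein; apply/asboolP/qc => e e0.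
by have [z] := hy e e0; rewrite Ein => /asboolP hz hl; exists z.
Qed.

End Generation.

Section PointwiseLimits.
Variables (R : realType) (A B : cstarAlgType R).

(** Stated for bare functions, so that conjugates of a homomorphism by varying unitaries qualify
    without being bundled. *)
Record star_maps (f : nat -> A -> B) : Prop := StarMaps {
  sm1 : forall k, f k 1 = 1;
  smL : forall k (c : R[i]) x y, f k (c *: x + y) = c *: f k x + f k y;
  smM : forall k x y, f k (x * y) = f k x * f k y;
  smS : forall k x, f k (star x) = star (f k x);
  smC : forall k x, cnorm (f k x) <= cnorm x }.

Lemma smB f : star_maps f -> forall k x y, f k x - f k y = f k (x - y).
Proof.
move=> hf k x y; have := smL hf k (-1) y x.
by rewrite !scaleN1r (addrC (- y)) => ->; rewrite addrC.
Qed.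

Lemma conj_star_maps (phi : {lrmorphism A -> B}) (u : nat -> B) : star_morphism phi ->
  (forall k, unitary (u k)) -> star_maps (fun k x => u k * phi x * star (u k)).
Proof.
move=> hs uu; split=> k.
- by rewrite rmorph1 mulr1; have [] := uu k.
- by move=> c x y; rewrite linearP mulrDr mulrDl -scalerAr -scalerAl.
- move=> x y; rewrite rmorphM /= -!mulrA; have [h _] := uu k.
  by rewrite (mulKx1 h).
- by move=> x; rewrite hs !starM starK mulrA.
move=> x; apply: le_trans (contractive hs x).
apply: le_trans (cnormMr_le _ _) _; first by rewrite cnorm_starE unitary_norm.
by apply: cnormMl_le; apply: unitary_norm.
Qed.

Lemma cvtoZ (D : cstarAlgType R) (c : R[i]) (u : nat -> D) x :
  cvto u x -> cvto (fun k => c *: u k) (c *: x).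
Proof.
move=> h; have := cvtoMl (c *: 1) h => h2 e e0; have [N hN] := h2 e e0.
by exists N => k /hN; rewrite -!scalerAl !mul1r.
Qed.

Lemma cvto_ext (D : cstarAlgType R) (u v : nat -> D) x : (forall k, u k = v k) ->
  cvto u x -> cvto v x.
Proof. by move=> uv h e e0; have [N hN] := h e e0; exists N => k /hN; rewrite uv. Qed.

(** The points of convergence form a unital subalgebra stable under [star], and it is closed because
    all maps are contractive. *)
Lemma star_maps_cvto n (S : 'I_n -> A) f (g : {lrmorphism A -> B}) :
  cstar_generated S -> star_maps f -> star_morphism g ->
  (forall i, cvto (fun k => f k (S i)) (g (S i))) -> forall x, cvto (fun k => f k x) (g x).
Proof.
move=> gS hf hg hS; apply: (generated_ind gS) => //.
- by rewrite rmorph1; apply: cvto_ext (cvto_cst 1) => k; rewrite (sm1 hf).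
- move=> c x y hx hy; rewrite linearP; apply: cvto_ext (cvtoD (cvtoZ c hx) hy) => k.
  by rewrite (smL hf).
- move=> x y hx hy; rewrite rmorphM; apply: cvto_ext (cvtoM hx hy) => k.
  by rewrite (smM hf).
- by move=> x hx; rewrite hg; apply: cvto_ext (cvto_star hx) => k; rewrite (smS hf).
move=> x hx e e0; have e3 : 0 < e / 3 by rewrite divr_gt0.
have [y hy xy] := hx _ e3; have [N hN] := hy _ e3; exists N => k /hN h.
have h1 : cnorm (f k x - f k y) < e / 3.
  by rewrite (smB hf); apply: le_lt_trans (smC hf _ _) xy.
have h2 : cnorm (g y - g x) < e / 3.
  by rewrite cnormC -raddfB; apply: le_lt_trans (contractive hg _) xy.
have := cnorm_tri (f k y) (f k x) (g x); have := cnorm_tri (g y) (f k y) (g x); lra.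
Qed.

Lemma cvto_comp (f : nat -> A -> B) (u : nat -> A) x y : star_maps f ->
  cvto u x -> cvto (fun k => f k x) y -> cvto (fun k => f k (u k)) y.
Proof.
move=> hf hu hx e e0; have e2 : 0 < e / 2 by rewrite divr_gt0.
have [N1 h1] := hu _ e2; have [N2 h2] := hx _ e2; exists (maxn N1 N2) => k.
rewrite geq_max => /andP[/h1 a1 /h2 a2].
apply: le_lt_trans (cnorm_tri (f k x) _ _) _.
rewrite (smB hf); have := smC hf k (u k - x); lra.
Qed.

End PointwiseLimits.

Section FamilyMaps.
Variables (R : realType) (n : nat) (M : 'M[int]_n).

Lemma ck_family_map (A B : cstarAlgType R) (f : {lrmorphism A -> B}) (S : 'I_n -> A) :
  star_morphism f -> ck_family M S -> ck_family M (fun i => f (S i)).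
Proof.
move=> hf [h1 h2 h3]; split=> [i||i].
- by rewrite /partial_isometry -hf -!rmorphM h1.
- by rewrite -(rmorph1 f) -h2 rmorph_sum; apply: eq_bigr => i _; rewrite rmorphM /= hf.
rewrite -hf -rmorphM h3 rmorph_sum; apply: eq_bigr => j _.
by rewrite rmorphMz rmorphM /= hf.
Qed.

Lemma ck_family_conj (A : cstarAlgType R) (S : 'I_n -> A) u : unitary u ->
  ck_family M S -> ck_family M (fun i => u * S i * star u).
Proof.
move=> [u1 u2] [h1 h2 h3]; have pE i : u * S i * star u * star (u * S i * star u)
    = u * (S i * star (S i)) * star u.
  by rewrite !starM starK -!mulrA (mulKx1 u1).
split=> [i||i].
- rewrite /partial_isometry pE -!mulrA (mulKx1 u1).
  have := h1 i; rewrite /partial_isometry -mulrA => hi.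
  by rewrite (mulrA (star _)) (mulrA (S i)) hi.
- under eq_bigr do rewrite pE.
  by rewrite -mulr_suml -mulr_sumr h2 mulr1.
rewrite !starM starK -!mulrA (mulKx1 u1) (mulrA (star (S i))) h3 mulr_suml mulr_sumr.
by apply: eq_bigr => j _; rewrite pE mulrzAl mulrzAr mulrA.
Qed.

Lemma ck_family_lim (A : cstarAlgType R) (S : nat -> 'I_n -> A) (T : 'I_n -> A) :
  (forall k, ck_family M (S k)) -> (forall i, cvto (fun k => S k i) (T i)) -> ck_family M T.
Proof.
move=> hS hT.
have cs (F : nat -> 'I_n -> A) (l : 'I_n -> A) :
    (forall i, cvto (fun k => F k i) (l i)) -> cvto (fun k => \sum_i F k i) (\sum_i l i).
  move=> h; elim: (index_enum _) => [|i r ih].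
    by rewrite big_nil; apply: cvto_ext (cvto_cst 0) => k; rewrite big_nil.
  by rewrite big_cons; apply: cvto_ext (cvtoD (h i) ih) => k; rewrite big_cons.
have hp i : cvto (fun k => S k i * star (S k i)) (T i * star (T i)).
  by apply: cvtoM => //; apply: cvto_star.
split=> [i||i].
- apply: (cvto_uniq (cvtoM (hp i) (hT i))); apply: cvto_ext (hT i) => k.
  by have [h _ _] := hS k; rewrite h.
- apply: (cvto_uniq (cs _ _ hp)); apply: cvto_ext (cvto_cst 1) => k.
  by have [_ -> _] := hS k.
apply: (cvto_uniq (cvtoM (cvto_star (hT i)) (hT i))).
have h : cvto (fun k => \sum_j (S k j * star (S k j)) *~ M i j) (\sum_j (T j * star (T j)) *~ M i j).
  apply: cs => j; have z (x : A) (c : int) : x *~ c = (c%:~R : R[i]) *: x by rewrite scaler_int.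
  by rewrite z; apply: cvto_ext (cvtoZ _ (hp j)) => k; rewrite z.
by apply: cvto_ext h => k; have [_ _ ->] := hS k.
Qed.

End FamilyMaps.

Section Intertwining.
Variable R : realType.

Definition approx_inner (A : cstarAlgType R) n (S : 'I_n -> A) (al : A -> A) :=
  forall e : R, 0 < e -> exists2 u, unitary u & forall i, cnorm (u * al (S i) * star u - S i) <= e.

Lemma approx_inner_all (A : cstarAlgType R) n (S : 'I_n -> A) (al : {lrmorphism A -> A}) :
  cstar_generated S -> star_morphism al -> approx_inner S al ->
  forall (X : seq A) (e : R), 0 < e ->
    exists2 u, unitary u & forall x, x \in X -> cnorm (u * al x * star u - x) <= e.
Proof.
move=> gS hal ai X e e0.
have ai' k : exists u, unitary u /\
    forall i, cnorm (u * al (S i) * star u - S i) <= k.+1%:R^-1.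
  by have [|u uu hu] := ai k.+1%:R^-1; [rewrite invr_gt0 ltr0Sn|exists u].
have [u hu] := boolp.choice ai'.
have uu k : unitary (u k) by have [] := hu k.
have cv := @star_maps_cvto R A A n S _ (@GRing.LRMorphism.clone _ _ _ _ idfun _) gS
  (conj_star_maps hal uu) (fun _ => erefl).
have {}cv x : cvto (fun k => u k * al x * star (u k)) x.
  apply: cv => i d d0; have [N hN] := inv_small d0; exists N => k Nk.
  by have [_ h] := hu k; apply: le_lt_trans (h i) (hN _ Nk).
suff [k hk] : exists N, forall k, (N <= k)%N ->
    forall x, x \in X -> cnorm (u k * al x * star (u k) - x) < e.
  by exists (u k) => // x /(hk k (leqnn _))/ltW.
elim: X => [|x X [N hN]]; first by exists 0%N.
have [M hM] := cv x _ e0; exists (maxn N M) => k; rewrite geq_max => /andP[Nk Mk] y.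
by rewrite inE => /predU1P[->|/(hN _ Nk)//]; exact: hM.
Qed.

Definition Ad (A : cstarAlgType R) (u x : A) := u * x * star u.

Lemma AdM (A : cstarAlgType R) (u v x : A) : Ad (u * v) x = Ad u (Ad v x).
Proof. by rewrite /Ad starM !mulrA. Qed.

Lemma AdK (A : cstarAlgType R) (u x : A) : unitary u -> Ad (star u) (Ad u x) = x.
Proof. by move=> [h1 h2]; rewrite /Ad starK -!mulrA h1 (mulKx1 h1) mulr1. Qed.

(* Corrects [Ad u \o phi] so that composing it after a map [Ad v \o psi] is close
   to the identity on a finite set. *)
Lemma correct_inner (A B : cstarAlgType R) n (S : 'I_n -> A) (phi : {lrmorphism A -> B})
    (psi : {lrmorphism B -> A}) : cstar_generated S -> star_morphism phi ->
  star_morphism psi -> approx_inner S (psi \o phi) ->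
  forall (X : seq A) (e : R) (v : B), 0 < e -> unitary v ->
    exists2 u, unitary u & forall x, x \in X -> cnorm (Ad u (psi (Ad v (phi x))) - x) <= e.
Proof.
move=> gS hphi hpsi ai X e v e0 uv.
have hc : star_morphism (psi \o phi) by move=> x; rewrite /= hphi hpsi.
have [u uu hu] := @approx_inner_all A n S (psi \o phi) gS hc ai X e e0.
have upv : unitary (psi v) := rmorph_unitary hpsi uv.
exists (u * star (psi v)); first by apply: unitaryM => //; exact: unitaryV.
move=> x xX; have -> : Ad (u * star (psi v)) (psi (Ad v (phi x))) = Ad u (psi (phi x)).
  rewrite AdM; congr Ad; rewrite -[RHS](AdK _ upv); congr Ad.
  by rewrite /Ad !rmorphM /= hpsi.
exact: hu.
Qed.

Variables (A B : cstarAlgType R) (n m : nat) (M : 'M[int]_n) (L : 'M[int]_m).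
Variables (S : 'I_n -> A) (T : 'I_m -> B).
Hypotheses (fS : ck_family M S) (fT : ck_family L T).
Hypotheses (gS : cstar_generated S) (gT : cstar_generated T).
Hypothesis uS : forall (C : cstarAlgType R) (S' : 'I_n -> C), ck_family M S' ->
  exists f : {lrmorphism A -> C}, star_morphism f /\ forall i, f (S i) = S' i.
Hypothesis uT : forall (C : cstarAlgType R) (T' : 'I_m -> C), ck_family L T' ->
  exists f : {lrmorphism B -> C}, star_morphism f /\ forall i, f (T i) = T' i.
Variables (phi : {lrmorphism A -> B}) (psi : {lrmorphism B -> A}).
Hypotheses (hphi : star_morphism phi) (hpsi : star_morphism psi).
Hypotheses (aiA : approx_inner S (psi \o phi)) (aiB : approx_inner T (phi \o psi)).

Lemma intertwining_sequences : exists (v : nat -> B) (u : nat -> A),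
  [/\ forall k, unitary (v k), forall k, unitary (u k),
    forall k i, cnorm (Ad (u k) (psi (Ad (v k) (phi (S i)))) - S i) <= 2^-1 ^+ k,
    forall k j, cnorm (Ad (v k.+1) (phi (Ad (u k) (psi (T j)))) - T j) <= 2^-1 ^+ k &
    forall k, (forall i, cnorm (Ad (v k.+1) (phi (Ad (u k) (psi (Ad (v k) (phi (S i)))))) -
         Ad (v k) (phi (S i))) <= 2^-1 ^+ k) /\
      (forall j, cnorm (Ad (u k.+1) (psi (Ad (v k.+1) (phi (Ad (u k) (psi (T j)))))) -
         Ad (u k) (psi (T j))) <= 2^-1 ^+ k)].
Proof.
have h0 k : 0 < (2^-1 : R) ^+ k by rewrite exprn_gt0 // invr_gt0.
(* Unitarity is a premise inside [next] because the choice function has to be total; on other pairs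
   the value [(1, 1)] serves. *)
pose next (ks : nat * (B * A)) (s : B * A) := let k := ks.1 in let v := ks.2.1 in let u := ks.2.2 in
  unitary v -> unitary u ->
  [/\ unitary s.1, unitary s.2,
    forall i, cnorm (Ad s.2 (psi (Ad s.1 (phi (S i)))) - S i) <= 2^-1 ^+ k.+1,
    forall j, cnorm (Ad s.1 (phi (Ad u (psi (T j)))) - T j) <= 2^-1 ^+ k &
    (forall i, cnorm (Ad s.1 (phi (Ad u (psi (Ad v (phi (S i)))))) - Ad v (phi (S i))) <= 2^-1 ^+ k) /\
    (forall j, cnorm (Ad s.2 (psi (Ad s.1 (phi (Ad u (psi (T j)))))) - Ad u (psi (T j)))
       <= 2^-1 ^+ k)].
have ex ks : exists s, next ks s.
  case: ks => k [v u]; rewrite /next /=.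
  have [uv|nv] := pselect (unitary v); last by exists (1, 1).
  have [uu|nu] := pselect (unitary u); last by exists (1, 1).
  (* The finite set holds the generators of one algebra and the current images of those of the
     other; the images make the sequences Cauchy. *)
  have [v' uv' hv'] := correct_inner gT hpsi hphi aiB
    ([seq T j | j <- enum 'I_m] ++ [seq Ad v (phi (S i)) | i <- enum 'I_n]) (h0 k) uu.
  have [u' uu' hu'] := correct_inner gS hphi hpsi aiA
    ([seq S j | j <- enum 'I_n] ++ [seq Ad u (psi (T i)) | i <- enum 'I_m]) (h0 k.+1) uv'.
  exists (v', u') => _ _ /=; split=> // [i|j|].
  - by apply: hu'; rewrite mem_cat map_f ?mem_enum.
  - by apply: hv'; rewrite mem_cat map_f ?mem_enum.
  split=> [i|j]; first by apply: hv'; rewrite mem_cat [X in _ || X]map_f ?mem_enum ?orbT.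
  apply: le_trans (hu' _ _) _; first by rewrite mem_cat [X in _ || X]map_f ?mem_enum ?orbT.
  by rewrite exprS ler_piMl ?(ltW (h0 k)) //; lra.
have [f hf] := boolp.choice ex.
have [u0 uu0 hu0] := correct_inner gS hphi hpsi aiA [seq S j | j <- enum 'I_n] (h0 0%N)
  (@unitary1 R B).
pose st := fix st k : B * A := if k is l.+1 then f (l, st l) else (1, u0).
have ust k : unitary (st k).1 /\ unitary (st k).2.
  elim: k => [|k [h1 h2]] /=; first by split=> //; exact: unitary1.
  by have [] := hf (k, st k) h1 h2.
exists (fun k => (st k).1), (fun k => (st k).2); split.
- by move=> k; have [] := ust k.
- by move=> k; have [] := ust k.
- case=> [|k] i; first by apply: hu0; rewrite map_f ?mem_enum.
  by have [h1 h2] := ust k; have [_ _ h _ _] := hf (k, st k) h1 h2; exact: h.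
- by move=> k j; have [h1 h2] := ust k; have [_ _ _ h _] := hf (k, st k) h1 h2; exact: h.
by move=> k; have [h1 h2] := ust k; have [_ _ _ _ h] := hf (k, st k) h1 h2; exact: h.
Qed.

(** The limits of the images of the generators form families again, so the universal properties
    yield [f] and [g]. By [star_maps_cvto] these are the pointwise limits, hence inverse to each
    other on generators and then everywhere. *)
Lemma intertwining : cstar_isomorphic A B.
Proof.
have [v [u [uv uu h1 h2 h3]]] := intertwining_sequences.
pose ph k x := Ad (v k) (phi x); pose ps k y := Ad (u k) (psi y).
have mph : star_maps ph := conj_star_maps hphi uv.
have mps : star_maps ps := conj_star_maps hpsi uu.
have mph1 : star_maps (fun k => ph k.+1) := conj_star_maps hphi (fun k => uv k.+1).
have h20 : (0 : R) <= 2^-1 by lra.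
have h21 : (2^-1 : R) < 1 by lra.
have cph i : exists l, cvto (fun k => ph k (S i)) l.
  apply: (geometric_cvto h20 h21 (B := 2)) => k.
  apply: le_trans (cnorm_tri (ph k.+1 (ps k (ph k (S i)))) _ _) _.
  have [h _] := h3 k; have := h i; rewrite -/(ph k (S i)) -/(ps _ _) -/(ph _ _).
  rewrite (smB mph); have := smC mph k.+1 (S i - ps k (ph k (S i))).
  have := h1 k i; rewrite -/(ph k (S i)) -/(ps _ _) cnormC; lra.
have cps j : exists l, cvto (fun k => ps k (T j)) l.
  apply: (geometric_cvto h20 h21 (B := 2)) => k.
  apply: le_trans (cnorm_tri (ps k.+1 (ph k.+1 (ps k (T j)))) _ _) _.
  have [_ h] := h3 k; have := h j; rewrite -/(ps k (T j)) -/(ph _ _) -/(ps _ _).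
  rewrite (smB mps); have := smC mps k.+1 (T j - ph k.+1 (ps k (T j))).
  have := h2 k j; rewrite -/(ps k (T j)) -/(ph _ _) cnormC; lra.
have [S' hS'] := boolp.choice cph; have [T' hT'] := boolp.choice cps.
have fph k : ck_family M (fun i => ph k (S i)).
  exact: (ck_family_conj (uv k) (ck_family_map hphi fS)).
have fps k : ck_family L (fun i => ps k (T i)).
  exact: (ck_family_conj (uu k) (ck_family_map hpsi fT)).
have [f [hf fE]] := uS (ck_family_lim fph hS').
have [g [hg gE]] := uT (ck_family_lim fps hT').
have cf : forall x, cvto (fun k => ph k x) (f x).
  by apply: (star_maps_cvto gS mph hf) => i; rewrite fE.
have cg : forall y, cvto (fun k => ps k y) (g y).
  by apply: (star_maps_cvto gT mps hg) => j; rewrite gE.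
have small (D : cstarAlgType R) (w : nat -> D) x :
    (forall k, cnorm (w k - x) <= 2^-1 ^+ k) -> cvto w x.
  move=> hw e e0; have [N hN] := expr_small h20 h21 e0; exists N => k /hN.
  exact: le_lt_trans.
have gf i : g (f (S i)) = S i.
  apply: (cvto_uniq (cvto_comp mps (cf (S i)) (cg _))).
  by apply: small => k; exact: h1.
have fg j : f (g (T j)) = T j.
  have cf1 y : cvto (fun k => ph k.+1 y) (f y).
    by move=> e e0; have [N hN] := cf y e e0; exists N => k Nk; apply: hN; apply: leqW.
  apply: (cvto_uniq (cvto_comp mph1 (cg (T j)) (cf1 _))).
  by apply: small => k; exact: h2.
exists f; split=> //; exists g.
- apply: (generated_ind gS); rewrite ?rmorph1 //.
  + by move=> c x y hx hy; rewrite linearP /= linearP /= hx hy.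
  + by move=> x y hx hy; rewrite rmorphM /= rmorphM /= hx hy.
  + by move=> x hx; rewrite hf hg hx.
  move=> x hx; apply/eqP; rewrite -subr_eq0; apply/eqP/cnorm_le0 => e e0.
  have e2 : 0 < e / 2 by rewrite divr_gt0.
  have [y hy xy] := hx _ e2; apply: le_trans (cnorm_tri y _ _) _.
  rewrite -{1}hy -raddfB -raddfB; have := contractive hg (f (x - y)).
  have := contractive hf (x - y); rewrite [cnorm (y - x)]cnormC; lra.
apply: (generated_ind gT); rewrite ?rmorph1 //.
- by move=> c x y hx hy; rewrite linearP /= linearP /= hx hy.
- by move=> x y hx hy; rewrite rmorphM /= rmorphM /= hx hy.
- by move=> x hx; rewrite hg hf hx.
move=> x hx; apply/eqP; rewrite -subr_eq0; apply/eqP/cnorm_le0 => e e0.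
have e2 : 0 < e / 2 by rewrite divr_gt0.
have [y hy xy] := hx _ e2; apply: le_trans (cnorm_tri y _ _) _.
rewrite -{1}hy -raddfB -raddfB; have := contractive hf (g (x - y)).
have := contractive hg (x - y); rewrite [cnorm (y - x)]cnormC; lra.
Qed.

End Intertwining.

(** * The absorption of an O_2-corner *)

Section PisoCalculus.
Variables (R : realType) (D : cstarAlgType R).
Implicit Types (p q r x y z g : D).

Lemma proj_leC p q : is_proj p -> is_proj q -> p * q = q -> q * p = q.
Proof. by move=> [sp _] [sq _] h; rewrite -{1}sq -{1}sp -starM h sq. Qed.

Lemma piso_id p : is_proj p -> piso p p p.
Proof. by move=> [sp pp]; split; rewrite sp pp. Qed.

Lemma pisoM p q r x y : is_proj p -> piso p q x -> piso q r y -> piso p r (y * x).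
Proof.
move=> pp hx hy; have [xp qx pq] := piso_proj pp hx; have [yq ry _] := piso_proj pq hy.
case: hx hy => [x1 x2] [y1 y2]; split; rewrite starM -mulrA.
  by rewrite (mulKx y1) qx.
by rewrite (mulKx x2) -{1}(proj1 pq) -starM yq.
Qed.

Lemma piso_ortho p q p' q' x y : is_proj p -> is_proj p' -> piso p q x -> piso p' q' y ->
  (p * p' = 0 -> x * star y = 0) /\ (q * q' = 0 -> star x * y = 0).
Proof.
move=> pp pp' hx hy; have [xp qx pq] := piso_proj pp hx; have [yp qy pq'] := piso_proj pp' hy.
split=> h.
  by rewrite -xp -yp starM (proj1 pp') -mulrA (mulrA p) h mul0r mulr0.
by rewrite -qx -qy starM (proj1 pq) -mulrA (mulrA q) h mul0r mulr0.
Qed.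

Lemma pisoD p q p' q' x y : is_proj p -> is_proj p' -> piso p q x -> piso p' q' y ->
  p * p' = 0 -> q * q' = 0 -> piso (p + p') (q + q') (x + y).
Proof.
move=> pp pp' hx hy h h'; have [e1 e2] := piso_ortho pp pp' hx hy.
have [_ _ pq] := piso_proj pp hx; have [_ _ pq'] := piso_proj pp' hy.
have [e3 e4] := piso_ortho pp' pp hy hx.
have f1 := e1 h; have f2 := e2 h'.
have f3 := e3 (proj_ortho_sym pp pp' h); have f4 := e4 (proj_ortho_sym pq pq' h').
case: hx hy => [x1 x2] [y1 y2].
by split; rewrite starD mulrDr !mulrDl ?f1 ?f2 ?f3 ?f4 ?x1 ?x2 ?y1 ?y2 addr0 add0r.
Qed.

Lemma piso_sub p q r x : is_proj p -> is_proj r -> p * r = r -> piso p q x ->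
  piso r (x * r * star x) (x * r).
Proof.
move=> pp pr h [x1 x2]; have [sr rr] := pr; split; rewrite starM sr -!mulrA.
  by rewrite (mulKx x1) h.
by rewrite (mulKx rr).
Qed.

Lemma piso_proj_r p q x : is_proj p -> piso p q x -> is_proj q.
Proof. by move=> pp /(piso_proj pp)[]. Qed.

Lemma piso_punit p q x y : is_proj p -> piso p q x -> piso p q y -> punit q (x * star y).
Proof.
move=> pp hx hy; split; first exact: (piso_proj_r pp hx).
exact: (pisoM (piso_proj_r pp hx) (piso_sym hy) hx).
Qed.

Lemma piso_conj p q w y : piso p q y -> punit p w -> punit q (y * w * star y).
Proof.
move=> [y1 y2] pw; have pp := proj1 pw; have [yp _ _] := piso_proj pp (conj y1 y2).
have := punit_conj (y := y) pw; rewrite yp y2; apply.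
by rewrite y1.
Qed.

Section PisoClass.
Variables (a b : D) (ha : star a * a = 1) (hb : star b * b = 1) (hab : star a * b = 0).
Local Notation cl := (pcl ha hb hab).

Lemma cl_piso p q w y : piso p q y -> punit p w -> cl q (y * w * star y) = cl p w.
Proof.
move=> [y1 y2] pw; have pp := proj1 pw; have [yp _ _] := piso_proj pp (conj y1 y2).
have := pcl_conj ha hb hab (y := y) pw; rewrite yp y2; apply.
by rewrite y1.
Qed.

Lemma cl_extend p q w : is_proj q -> punit p w -> p * q = 0 -> cl (p + q) (w + q) = cl p w.
Proof. by move=> pq pw h; rewrite pclD ?pcl_proj ?addr0 //; exact: punit_proj. Qed.

End PisoClass.

End PisoCalculus.

(* [o2b] and [o2c] are isometries of the corner of [pv] whose range projections
   sum to [pv], a copy of the generators of [O_2]; [embed_o2] embeds that corner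
   under [Q], and [tau_] then absorbs [pv] into [Q].  Locked, because rewriting
   would otherwise see through these products. *)
HB.lock Definition o2b (R : realType) (D : cstarAlgType R) (pu pv pw sv sw : D) : D :=
  sv * (pu + pv + sw * pw) * star sv.
HB.lock Definition o2c (R : realType) (D : cstarAlgType R) (pv sv sw : D) : D := sv * sw * pv.
HB.lock Definition embed_o2 (R : realType) (D : cstarAlgType R) (pv om su : D) : D := om * su * pv.
HB.lock Definition theta (R : realType) (D : cstarAlgType R) (i b c : D) : D :=
  i * star b + star c.
HB.lock Definition tau_ (R : realType) (D : cstarAlgType R) (Q i b c : D) : D :=
  (Q - i * star i) + theta i b c * star i.
Arguments o2b {R D} pu pv pw sv sw.
Arguments o2c {R D} pv sv sw.
Arguments embed_o2 {R D} pv om su.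
Arguments theta {R D} i b c.
Arguments tau_ {R D} Q i b c.
Definition tau (R : realType) (D : cstarAlgType R) (Q pu pv pw om su sv sw : D) : D :=
  tau_ Q (embed_o2 pv om su) (o2b pu pv pw sv sw) (o2c pv sv sw).
Definition o2_unlock := (@o2b.unlock, @o2c.unlock, @embed_o2.unlock, @theta.unlock, @tau_.unlock).

Section Gadget.
Variables (R : realType) (D : cstarAlgType R).
Variables (Q pu pv pw pN : D).
Hypotheses (jQ : is_proj Q) (ju : is_proj pu) (jv : is_proj pv) (jw : is_proj pw).
Hypotheses (Qu : Q * pu = 0) (Qv : Q * pv = 0) (Qw : Q * pw = 0).
Hypotheses (uv : pu * pv = 0) (uw : pu * pw = 0) (vw : pv * pw = 0).

Record gadget (sN om su sv sw : D) : Prop := Gadget {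
  gN : piso pu pN sN;
  gom : star om * om = pu;
  gQom : Q * om = om;
  gu : piso (Q + pv) pu su;
  gv : piso (pu + pv + pw) pv sv;
  gw : piso (pv + pw) pw sw }.

Lemma proj_uvw : is_proj (pu + pv + pw).
Proof. by apply: projD; [exact: projD| |rewrite mulrDl uw vw addr0]. Qed.

Lemma proj_vw : is_proj (pv + pw).
Proof. exact: projD. Qed.

Lemma jQv : is_proj (Q + pv).
Proof. exact: projD. Qed.

(** [sw] splits [pw] into a copy of [pv] and a copy of [pw]. So [pu + pv + pw] is the sum of a copy
    of itself and a copy of [pv], and [sv] carries this splitting to [pv]. *)
Lemma o2_facts sv sw : piso (pu + pv + pw) pv sv -> piso (pv + pw) pw sw ->
  let b := o2b pu pv pw sv sw in let c := o2c pv sv sw in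
  [/\ piso pv (b * star b) b, piso pv (c * star c) c, star b * c = 0,
      b * star b + c * star c = pv & pv * b = b /\ pv * c = c].
Proof.
move=> hv hw b c.
have [vt pvv _] := piso_proj proj_uvw hv; have [wt pww _] := piso_proj proj_vw hw.
have vu := proj_ortho_sym ju jv uv; have wu := proj_ortho_sym ju jw uw.
have wv := proj_ortho_sym jv jw vw.
have hwv := piso_sub proj_vw jv (_ : (pv + pw) * pv = pv) hw.
have hww := piso_sub proj_vw jw (_ : (pv + pw) * pw = pw) hw.
have {}hwv : piso pv (sw * pv * star sw) (sw * pv).
  by apply: hwv; rewrite mulrDl (proj2 jv) wv addr0.
have {}hww : piso pw (sw * pw * star sw) (sw * pw).
  by apply: hww; rewrite mulrDl (proj2 jw) vw add0r.
have jwv := piso_proj_r jv hwv; have jww := piso_proj_r jw hww.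
have wsum : sw * pw * star sw + sw * pv * star sw = pw.
  by have [_ h] := hw; rewrite -[RHS]h -mulrDl -mulrDr [pw + pv]addrC wt.
have wort : sw * pw * star sw * (sw * pv * star sw) = 0.
  by have [h _] := hw; rewrite -!mulrA (mulrA (star sw)) h mulrDl (mulKx0 wv) addr0
    (mulKx (proj2 jv)) (mulKx0 wv) mulr0.
have lew x : pw * (sw * x) = sw * x by rewrite mulrA pww.
have ju_w x : pu * (sw * x) = 0 by rewrite -lew mulrA uw mul0r.
have jv_w x : pv * (sw * x) = 0 by rewrite -lew mulrA vw mul0r.
have hin : piso (pu + pv + pw) (pu + pv + sw * pw * star sw) (pu + pv + sw * pw).
  apply: pisoD => //; [exact: projD|exact/piso_id/projD|by rewrite mulrDl uw vw addr0|].
  by rewrite mulrDl -!mulrA ju_w jv_w addr0.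
have jin := piso_proj_r proj_uvw hin.
have inle : (pu + pv + pw) * (pu + pv + sw * pw * star sw) = pu + pv + sw * pw * star sw.
  rewrite !(mulrDl, mulrDr) -!mulrA ju_w jv_w lew (proj2 ju) (proj2 jv) uv vu wu wv.
  by rewrite !(addr0, add0r).
have hb1 := piso_sub proj_uvw jin inle hv.
have hb : piso pv (sv * (pu + pv + sw * pw * star sw) * star sv) b.
  have [_ h _] := piso_proj proj_uvw hin.
  have -> : b = sv * (pu + pv + sw * pw * star sw) * ((pu + pv + sw * pw) * star sv).
    by rewrite -[RHS]mulrA (mulrA (pu + pv + _)) h /b o2b.unlock mulrA.
  exact: (pisoM jv (pisoM jv (piso_sym hv) hin) hb1).
have cle : (pu + pv + pw) * (sw * pv * star sw) = sw * pv * star sw.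
  by rewrite !mulrDl -!mulrA ju_w jv_w lew !add0r.
have hc : piso pv (sv * (sw * pv * star sw) * star sv) c.
  have [_ h _] := piso_proj jv hwv.
  have -> : c = sv * (sw * pv * star sw) * (sw * pv) by rewrite -[RHS]mulrA h /c o2c.unlock mulrA.
  exact: (pisoM jv hwv (piso_sub proj_uvw jwv cle hv)).
have bE : b * star b = sv * (pu + pv + sw * pw * star sw) * star sv by case: hb.
have cE : c * star c = sv * (sw * pv * star sw) * star sv by case: hc.
have jb := piso_proj_r jv hb; have jc := piso_proj_r jv hc.
rewrite -bE in hb jb; rewrite -cE in hc jc.
have ort : b * star b * (c * star c) = 0.
  have gen x y : (pu + pv + pw) * y = y -> x * y = 0 ->
      sv * x * star sv * (sv * y * star sv) = 0.
    move=> ty xy; have [h _] := hv; rewrite -!mulrA (mulrA (star sv) sv) h (mulrA _ y) ty.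
    by rewrite (mulrA x) xy mul0r mulr0.
  rewrite bE cE; apply: gen => //; rewrite !mulrDl wort addr0.
  by rewrite -!mulrA ju_w jv_w addr0.
split=> //.
- by have [_ h] := piso_ortho jv jv hb hc; exact: h.
- rewrite bE cE -mulrDl -mulrDr -addrA wsum.
  by have [_ h] := hv; rewrite -[RHS]h vt.
by rewrite /b /c o2b.unlock o2c.unlock !mulrA pvv.
Qed.

End Gadget.

Section Absorber.
Variables (R : realType) (D : cstarAlgType R).
Variables (Q pv : D).
Hypotheses (jQ : is_proj Q) (jv : is_proj pv) (Qv : Q * pv = 0).

Record o2pair (b c : D) : Prop := O2Pair {
  ob : piso pv (b * star b) b; oc : piso pv (c * star c) c;
  obc : star b * c = 0; osum : b * star b + c * star c = pv }.

Variables (i b c : D).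
Hypotheses (hi : star i * i = pv) (Qi : Q * i = i) (o2 : o2pair b c).

Let pi : piso pv (i * star i) i. Proof. by split. Qed.
Let ji : is_proj (i * star i). Proof. exact: (piso_proj_r jv pi). Qed.

Lemma absorb_ortho : i * star i * pv = 0.
Proof.
have : star i * Q = star i by rewrite -(proj1 jQ) -starM Qi.
by move=> h; rewrite -h -!mulrA Qv !mulr0.
Qed.

Lemma absorb_le : Q * (i * star i) = i * star i.
Proof. by rewrite mulrA Qi. Qed.

Lemma pair_ortho : b * star b * (c * star c) = 0.
Proof. by rewrite -!mulrA (mulrA (star b)) (obc o2) mul0r mulr0. Qed.

Lemma theta_piso : piso pv (i * star i + pv) (theta i b c).
Proof.
have jb := piso_proj_r jv (ob o2); have jc := piso_proj_r jv (oc o2).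
rewrite -{1}(osum o2) theta.unlock; apply: pisoD => //.
- exact: (pisoM jb (piso_sym (ob o2)) pi).
- exact: (piso_sym (oc o2)).
- exact: pair_ortho.
exact: absorb_ortho.
Qed.

(** The piece [i * star i] of [Q] is a copy of [pv], and [pv] is two copies of itself: one goes back
    to [i * star i], the other becomes the new summand. *)
Lemma tau_piso : piso Q (Q + pv) (tau_ Q i b c).
Proof.
have le := absorb_le; have le' := proj_leC jQ ji le.
have jd : is_proj (Q - i * star i) by apply: projB.
have d0 : (Q - i * star i) * (i * star i) = 0 by rewrite mulrBl le (proj2 ji) subrr.
have := pisoD jd ji (piso_id jd) (pisoM ji (piso_sym pi) theta_piso) d0.
rewrite tau_.unlock subrK addrA subrK; apply.
by rewrite mulrDr d0 add0r mulrBl Qv absorb_ortho subrr.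
Qed.

Variables (e t sv : D).
Hypotheses (je : is_proj e) (proj_uvw : is_proj t) (et : e * t = 0) (eQ : e * Q = Q) (e1 : e + t = 1)
  (hv : piso t pv sv).

(* Makes room for [t] in [e] by means of the [O_2]-pair sitting under [i i^*]. *)
Definition shrink : D := (e - i * star i) + i * (b * star i + c * sv).

Lemma shrink_piso : piso 1 e shrink.
Proof.
have le : e * (i * star i) = i * star i by rewrite -absorb_le mulrA eQ.
have le' := proj_leC je ji le.
have jd : is_proj (e - i * star i) by apply: projB.
have d0 : (e - i * star i) * (i * star i) = 0 by rewrite mulrBl le (proj2 ji) subrr.
have it0 : i * star i * t = 0 by rewrite -le' -mulrA et mulr0.
have jit : is_proj (i * star i + t) by apply: projD.
have h1 : piso (i * star i + t) pv (b * star i + c * sv).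
  rewrite -(osum o2); apply: pisoD => //.
  - exact: (pisoM ji (piso_sym pi) (ob o2)).
  - exact: (pisoM proj_uvw hv (oc o2)).
  exact: pair_ortho.
have := pisoD jd jit (piso_id jd) (pisoM jit h1 pi); rewrite addrA subrK e1.
apply; last exact: d0.
by rewrite mulrDr d0 add0r mulrBl et it0 subrr.
Qed.

End Absorber.

(** * The new last generator and its response to twists *)

Section LastGenerator.
Variables (R : realType) (D : cstarAlgType R).
Variables (a0 b0 : D) (ha : star a0 * a0 = 1) (hb : star b0 * b0 = 1) (hab : star a0 * b0 = 0).
Local Notation cl := (pcl ha hb hab).
Variables (Q pu pv pw pN : D).
Hypotheses (jQ : is_proj Q) (ju : is_proj pu) (jv : is_proj pv) (jw : is_proj pw).
Hypotheses (Qu : Q * pu = 0) (Qv : Q * pv = 0) (Qw : Q * pw = 0).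
Hypotheses (uv : pu * pv = 0) (uw : pu * pw = 0) (vw : pv * pw = 0).
Variables (sN om su sv sw : D).
Hypothesis gd : gadget Q pu pv pw pN sN om su sv sw.

Local Notation b := (o2b pu pv pw sv sw).
Local Notation c := (o2c pv sv sw).
Local Notation i := (embed_o2 pv om su).

Lemma gadget_o2pair : o2pair pv b c /\ pv * b = b /\ pv * c = c.
Proof.
have [h1 h2 h3 h4 h5] := o2_facts ju jv jw uv uw vw (gv gd) (gw gd).
by split.
Qed.

Lemma embed_o2P : star i * i = pv /\ Q * i = i.
Proof.
have jQv : is_proj (Q + pv) by exact: projD.
have [suQ puu _] := piso_proj jQv (gu gd).
rewrite embed_o2.unlock; split; last by rewrite !mulrA (gQom gd).
rewrite !starM (proj1 jv) -!mulrA (mulrA (star om)) (gom gd) (mulrA pu) puu.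
have [h _] := gu gd; rewrite (mulrA (star su)) h mulrDl Qv add0r (proj2 jv).
exact: (proj2 jv).
Qed.

Lemma gadget_tau : piso Q (Q + pv) (tau Q pu pv pw om su sv sw).
Proof.
have [o2 _] := gadget_o2pair; have [h1 h2] := embed_o2P.
exact: tau_piso.
Qed.

(** The route [Q -> Q + pv -> pu -> pN]: the summand [pv] in the source of [su] is supplied by
    absorption. *)
Definition new_last : D := sN * su * tau Q pu pv pw om su sv sw.

Lemma new_last_piso : piso Q pN new_last.
Proof.
have jQv : is_proj (Q + pv) by exact: projD.
have := pisoM jQ gadget_tau (pisoM jQv (gu gd) (gN gd)).
by [].
Qed.


Variables (Wu Wv Ww : D).
Hypotheses (hWu : punit pu Wu) (hWv : punit pv Wv) (hWw : punit pw Ww).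

Let jQv : is_proj (Q + pv). Proof. exact: projD. Qed.
Let proj_uvw := proj_uvw ju jv jw uv uw vw.

(** [Y] is a product of [Wv], of [K] carrying [Ww] along [sv], and of [Z]. The factor [Z] restores
    the [star Wv] that [o2b] produces on its right end, and its class cancels that of [Wv]. *)
Lemma o2pair_twist : exists Y, [/\ punit pv Y, o2b pu pv pw (Wv * sv) (Ww * sw) = Y * b,
  o2c pv (Wv * sv) (Ww * sw) = Y * c & cl pv Y = cl pw Ww].
Proof.
have [o2 [vb vc]] := gadget_o2pair.
have puv : is_proj (pu + pv) by exact: projD.
have uvw : (pu + pv) * pw = 0 by rewrite mulrDl uw vw addr0.
have pK : punit (pu + pv + pw) (pu + pv + Ww) by apply: punitD => //; exact: punit_proj.
pose K := sv * (pu + pv + Ww) * star sv.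
have hK : punit pv K by exact: (piso_conj (gv gd) pK).
pose Z := b * star Wv * star b + c * star c.
have h1 := piso_conj (ob o2) (punit_star hWv).
have jc := piso_proj_r jv (oc o2).
have po := pair_ortho o2.
have hZ : punit pv Z by rewrite -{1}(osum o2); apply: punitD => //; exact: punit_proj.
have [sv1 sv2] := gv gd.
have [svt _ _] := piso_proj proj_uvw (gv gd).
have [swt pww _] := piso_proj (proj_vw jv jw vw) (gw gd).
have [Wv1 Wv2] := punit_mul hWv; have [Vv1 Vv2] := punit_mul (punit_star hWv).
have [Ww1 Ww2] := punit_mul hWw.
have [wu wv] : pw * pu = 0 /\ pw * pv = 0.
  by split; [exact: (proj_ortho_sym ju jw)|exact: (proj_ortho_sym jv jw)].
have vu := proj_ortho_sym ju jv uv.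
have wWu : Ww * pu = 0 by rewrite -Ww2 -mulrA wu mulr0.
have wWv : Ww * pv = 0 by rewrite -Ww2 -mulrA wv mulr0.
have us : pu * sw = 0 by rewrite -pww mulrA uw mul0r.
have vs : pv * sw = 0 by rewrite -pww mulrA vw mul0r.
have Kin : (pu + pv + Ww) * (pu + pv + sw * pw) = pu + pv + Ww * sw * pw.
  rewrite !(mulrDl, mulrDr) !mulrA us vs (proj2 ju) (proj2 jv) uv vu wWu wWv.
  by rewrite !mul0r; abel.
have Kb : K * b = sv * (pu + pv + Ww * sw * pw) * star sv.
  rewrite /K o2b.unlock -!(mulrA sv) -Kin -!mulrA (mulrA (star sv) sv) sv1; congr (_ * _).
  rewrite (mulrA (pu + pv + pw)).
  have -> : (pu + pv + pw) * (pu + pv + sw * pw) = pu + pv + sw * pw.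
    rewrite !(mulrDl, mulrDr) !mulrA us vs (proj2 ju) (proj2 jv) uv vu wu wv pww.
    by rewrite !mul0r; abel.
  by rewrite mulrA.
have Kc : K * c = sv * Ww * sw * pv.
  rewrite /K o2c.unlock -!(mulrA sv) -!mulrA (mulrA (star sv) sv) sv1; congr (_ * _).
  rewrite (mulrA (pu + pv + pw)).
  have -> : (pu + pv + pw) * sw = sw by rewrite !mulrDl us vs pww !add0r.
  by rewrite mulrA !mulrDl us vs !mul0r !add0r mulrA.
have jb := piso_proj_r jv (ob o2).
have cb : star c * b = 0 by rewrite -[b]starK -starM (obc o2) star0.
exists (Wv * (K * Z)); split.
- by do 2 apply: punitM => //.
- have zb : Z * b = b * star Wv.
    rewrite /Z mulrDl -!mulrA cb mulr0 addr0; have [-> _] := ob o2; by rewrite Vv2.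
  by rewrite -[RHS]mulrA -(mulrA K) zb (mulrA K) Kb o2b.unlock starM !mulrA.
- have zc : Z * c = c.
    rewrite /Z mulrDl -!mulrA (obc o2) !mulr0 add0r; have [-> _] := oc o2.
    by have [] := piso_proj jv (oc o2).
  by rewrite -[RHS]mulrA -(mulrA K) zc Kc o2c.unlock !mulrA.
rewrite (pclM ha hb hab hWv (punitM hK hZ)) (pclM ha hb hab hK hZ).
rewrite /K (cl_piso ha hb hab (gv gd) pK) pclD //; last exact: punit_proj.
rewrite pcl_proj add0r.
have -> : cl pv Z = - cl pv Wv.
  rewrite -{1}(osum o2) /Z pclD //; last exact: punit_proj.
  by rewrite pcl_proj addr0 (cl_piso ha hb hab (ob o2) (punit_star hWv)) pcl_star.
by rewrite addrCA subrr addr0.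
Qed.

(** [Wu] enters directly through [su] and again through the embedding, as [B]; the latter acts on
    both sides of [tau] and cancels. The pair is twisted by [Y], which enters through adjoints and
    contributes [- cl Ww]. *)
Lemma new_last_class : exists W, [/\ punit pN W,
  sN * (Wu * su) * tau Q pu pv pw om (Wu * su) (Wv * sv) (Ww * sw) = W * new_last
  & cl pN W = cl pu Wu - cl pw Ww].
Proof.
have [Y [pY Yb Yc clY]] := o2pair_twist; have [o2 [vb vc]] := gadget_o2pair.
have [ii Qi] := embed_o2P; have ht := gadget_tau; have [omu omQ] := (gom gd, gQom gd).
rewrite /new_last /tau Yb Yc.
set b' := b in Yb Yc o2 vb vc ht *; set c' := c in Yb Yc o2 vb vc ht *.
set i' := i in ii Qi ht *; pose t := tau_ Q i' b' c'.
rewrite -/(tau Q pu pv pw om su sv sw) /tau -/b' -/c' -/i' -/t in ht *.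
have [Wu1 Wu2] := punit_mul hWu; have [Y1 Y2] := punit_mul pY.
have [V1 V2] := punit_mul (punit_star pY).
have [suQ puu _] := piso_proj jQv (gu gd).
have pom : piso pu (om * star om) om by split.
have jom := piso_proj_r ju pom.
have omle : Q * (om * star om) = om * star om by rewrite mulrA (gQom gd).
have omle' := proj_leC jQ jom omle.
have jd : is_proj (Q - om * star om) by apply: projB.
have d0 : (Q - om * star om) * (om * star om) = 0 by rewrite mulrBl omle (proj2 jom) subrr.
pose B := (Q - om * star om) + om * Wu * star om.
have pB : punit Q B.
  rewrite -{1}(subrK (om * star om) Q); apply: punitD => //; first exact: punit_proj.
  exact: (piso_conj pom hWu).
have clB : cl Q B = cl pu Wu.
  rewrite -{1}(subrK (om * star om) Q) pclD //; [|exact: punit_proj|exact: (piso_conj pom hWu)].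
  by rewrite pcl_proj add0r (cl_piso ha hb hab pom hWu).
have Bi : embed_o2 pv om (Wu * su) = B * i'.
  have omi : star om * i' = su * pv.
    by rewrite /i' embed_o2.unlock -!mulrA (mulrA (star om)) (gom gd) mulrA puu.
  have e0 : (Q - om * star om) * i' = 0.
    by rewrite mulrBl Qi -mulrA omi /i' embed_o2.unlock mulrA subrr.
  by rewrite /B mulrDl e0 add0r -mulrA omi embed_o2.unlock !mulrA.
clearbody B.
pose th := theta i' b' c'; have hth : piso pv (i' * star i' + pv) th by exact: (theta_piso jQ jv Qv ii Qi o2).
have pi' : piso pv (i' * star i') i' by split.
have ji := piso_proj_r jv pi'.
have ile : Q * (i' * star i') = i' * star i' by rewrite mulrA Qi.
have jdi : is_proj (Q - i' * star i') by apply: projB => //; exact: (proj_leC jQ ji ile).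
have di0 : (Q - i' * star i') * (i' * star i') = 0 by rewrite mulrBl ile (proj2 ji) subrr.
have ivp : i' * star i' * pv = 0 by exact: (absorb_ortho jQ Qv Qi).
pose t2 := (Q - i' * star i') + th * star Y * star i'.
have hthY : piso pv (i' * star i' + pv) (th * star Y) by exact: (pisoM jv (proj2 (punit_star pY)) hth).
have ht2 : piso Q (Q + pv) t2.
  have := pisoD jdi ji (piso_id jdi) (pisoM ji (piso_sym pi') hthY) di0.
  rewrite subrK addrA subrK; apply.
  by rewrite mulrDr di0 add0r mulrBl Qv ivp subrr.
have [B1 B2] := punit_mul pB; have [C1 C2] := punit_mul (punit_star pB).
have BB : B * star B = Q by case: pB => _ [].
have t2E : tau_ Q (B * i') (Y * b') (Y * c') = (B + pv) * (t2 * star B).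
  have Bpv : B * pv = 0 by rewrite -B2 -mulrA Qv mulr0.
  have vB : pv * B = 0 by rewrite -B1 mulrA (proj_ortho_sym jQ jv Qv) mul0r.
  have vi : pv * i' = 0 by rewrite -Qi mulrA (proj_ortho_sym jQ jv Qv) mul0r.
  have vc' : pv * star c' = star c'.
    by have [h _ _] := piso_proj jv (oc o2); rewrite -{1}(proj1 jv) -starM h.
  have Bc : B * star c' = 0 by rewrite -vc' mulrA Bpv mul0r.
  rewrite tau_.unlock !theta.unlock /t2 /th theta.unlock !starM.
  have vQ : pv * Q = 0 := proj_ortho_sym jQ jv Qv.
  rewrite !(mulrDl, mulrDr, mulrN, mulNr) -!mulrA.
  rewrite ?(mulKx B2, mulKx0 Bc, mulKx0 vQ, mulKx0 vi, mulKx vc', BB).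
  by abel.
have t2t : t2 * star t = (Q - i' * star i') + th * star Y * star th.
  rewrite /t2 /t tau_.unlock -/th.
  have e1 : (Q - i' * star i') * star (Q - i' * star i') = Q - i' * star i'.
    by rewrite (proj1 jdi) (proj2 jdi).
  have [ipv _ _] := piso_proj jv pi'.
  have e2 : (Q - i' * star i') * i' = 0 by rewrite mulrBl Qi -mulrA ii ipv subrr.
  have e3 : star i' * star (Q - i' * star i') = 0.
    by rewrite -starM e2 star0.
  move: e1 e2 e3; move: (Q - i' * star i') => d e1 e2 e3.
  rewrite starD mulrDr !mulrDl e1 starM starK.
  rewrite (mulrA d i') e2 mul0r add0r -!mulrA e3 !mulr0 addr0; congr (_ + _).
  by rewrite (mulrA (star i')) ii (mulrA (star Y)) V2.
clearbody t2 t th.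
have p2 : punit (Q + pv) (t2 * star t) by exact: (piso_punit jQ ht2 ht).
have pKb : punit (Q + pv) (B + pv) by apply: punitD => //; exact: punit_proj.
have p1 : punit (Q + pv) (t2 * star B * star t2) by exact: (piso_conj ht2 (punit_star pB)).
pose m := (B + pv) * ((t2 * star B * star t2) * (t2 * star t)).
have pm : punit (Q + pv) m by do 2 apply: punitM => //.
have [tQ Qt _] := piso_proj jQ ht.
have tt : star t * t = Q by case: ht.
have t2t2 : star t2 * t2 = Q by case: ht2.
have mt : m * t = tau_ Q (B * i') (Y * b') (Y * c').
  rewrite t2E /m -!(mulrA (B + pv)) -!mulrA tt (mulrA (star t2)) t2t2.
  by rewrite (mulrA (star B)) C2 C2.
have clt : cl (Q + pv) (t2 * star t) = - cl pw Ww.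
  have -> : Q + pv = (Q - i' * star i') + (i' * star i' + pv) by rewrite addrA subrK.
  rewrite t2t pclD; [|exact: punit_proj|exact: (piso_conj hth (punit_star pY))|].
    by rewrite pcl_proj add0r (cl_piso ha hb hab hth (punit_star pY)) pcl_star // clY.
  by rewrite mulrDr di0 add0r mulrBl Qv ivp subrr.
have clm : cl (Q + pv) m = - cl pw Ww.
  rewrite /m (pclM ha hb hab pKb (punitM p1 p2)) (pclM ha hb hab p1 p2).
  rewrite cl_extend // (cl_piso ha hb hab ht2 (punit_star pB)) pcl_star // clB clt.
  by abel.
clearbody m.
have [s1 s2] := gu gd.
have pP : punit pu (Wu * (su * m * star su)).
  by apply: punitM => //; exact: (piso_conj (gu gd) pm).
exists (sN * (Wu * (su * m * star su)) * star sN); split.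
- exact: (piso_conj (gN gd) pP).
- have [sNu _ _] := piso_proj ju (gN gd); have [n1 n2] := gN gd.
  rewrite Bi -mt; have [m1 m2] := punit_mul pm.
  rewrite -!(mulrA sN) -!mulrA (mulrA (star sN)) n1 (mulrA pu) puu.
  by rewrite (mulrA (star su)) s1 (mulrA m) m2 !mulrA.
rewrite (cl_piso ha hb hab (gN gd) pP) pclM //; last exact: (piso_conj (gu gd) pm).
by rewrite (cl_piso ha hb hab (gu gd) pm) clm.
Qed.

End LastGenerator.

(** * Reduction and expansion of families *)

Section BarMatrix.
Variables (R : realType) (m : nat) (A : 'M[int]_m.+1).
Hypothesis A01 : mx01 A.

Definition li (i : 'I_m.+1) : 'I_(m.+1 + 3) := lshift 3 i.
Definition ri (k : 'I_3) : 'I_(m.+1 + 3) := rshift m.+1 k.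
Definition iu := ri ord0.
Definition iv := ri (lift ord0 ord0).
Definition iw := ri ord_max.

Lemma bar_sum (V : zmodType) (x : 'I_(m.+1 + 3) -> V) :
  \sum_j x j = \sum_j x (li j) + (x iu + x iv + x iw).
Proof.
rewrite big_split_ord /=; congr (_ + _).
rewrite !big_ord_recl big_ord0 addr0 addrA; congr (_ + _ + x _).
by apply: val_inj.
Qed.

Lemma bar_row_A (V : zmodType) (x : 'I_(m.+1 + 3) -> V) i : i != ord_max ->
  \sum_j x j *~ bar_mx A (li i) j = \sum_j x (li j) *~ A i j.
Proof.
move=> iN; rewrite bar_sum /li /iu /iv /iw /ri /bar_mx.
rewrite [X in _ + X](_ : _ = 0) ?addr0.
  by apply: eq_bigr => j _; rewrite block_mxEul mxE (negPf iN).
by rewrite !block_mxEur !mxE (negPf iN) !mulr0z !addr0.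
Qed.

Lemma bar_row_N (V : zmodType) (x : 'I_(m.+1 + 3) -> V) :
  \sum_j x j *~ bar_mx A (li ord_max) j = x iu.
Proof.
rewrite bar_sum /li /iu /iv /iw /ri /bar_mx big1 => [|j _].
  by rewrite !block_mxEur !mxE eqxx /= !mulr0z !addr0 add0r mulr1z.
by rewrite block_mxEul mxE eqxx mulr0z.
Qed.

Lemma bar_row_u (V : zmodType) (x : 'I_(m.+1 + 3) -> V) :
  \sum_j x j *~ bar_mx A iu j = \sum_j x (li j) *~ A ord_max j + x iv.
Proof.
rewrite bar_sum /li /iu /iv /iw /ri /bar_mx; congr (_ + _).
  by apply: eq_bigr => j _; rewrite block_mxEdl mxE eqxx.
by rewrite !block_mxEdr !mxE /= !mulr0z mulr1z add0r addr0.
Qed.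

Lemma bar_row_v (V : zmodType) (x : 'I_(m.+1 + 3) -> V) :
  \sum_j x j *~ bar_mx A iv j = x iu + x iv + x iw.
Proof.
rewrite bar_sum /li /iu /iv /iw /ri /bar_mx big1 ?add0r => [|j _].
  by rewrite !block_mxEdr !mxE /= !mulr1z.
by rewrite block_mxEdl mxE mulr0z.
Qed.

Lemma bar_row_w (V : zmodType) (x : 'I_(m.+1 + 3) -> V) :
  \sum_j x j *~ bar_mx A iw j = x iv + x iw.
Proof.
rewrite bar_sum /li /iu /iv /iw /ri /bar_mx big1 ?add0r => [|j _].
  by rewrite !block_mxEdr !mxE /= mulr0z !mulr1z add0r.
by rewrite block_mxEdl mxE mulr0z.
Qed.

Lemma bar_mx01 : mx01 (bar_mx A).
Proof.
move=> i j; rewrite -(splitK i) -(splitK j).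
case: (fintype.split i) => k; case: (fintype.split j) => l /=; rewrite /bar_mx.
- by rewrite block_mxEul mxE; case: ifP => _; [left|exact: A01].
- by rewrite block_mxEur mxE; case: (_ && _); [right|left].
- by rewrite block_mxEdl mxE; case: ifP => _; [exact: A01|left].
rewrite block_mxEdr mxE.
by case: k => [[|[|[|k]]] hk] //; case: l => [[|[|[|l]]] hl] //=; first [by left|by right].
Qed.

Section Family.
Variables (D : cstarAlgType R).

Definition src_proj (q : 'I_m.+1 -> D) i := \sum_j (q j *~ A i j).

(** The relations sorted by blocks, asking for range projections in place of partial isometries;
    [bar_rel_family] converts back. *)
Record bar_rel (sA : 'I_m.+1 -> D) (su sv sw : D) : Prop := BarRel {
  br_pA : forall i, is_proj (rproj sA i);
  br_pu : is_proj (su * star su);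
  br_pv : is_proj (sv * star sv);
  br_pw : is_proj (sw * star sw);
  br_sum : \sum_j rproj sA j + (su * star su + sv * star sv + sw * star sw) = 1;
  br_A : forall i, i != ord_max -> star (sA i) * sA i = src_proj (rproj sA) i;
  br_N : star (sA ord_max) * sA ord_max = su * star su;
  br_u : star su * su = src_proj (rproj sA) ord_max + sv * star sv;
  br_v : star sv * sv = su * star su + sv * star sv + sw * star sw;
  br_w : star sw * sw = sv * star sv + sw * star sw }.

Lemma bar_family_rel (s : 'I_(m.+1 + 3) -> D) : ck_family (bar_mx A) s ->
  bar_rel (fun i => s (li i)) (s iu) (s iv) (s iw).
Proof.
move=> fs; have [_ hs hr] := fs; have pp := ck_proj fs; split.
- by move=> i; exact: pp.
- exact: (pp iu).
- exact: (pp iv).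
- exact: (pp iw).
- by rewrite -hs bar_sum.
- by move=> i iN; rewrite hr (bar_row_A (fun j => s j * star (s j)) iN).
- by rewrite hr (bar_row_N (fun j => s j * star (s j))).
- by rewrite hr (bar_row_u (fun j => s j * star (s j))).
- by rewrite hr (bar_row_v (fun j => s j * star (s j))).
by rewrite hr (bar_row_w (fun j => s j * star (s j))).
Qed.

Definition bar_fam (sA : 'I_m.+1 -> D) (su sv sw : D) (i : 'I_(m.+1 + 3)) : D :=
  match fintype.split i with inl j => sA j | inr k => nth 0 [:: su; sv; sw] k end.

Lemma bar_famA sA su sv sw i : bar_fam sA su sv sw (li i) = sA i.
Proof. by rewrite /bar_fam (unsplitK (inl _ i : 'I_m.+1 + 'I_3)). Qed.

Lemma bar_famr sA su sv sw k : bar_fam sA su sv sw (ri k) = nth 0 [:: su; sv; sw] k.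
Proof. by rewrite /bar_fam (unsplitK (inr _ k : 'I_m.+1 + 'I_3)). Qed.

Lemma proj_pi (x : D) : is_proj (x * star x) -> x * star x * x = x.
Proof.
move=> px; have hx : piso (x * star x) (star x * x) (star x) by split; rewrite starK.
by have [h _ _] := piso_proj px hx; have := congr1 star h; rewrite starM (proj1 px) starK.
Qed.

Lemma bar_ind (P : 'I_(m.+1 + 3) -> Prop) :
  (forall i, i != ord_max -> P (li i)) -> P (li ord_max) -> P iu -> P iv -> P iw ->
  forall i, P i.
Proof.
move=> hA hN hu hv hw i; rewrite -(splitK i); case: (fintype.split i) => k /=.
  by have [->|kN] := eqVneq k ord_max; [exact: hN|exact: hA].
case: k => [[|[|[|k]]] hk] //; [move: hu|move: hv|move: hw];
  by congr P; apply: val_inj.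
Qed.

Lemma bar_rel_family sA su sv sw : bar_rel sA su sv sw ->
  ck_family (bar_mx A) (bar_fam sA su sv sw).
Proof.
move=> h; have [eu ev ew] : [/\ bar_fam sA su sv sw iu = su, bar_fam sA su sv sw iv = sv &
  bar_fam sA su sv sw iw = sw] by rewrite !bar_famr.
set s := bar_fam _ _ _ _ in eu ev ew *.
have eA i : s (li i) = sA i by exact: bar_famA.
split.
- apply: bar_ind => [i iN||||]; rewrite /partial_isometry ?eA ?eu ?ev ?ew; apply: proj_pi;
   by [exact: (br_pA h)|exact: (br_pu h)|exact: (br_pv h)|exact: (br_pw h)].
- rewrite bar_sum eu ev ew -(br_sum h); congr (_ + _).
  by apply: eq_bigr => i _; rewrite eA.
apply: bar_ind => [i iN||||].
- rewrite (bar_row_A (fun j => s j * star (s j)) iN) eA (br_A h) //.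
  by apply: eq_bigr => j _; rewrite eA.
- by rewrite (bar_row_N (fun j => s j * star (s j))) eA eu (br_N h).
- rewrite (bar_row_u (fun j => s j * star (s j))) eu ev (br_u h); congr (_ + _).
  by apply: eq_bigr => j _; rewrite eA.
- by rewrite (bar_row_v (fun j => s j * star (s j))) eu ev ew (br_v h).
by rewrite (bar_row_w (fun j => s j * star (s j))) ev ew (br_w h).
Qed.

End Family.

End BarMatrix.

Section ProjSums.
Variables (R : realType) (D : cstarAlgType R) (I : finType) (q : I -> D).
Hypotheses (jq : forall i, is_proj (q i)) (oq : forall i j, i != j -> q i * q j = 0).

Lemma proj_sum (P : pred I) : is_proj (\sum_(i | P i) q i).
Proof.
split; first by rewrite star_sum; apply: eq_bigr => i _; rewrite (proj1 (jq i)).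
rewrite mulr_suml; apply: eq_bigr => i Pi; rewrite mulr_sumr (bigD1 i) //=.
rewrite (proj2 (jq i)) big1 ?addr0 // => j /andP[_ ji]; rewrite oq // eq_sym //.
Qed.

Lemma proj_sum_mul (P : pred I) i : q i * (\sum_(j | P j) q j) = if P i then q i else 0.
Proof.
case: ifP => Pi.
  rewrite mulr_sumr (bigD1 i) //= (proj2 (jq i)) big1 ?addr0 // => j /andP[_ ji].
  by rewrite oq // eq_sym.
rewrite mulr_sumr big1 // => j Pj; apply: oq; apply: contraTneq Pj => <-.
by rewrite Pi.
Qed.

Lemma proj_sum_mulr (P : pred I) i : (\sum_(j | P j) q j) * q i = if P i then q i else 0.
Proof.
have := congr1 star (proj_sum_mul P i); rewrite starM (proj1 (proj_sum P)) (proj1 (jq i)) => ->.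
by case: ifP => _; rewrite ?star0 ?(proj1 (jq i)).
Qed.

Lemma proj_sum_le (P P' : pred I) : (forall i, P' i -> P i) ->
  (\sum_(i | P i) q i) * (\sum_(i | P' i) q i) = \sum_(i | P' i) q i.
Proof.
move=> h; rewrite mulr_sumr; apply: eq_bigr => i Pi.
by rewrite proj_sum_mulr h.
Qed.

End ProjSums.

Lemma piso_compress (R : realType) (D : cstarAlgType R) (U F r p e : D) :
  U * star U = e -> piso r p F -> F * e = F -> e * F = F ->
  piso (star U * r * U) (star U * p * U) (star U * F * U).
Proof.
move=> U2 [h1 h2] h3 h4; split; rewrite !starM starK -!mulrA (mulKx U2).
  by rewrite (mulrA e) h4 -h1 !mulrA.
by rewrite (mulrA F) h3 -h2 !mulrA.
Qed.

(** * From families for the extended matrix to families for the original one *)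

Section Reduction.
Variables (R : realType) (m : nat) (A : 'M[int]_m.+1).
Hypothesis A01 : mx01 A.
Local Notation N := (@ord_max m).

(** Among the old vertices only [N] has its outgoing edges changed in the extended graph, so a loop
    whose inner vertices avoid [N] can still be followed there. *)
Definition first_return (mu : seq 'I_m.+1) :=
  path (edge A) N (rcons mu N) /\ N \notin mu.

Section Formulas.
Variables (D : cstarAlgType R) (mu : seq 'I_m.+1) (sA : 'I_m.+1 -> D) (su sv sw : D).
Definition eA : D := \sum_j rproj sA j.
Definition srcN : D := src_proj A (rproj sA) N.
Definition return_iso : D := Sw sA mu * sA N.
Definition last_gen : D := new_last srcN (su * star su) (sv * star sv) (sw * star sw)
   (sA N) return_iso su sv sw.
Definition fam_iota : D := embed_o2 (sv * star sv) return_iso su.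
Definition fam_o2b : D := o2b (su * star su) (sv * star sv) (sw * star sw) sv sw.
Definition fam_o2c : D := o2c (sv * star sv) sv sw.
Definition shrink_iso : D := shrink fam_iota fam_o2b fam_o2c eA sv.
Definition reduced_gen i : D := if i == N then last_gen else sA i.
Definition reduced_fam i : D := star shrink_iso * reduced_gen i * shrink_iso.
End Formulas.

Section Rel.
Variables (D : cstarAlgType R) (mu : seq 'I_m.+1) (sA : 'I_m.+1 -> D) (su sv sw : D).
Hypothesis h : bar_rel A sA su sv sw.
Local Notation pu := (su * star su).
Local Notation pv := (sv * star sv).
Local Notation pw := (sw * star sw).
Local Notation q := (rproj sA).
Local Notation Q := (srcN sA).
Local Notation e := (eA sA).

Let s := bar_fam sA su sv sw.
Let fs : ck_family (bar_mx A) s := bar_rel_family h.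

Let qE i : rproj s (li i) = q i.
Proof. by rewrite /rproj /s bar_famA. Qed.
Let uE : rproj s (iu m) = pu. Proof. by rewrite /rproj /s bar_famr. Qed.
Let vE : rproj s (iv m) = pv. Proof. by rewrite /rproj /s bar_famr. Qed.
Let wE : rproj s (iw m) = pw. Proof. by rewrite /rproj /s bar_famr. Qed.

Lemma rel_qq i j : i != j -> q i * q j = 0.
Proof.
move=> ij; rewrite -!qE; apply: (ck_ortho fs).
by apply: contraNneq ij => /lshift_inj ->.
Qed.

Lemma rel_qr i : [/\ q i * pu = 0, q i * pv = 0 & q i * pw = 0].
Proof.
by rewrite -!qE -uE -vE -wE; split; apply: (ck_ortho fs); rewrite /li /iu /iv /iw /ri eq_lrshift.
Qed.

Lemma rel_rr : [/\ pu * pv = 0, pu * pw = 0 & pv * pw = 0].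
Proof.
by rewrite -uE -vE -wE; split; apply: (ck_ortho fs);
  rewrite /iu /iv /iw /ri (inj_eq (@rshift_inj _ _)).
Qed.

Lemma srcE (r : 'I_m.+1 -> D) i : src_proj A r i = \sum_(j | edge A i j) r j.
Proof. by rewrite /src_proj [RHS]big_mkcond; apply: eq_bigr => j _; rewrite (MnE A01). Qed.

Lemma rel_src_proj i : is_proj (src_proj A q i).
Proof. by rewrite srcE; apply: proj_sum; [exact: (br_pA h)|exact: rel_qq]. Qed.

Lemma rel_e_proj : is_proj e.
Proof. by apply: proj_sum; [exact: (br_pA h)|exact: rel_qq]. Qed.

Lemma rel_e_src i : e * src_proj A q i = src_proj A q i.
Proof. by rewrite srcE /eA; apply: proj_sum_le; [exact: (br_pA h)|exact: rel_qq|]. Qed.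

Lemma rel_e_q i : e * q i = q i.
Proof. by rewrite /eA proj_sum_mulr; [|exact: (br_pA h)|exact: rel_qq]. Qed.

Lemma rel_src_r i : [/\ src_proj A q i * pu = 0, src_proj A q i * pv = 0 & src_proj A q i * pw = 0].
Proof.
by rewrite srcE; split; rewrite mulr_suml big1 // => j _; have [] := rel_qr j.
Qed.

Lemma rel_e_r : [/\ e * pu = 0, e * pv = 0 & e * pw = 0].
Proof. by split; rewrite /eA mulr_suml big1 // => j _; have [] := rel_qr j. Qed.

Lemma rel_pA i : i != N -> piso (src_proj A q i) (q i) (sA i).
Proof. by move=> iN; split; rewrite ?(br_A h iN). Qed.

Hypothesis hmu : first_return mu.

(** In the extended graph the word runs from a successor of [N] in the old graph, whose projection
    lies under [Q], to [N], whose only edge leads to [u]. *)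
Lemma rel_om : star (return_iso mu sA) * return_iso mu sA = pu /\ Q * return_iso mu sA = return_iso mu sA.
Proof.
have [pmu Nmu] := hmu.
have omE : return_iso mu sA = Sw sA (rcons mu N).
  by rewrite /return_iso -cats1 Sw_cat /Sw big_seq1.
have SwE u : Sw sA u = Sw s (map (@li m) u).
  by rewrite /Sw big_map; apply: eq_bigr => i _; rewrite /s bar_famA.
have b01 := bar_mx01 A01.
have edgeE i j : i != N -> edge A i j -> edge (bar_mx A) (li i) (li j).
  by move=> iN; rewrite /edge /bar_mx /li block_mxEul mxE (negPf iN).
have pb i u : i != N -> N \notin u -> path (edge A) i (rcons u N) ->
    path (edge (bar_mx A)) (li i) (map (@li m) (rcons u N)).
  elim: u i => [|j u ih] i iN /=; first by move=> _ /andP[h1 _]; rewrite edgeE.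
  rewrite inE negb_or => /andP[Nj Nu] /andP[eij pj].
  by rewrite edgeE // ih // eq_sym.
have [j [r [rE eNj pr]]] : exists j r, [/\ rcons mu N = j :: r, edge A N j &
    path (edge (bar_mx A)) (li j) (map (@li m) r)].
  case: (mu) pmu Nmu => [|j u] /=; first by move=> /andP[eN _] _; exists N, [::].
  move=> /andP[eN pj]; rewrite inE negb_or => /andP[Nj Nu].
  by exists j, (rcons u N); split=> //; apply: pb; rewrite // eq_sym.
split.
  rewrite omE rE SwE /= (Sw_path b01 fs pr).
  have -> : last (li j) (map (@li m) r) = li N.
    by rewrite last_map -[last j r]/(last j (j :: r)) -rE last_rcons.
  by rewrite /s bar_famA (br_N h).
rewrite omE rE SwE /= -{2}(Sw_head fs) -[in LHS](Sw_head fs) mulrA; congr (_ * _).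
by rewrite qE /srcN srcE proj_sum_mulr ?eNj; [|exact: (br_pA h)|exact: rel_qq].
Qed.

Lemma rel_gadget : gadget Q pu pv pw (q N) (sA N) (return_iso mu sA) su sv sw.
Proof.
have [h1 h2] := rel_om; split=> //.
- by split; rewrite ?(br_N h).
- by split; rewrite ?(br_u h).
- by split; rewrite ?(br_v h).
by split; rewrite ?(br_w h).
Qed.

Lemma rel_last_gen : piso Q (q N) (last_gen mu sA su sv sw).
Proof.
have [Qu Qv Qw] := rel_src_r N; have [uv uw vw] := rel_rr.
by apply: new_last_piso => //; [exact: rel_src_proj|exact: (br_pu h)|exact: (br_pv h)|
  exact: (br_pw h)|exact: rel_gadget].
Qed.

Lemma rel_reduced_gen i : piso (src_proj A q i) (q i) (reduced_gen mu sA su sv sw i).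
Proof. by rewrite /reduced_gen; case: eqVneq => [->|iN]; [exact: rel_last_gen|exact: rel_pA]. Qed.

Lemma rel_shrink_iso : piso 1 e (shrink_iso mu sA su sv sw).
Proof.
have [Qu Qv Qw] := rel_src_r N; have [uv uw vw] := rel_rr; have [eu ev ew] := rel_e_r.
have jQ := rel_src_proj N.
have [ju jv jw] := And3 (br_pu h) (br_pv h) (br_pw h).
have [o2 _] := gadget_o2pair ju jv jw uv uw vw rel_gadget.
have [ii Qi] := embed_o2P jQ jv Qv rel_gadget.
apply: (shrink_piso jv ii Qi o2 rel_e_proj (proj_uvw ju jv jw uv uw vw)).
- by rewrite !mulrDr eu ev ew !addr0.
- exact: rel_e_src.
- exact: (br_sum h).
by split; rewrite ?(br_v h).
Qed.


Lemma reduced_gen_e i : reduced_gen mu sA su sv sw i * e = reduced_gen mu sA su sv sw i /\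
  e * reduced_gen mu sA su sv sw i = reduced_gen mu sA su sv sw i.
Proof.
have [h1 h2 h3] := piso_proj (rel_src_proj i) (rel_reduced_gen i); split.
  rewrite -{1}h1 -mulrA (proj_leC rel_e_proj) //; first exact: rel_src_proj.
  exact: rel_e_src.
by rewrite -h2 mulrA rel_e_q.
Qed.

Lemma reduced_fam_piso i : let U := shrink_iso mu sA su sv sw in
  piso (star U * src_proj A q i * U) (star U * q i * U) (reduced_fam mu sA su sv sw i).
Proof.
have [h3 h4] := reduced_gen_e i; have [_ U2] := rel_shrink_iso.
exact: (piso_compress U2 (rel_reduced_gen i) h3 h4).
Qed.

Lemma reduced_fam_family : ck_family A (reduced_fam mu sA su sv sw).
Proof.
have [U1 U2] := rel_shrink_iso; have [_ eU _] := piso_proj (is_proj1 D) (conj U1 U2).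
have pF := reduced_fam_piso; rewrite /reduced_fam in pF *.
move: (shrink_iso _ _ _ _ _) U1 U2 eU pF => U U1 U2 eU pF.
split=> [i||i].
- have [_ h2 _] := piso_proj (rel_src_proj i) (rel_reduced_gen i).
  have [x1 x2] := pF i; rewrite /partial_isometry x2 -!(mulrA (star U)) -(mulrA (q i)) (mulKx U2).
  by rewrite (mulrA e) (proj2 (reduced_gen_e i)) (mulrA (q i)) h2.
- under eq_bigr do rewrite (proj2 (pF _)).
  by rewrite -mulr_suml -mulr_sumr -/(eA sA) -mulrA eU.
rewrite (proj1 (pF i)) /src_proj mulr_sumr mulr_suml; apply: eq_bigr => j _.
by rewrite (proj2 (pF j)) mulrzAr mulrzAl.
Qed.

End Rel.

(** * Naturality of the reduction, for homomorphisms as well as for conjugations by unitaries *)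

Section Naturality.
Variables (D D' : cstarAlgType R) (f : D -> D').
Hypotheses (fD : {morph f : x y / x + y}) (fM : {morph f : x y / x * y}).
Hypotheses (f1 : f 1 = 1) (fS : star_morphism f).
Variables (mu : seq 'I_m.+1) (sA : 'I_m.+1 -> D) (su sv sw : D).

Lemma hom0 : f 0 = 0.
Proof. by apply: (addIr (f 0)); rewrite -fD !add0r. Qed.

Lemma homN : {morph f : x / - x}.
Proof. by move=> x; apply: (addIr (f x)); rewrite -fD !addNr hom0. Qed.

Lemma hom_sum I (r : seq I) (P : pred I) (G : I -> D) :
  f (\sum_(i <- r | P i) G i) = \sum_(i <- r | P i) f (G i).
Proof. by elim/big_rec2: _ => [|i a b _ <-]; rewrite ?hom0 ?fD. Qed.

Lemma homz x (z : int) : f (x *~ z) = f x *~ z.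
Proof.
have nn k : f (x *+ k) = f x *+ k.
  by elim: k => [|k ih]; rewrite ?hom0 // !mulrS fD ih.
by case: z => k; rewrite ?NegzE ?mulrNz ?homN -!pmulrn nn.
Qed.

Lemma bar_rel_map : bar_rel A sA su sv sw -> bar_rel A (f \o sA) (f su) (f sv) (f sw).
Proof.
have fp x : is_proj (x * star x) -> is_proj (f x * star (f x)).
  by move=> [h1 h2]; rewrite -fS -fM; split; rewrite -?fS -?fM ?h1 ?h2.
have fr i : rproj (f \o sA) i = f (rproj sA i) by rewrite /rproj /= fM fS.
have fs i : src_proj A (rproj (f \o sA)) i = f (src_proj A (rproj sA) i).
  by rewrite /src_proj hom_sum; apply: eq_bigr => j _; rewrite homz fr.
move=> h; split.
- by move=> i; apply: fp; exact: (br_pA h).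
- exact/fp/(br_pu h).
- exact/fp/(br_pv h).
- exact/fp/(br_pw h).
- by rewrite -f1 -(br_sum h) !fD !fM !fS hom_sum; congr (_ + _); apply: eq_bigr => i _; rewrite fr.
- by move=> i iN; rewrite fs -(br_A h) //= fM fS.
- by rewrite /= -!fS -!fM (br_N h).
- by rewrite fs -!fS -!fM (br_u h) fD.
- by rewrite -!fS -!fM (br_v h) !fD.
by rewrite -!fS -!fM (br_w h) fD.
Qed.

Lemma last_gen_map : last_gen mu (f \o sA) (f su) (f sv) (f sw) = f (last_gen mu sA su sv sw).
Proof.
have fr i : rproj (f \o sA) i = f (rproj sA i) by rewrite /rproj /= fM fS.
have fs i : src_proj A (rproj (f \o sA)) i = f (src_proj A (rproj sA) i).
  by rewrite /src_proj hom_sum; apply: eq_bigr => j _; rewrite homz fr.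
have fw : Sw (f \o sA) mu = f (Sw sA mu).
  by rewrite /Sw; elim/big_rec2: _ => [|i a b _ ->]; rewrite ?f1 ?fM.
by rewrite /last_gen /new_last /tau /return_iso /srcN fs fw !o2_unlock !(fD, fM, fS, homN).
Qed.

Lemma shrink_iso_map : shrink_iso mu (f \o sA) (f su) (f sv) (f sw) = f (shrink_iso mu sA su sv sw).
Proof.
have fr i : rproj (f \o sA) i = f (rproj sA i) by rewrite /rproj /= fM fS.
have fw : Sw (f \o sA) mu = f (Sw sA mu).
  by rewrite /Sw; elim/big_rec2: _ => [|i a b _ ->]; rewrite ?f1 ?fM.
have fe : eA (f \o sA) = f (eA sA).
  by rewrite /eA hom_sum; apply: eq_bigr => j _; rewrite fr.
by rewrite /shrink_iso /shrink fe /fam_iota /fam_o2b /fam_o2c /return_iso fw !o2_unlock !(fD, fM, fS, homN).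
Qed.

Lemma reduced_gen_map i : reduced_gen mu (f \o sA) (f su) (f sv) (f sw) i = f (reduced_gen mu sA su sv sw i).
Proof. by rewrite /reduced_gen; case: ifP => _ //; rewrite last_gen_map. Qed.

Lemma reduced_fam_map i : reduced_fam mu (f \o sA) (f su) (f sv) (f sw) i = f (reduced_fam mu sA su sv sw i).
Proof. by rewrite /reduced_fam shrink_iso_map reduced_gen_map !fM fS. Qed.

End Naturality.
End Reduction.

(** * From families for the original matrix to families for the extended one *)

Section Expansion.
Variables (R : realType) (D : cstarAlgType R) (m : nat) (A : 'M[int]_m.+1).
Hypothesis A01 : mx01 A.
Local Notation N := (@ord_max m).
Variable S : 'I_m.+1 -> D.
Hypothesis fS : ck_family A S.

Record expansion (sA : 'I_m.+1 -> D) (su sv sw U k : D) : Prop := Expansion {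
  ex_rel : bar_rel A sA su sv sw;
  ex_iso : star U * U = 1;
  ex_e : U * star U = eA sA;
  ex_A : forall i, i != N -> sA i = S i * star U;
  ex_US : forall i, i != N -> U * S i = S i;
  ex_N : rproj sA N = U * rproj S N * star U;
  ex_k : star k * k = rproj sA N;
  ex_w : sw * star sw * k = k }.

Lemma piso_isom (p x : D) : is_proj p -> star x * x = p -> piso p (x * star x) x.
Proof. by []. Qed.

Lemma iso_ortho_proj (p x y : D) : is_proj p -> star x * x = p -> star x * y = 0 ->
  x * star x * (y * star y) = 0.
Proof. by move=> pp hx h; rewrite -mulrA (mulKx0 h) mulr0. Qed.

(* With orthogonal isometries [G], [Dl], [E] of the corner of [p = p_N] the complement
   [v] of [G G^*] in [p] is cut into the three new projections: [Dl G G^* Dl^*],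
   [Dl v Dl^*] and [v - Dl Dl^*]. *)
Lemma expansion_exists : ck_graph A ->
  exists sA su sv sw U k, expansion sA su sv sw U k.
Proof.
move=> gA; have [x [Px xo]] := room A01 gA fS 1 3.
have [p [pE jp pS pS0]] : exists p, [/\ p = rproj S N, is_proj p, p * S N = S N &
    forall i, i != N -> p * S i = 0].
  exists (rproj S N); split=> //; [exact: ck_proj fS N|exact: ck_pS fS N|].
  by move=> i iN; rewrite (ck_pS0 fS) // eq_sym.
have {}xo a b : star (x a) * x b = (a == b)%:R by have := xo a b 0%N isT.
have {}Px a : x a * p = p * x a by rewrite pE; exact: Px.
have [G [Dl [E [GG DD EE [GD GE DE] [pG pD pEE]]]]] : exists G Dl E : D, [/\ star G * G = p,
    star Dl * Dl = p, star E * E = p,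
    [/\ star G * Dl = 0, star G * E = 0 & star Dl * E = 0] & [/\ p * G = G, p * Dl = Dl & p * E = E]].
  have iso a b : star (x a * p) * (x b * p) = (a == b)%:R * p.
    by rewrite starM (proj1 jp) -mulrA (mulrA (star (x a))) xo; case: eqP => _;
      rewrite ?mul1r ?mul0r ?mulr0 // (proj2 jp).
  have px a : p * (x a * p) = x a * p by rewrite mulrA -Px -mulrA (proj2 jp).
  exists (x ord0 * p), (x (lift ord0 ord0) * p), (x ord_max * p).
  by split; rewrite ?iso /= ?mul1r //; split; rewrite ?iso ?px //= mul0r.
have hG := piso_isom jp GG; have hD := piso_isom jp DD; have hE := piso_isom jp EE.
have jG := piso_proj_r jp hG; have jD := piso_proj_r jp hD; have jE := piso_proj_r jp hE.
have oGD := iso_ortho_proj jp GG GD; have oGE := iso_ortho_proj jp GG GE.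
have oDE := iso_ortho_proj jp DD DE.
have leG : p * (G * star G) = G * star G by rewrite mulrA pG.
have leD : p * (Dl * star Dl) = Dl * star Dl by rewrite mulrA pD.
have leE : p * (E * star E) = E * star E by rewrite mulrA pEE.
have [g [gE jg]] : exists g, g = G * star G /\ is_proj g by exists (G * star G).
have [d [dE jd]] : exists d, d = Dl * star Dl /\ is_proj d by exists (Dl * star Dl).
have [ee [eeE jee]] : exists e, e = E * star E /\ is_proj e by exists (E * star E).
rewrite -gE -dE -eeE in hG hD hE leG leD leE oGD oGE oDE.
have leG' := proj_leC jp jg leG.
have jv : is_proj (p - g) by apply: projB.
have gv : g * (p - g) = 0 by rewrite mulrBr leG' (proj2 jg) subrr.
have [v [vE jv' gv' pv]] : exists v, [/\ v = p - g, is_proj v, g * v = 0 & p * v = v].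
  exists (p - g); split=> //; by rewrite mulrBr (proj2 jp) leG.
have vp := proj_leC jp jv' pv.
have gpv : g + v = p by rewrite vE subrKC.
have jp1 := projC jp.
have cp : (1 - p) * p = 0 by rewrite mulrBl mul1r (proj2 jp) subrr.
have cg : (1 - p) * g = 0 by rewrite -leG mulrA cp mul0r.
(* [U] shrinks [p] to [g] and thereby frees [v], which will hold the three new projections. *)
pose U := 1 - p + G.
have hU : piso 1 (1 - v) U.
  have := pisoD jp1 jp (piso_id jp1) hG cp cg; rewrite subrK.
  by rewrite (_ : 1 - p + g = 1 - v) // vE opprB addrCA addrC.
have [U1 U2] := hU.
have US i : i != N -> U * S i = S i.
  move=> iN; have Gp : G * p = G by have [] := piso_proj jp hG.
  by rewrite /U mulrDl mulrBl mul1r -Gp -mulrA (pS0 _ iN) mulr0 subr0 addr0.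
have Up : U * p = G.
  by rewrite /U mulrDl cp add0r; have [] := piso_proj jp hG.
have UpU : U * p * star U = g.
  by rewrite -(proj2 jp) mulrA -mulrA -{2}(proj1 jp) -starM Up gE.
have hDg := piso_sub jp jg leG hD; have hDv := piso_sub jp jv' pv hD.
have [pu [puE hu]] : exists pu, pu = Dl * g * star Dl /\ piso g pu (Dl * g) by exists (Dl * g * star Dl).
have [pv_ [pvE hv]] : exists q, q = Dl * v * star Dl /\ piso v q (Dl * v) by exists (Dl * v * star Dl).
have ju := piso_proj_r jg hu; have jpv := piso_proj_r jv' hv.
have uvd : pu + pv_ = d.
  rewrite puE pvE -mulrDl -mulrDr gpv dE; congr (_ * _).
  by have [] := piso_proj jp hD.
have uv : pu * pv_ = 0.
  by rewrite puE pvE -!mulrA (mulKx DD) (mulKx pv) (mulKx0 gv') mulr0.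
have vd : v * d = d.
  rewrite vE mulrBl leD oGD subr0 //.
have ve : v * ee = ee by rewrite vE mulrBl leE oGE subr0.
have dv := proj_leC jv' jd vd.
have jw : is_proj (v - d) by apply: projB.
have [pw [pwE jw' dw we]] : exists w, [/\ w = v - d, is_proj w, d * w = 0 & w * ee = ee].
  exists (v - d); split=> //; first by rewrite mulrBr dv (proj2 jd) subrr.
  by rewrite mulrBl ve oDE subr0.
have ew := proj_leC jw' jee we.
have dwv : d + pw = v by rewrite pwE subrKC.
have du : d * pu = pu by rewrite -uvd mulrDl (proj2 ju) (proj_ortho_sym ju jpv uv) addr0.
have dpv : d * pv_ = pv_ by rewrite -uvd mulrDl (proj2 jpv) uv add0r.
have wd := proj_ortho_sym jd jw' dw.
have wu : pw * pu = 0 by rewrite -du mulrA wd mul0r.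
have wv : pw * pv_ = 0 by rewrite -dpv mulrA wd mul0r.
have sumv : pu + pv_ + pw = v by rewrite uvd.
have srcU j : U * rproj S j * star U = if j == N then g else rproj S j.
  case: eqVneq => [->|jN]; first by rewrite -pE.
  by rewrite /rproj mulrA US // -mulrA -starM US.
pose sA i := if i == N then g * star Dl else S i * star U.
have hsN : piso pu g (g * star Dl) by have := piso_sym hu; rewrite starM (proj1 jg).
have qE i : rproj sA i = U * rproj S i * star U.
  rewrite srcU /sA /rproj; case: eqP => iN; first by case: hsN.
  by rewrite starM starK -mulrA (mulKx1 U1).
have QE i : src_proj A (rproj sA) i = U * (star (S i) * S i) * star U.
  have [_ _ ->] := fS; rewrite /src_proj mulr_sumr mulr_suml; apply: eq_bigr => j _.
  by rewrite qE mulrzAr mulrzAl.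
have vU : v * U = 0.
  by rewrite -[U]mulr1 -U1 !mulrA -[v * U * _]mulrA U2 mulrBr mulr1 (proj2 jv') subrr mul0r.
have [r [rE jr hS]] : exists r, [/\ r = star (S N) * S N, is_proj r & piso r p (S N)].
  have hs : piso (star (S N) * S N) p (S N) by rewrite pE.
  exists (star (S N) * S N); split=> //.
  exact: piso_proj_r jp (piso_sym hs).
have [Q [QE0 QN]] : exists Q, Q = src_proj A (rproj sA) N /\ Q = U * r * star U.
  by exists (src_proj A (rproj sA) N); split; rewrite // QE rE.
have hUr := piso_sub (is_proj1 D) jr (mul1r r) hU; rewrite -QN in hUr.
have jQ := piso_proj_r jr hUr.
have vQ : v * Q = 0 by rewrite QN !mulrA vU !mul0r.
have pvv : pv_ * v = pv_ by rewrite -sumv !mulrDr (proj_ortho_sym ju jpv uv) add0r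
  (proj2 jpv) (proj_ortho_sym jw' jpv wv) addr0.
have Qpv : Q * pv_ = 0.
  by apply: (proj_ortho_sym jpv jQ); rewrite -pvv -mulrA vQ mulr0.
(* For [su]: [Q] reaches [g] through [S N] and [G], and [pv_] reaches [v]; together they fill
   [p = g + v], which is carried on to [pu]. *)
have hx := pisoM jQ (pisoM jQ (piso_sym hUr) hS) hG.
have hy := piso_sym hv.
have hxy := pisoD jQ jpv hx hy Qpv gv'; rewrite gpv in hxy.
have hsu := pisoM (projD jQ jpv Qpv) hxy (pisoM jp hG hu).
have hsv := hv; rewrite -{1}sumv in hsv.
(* For [sw]: the identity on [pw - ee], while [ee] and [pv_] are packed into the two parts [E g E^*]
   and [E v E^*] of [ee]. *)
have jwe : is_proj (pw - ee) by apply: projB.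
have hz1 := pisoM jee (pisoM jee (piso_sym hE) hG) (piso_sub jp jg leG hE).
have hz2 := pisoM jpv hy (piso_sub jp jv' pv hE).
have wee : (pw - ee) * ee = 0 by rewrite mulrBl we (proj2 jee) subrr.
have epv : ee * pv_ = 0 by rewrite -ew -mulrA wv mulr0.
have gv_E : E * g * star E * (E * v * star E) = 0.
  by rewrite -!mulrA (mulKx EE) (mulKx pv) (mulKx0 gv') mulr0.
have hz := pisoD jee jpv hz1 hz2 epv gv_E.
have gvE : E * g * star E + E * v * star E = ee.
  by rewrite -mulrDl -mulrDr gpv eeE; congr (_ * _); have [] := piso_proj jp hE.
rewrite gvE in hz.
have wev : (pw - ee) * pv_ = 0 by rewrite mulrBl wv epv subrr.
have wepv : (pw - ee) * (ee + pv_) = 0 by rewrite mulrDr wee wev addr0.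
have hsw := pisoD jwe (projD jee jpv epv) (piso_id jwe) hz wepv wee.
rewrite subrK addrA subrK [pw + pv_]addrC in hsw.
(* A copy of [g], the range projection of [sA N], under [pw]; it will carry the class that a twist
   of [sw] has to realize. *)
have hk := pisoM jg (piso_sym hG) hE.
have [k1 k2] := hk.
have [sw {}hsw] : exists sw, piso (pv_ + pw) pw sw by eexists; exact: hsw.
have [su {}hsu] : exists su, piso (Q + pv_) pu su by eexists; exact: hsu.
have [u1 u2] := hsu; have [v1 v2] := hsv; have [w1 w2] := hsw.
have eE : eA sA = 1 - v.
  rewrite /eA -U2; under eq_bigr do rewrite qE.
  by rewrite -mulr_suml -mulr_sumr (ck_sum fS) mulr1.
exists sA, su, (Dl * v), sw, U, (E * star G); split=> //.
- split; rewrite ?u2 ?v2 ?w2 //.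
  + move=> i; rewrite qE srcU; case: eqP => // _; exact: ck_proj fS i.
  + by rewrite -/(eA sA) eE sumv subrK.
  + move=> i iN; rewrite QE /sA (negPf iN) starM starK -!mulrA.
    by rewrite !mulrA.
  + by rewrite /sA eqxx; case: hsN.
  by rewrite u1 QE0.
- by rewrite eE.
- by move=> i iN; rewrite /sA (negPf iN).
- by rewrite qE srcU eqxx.
by have [_ h _] := piso_proj jg hk; rewrite w2 -{1}h mulrA we.
Qed.

End Expansion.

Lemma aeq_conj (R : realType) (D : cstarAlgType R) n (M : 'M[int]_n) (S : 'I_n -> D) X :
  mx01 M -> ck_family M S -> aeq S X 1 -> forall e : R, 0 < e ->
  exists2 u, unitary u & forall i, cnorm (u * (X * S i) * star u - S i) <= e.
Proof.
move=> M01 fS h e e0; have [u [uu Pu hu]] := h e e0; exists u => // i.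
have sa := pcomm_sa fS; have Pu' := saS sa Pu.
have -> : u * (X * S i) * star u - S i = (u * X * star (lam S u) - 1) * S i.
  by rewrite mulrBl mul1r -(lam_star S) -[_ * lam S _ * _]mulrA (lamS M01 fS _ Pu') !mulrA.
apply: le_trans (cnormMr_le _ _) hu; rewrite -cnorm_starE; apply: cnorm_le1.
by rewrite starK; apply: cnorm_proj; exact: ck_proj fS i.
Qed.

(** * Twists of the new generators, and the round trip on the original algebra *)

Section Twist.
Variables (R : realType) (D : cstarAlgType R) (m : nat) (A : 'M[int]_m.+1).
Hypothesis A01 : mx01 A.
Local Notation N := (@ord_max m).

Lemma twist_piso (p q s W : D) : is_proj p -> piso p q s -> punit q W -> piso p q (W * s).
Proof. by move=> jp hs [_ hW]; exact: (pisoM jp hs hW). Qed.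

Lemma twist_range (s W : D) : is_proj (s * star s) -> punit (s * star s) W ->
  W * s * star (W * s) = s * star s /\ star (W * s) * (W * s) = star s * s.
Proof.
move=> js hW; have hs : piso (star s * s) (s * star s) s by [].
have jp : is_proj (star s * s) := piso_proj_r js (piso_sym hs).
by have [] := twist_piso jp hs hW.
Qed.

Lemma bar_rel_twist sA (su sv sw Wu Wv Ww : D) : bar_rel A sA su sv sw ->
  punit (su * star su) Wu -> punit (sv * star sv) Wv -> punit (sw * star sw) Ww ->
  bar_rel A sA (Wu * su) (Wv * sv) (Ww * sw).
Proof.
move=> h hu hv hw; have [u1 u2] := twist_range (br_pu h) hu.
have [v1 v2] := twist_range (br_pv h) hv; have [w1 w2] := twist_range (br_pw h) hw.
by case: h => *; split; rewrite ?u1 ?v1 ?w1 ?u2 ?v2 ?w2.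
Qed.

Variables (a b : D) (ha : star a * a = 1) (hb : star b * b = 1) (hab : star a * b = 0).
Local Notation cl := (pcl ha hb hab).
Variable mu : seq 'I_m.+1.
Hypothesis hmu : first_return A mu.

Lemma last_gen_twist sA (su sv sw Wu Wv Ww : D) : bar_rel A sA su sv sw ->
  punit (su * star su) Wu -> punit (sv * star sv) Wv -> punit (sw * star sw) Ww ->
  exists W, [/\ punit (rproj sA N) W,
    last_gen A mu sA (Wu * su) (Wv * sv) (Ww * sw) = W * last_gen A mu sA su sv sw &
    cl (rproj sA N) W = cl (su * star su) Wu - cl (sw * star sw) Ww].
Proof.
move=> h hu hv hw; have [u1 u2] := twist_range (br_pu h) hu.
have [v1 v2] := twist_range (br_pv h) hv; have [w1 w2] := twist_range (br_pw h) hw.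
have [Qu Qv Qw] := rel_src_r A01 h N; have [uv uw vw] := rel_rr h.
have jQ := rel_src_proj A01 h N.
have [W [pW WE clW]] := new_last_class ha hb hab jQ (br_pu h) (br_pv h) (br_pw h)
  Qv uv uw vw (rel_gadget A01 h hmu) hu hv hw.
by exists W; split=> //; rewrite -WE /last_gen /new_last u1 v1 w1.
Qed.

Hypothesis gA : ck_graph A.
Variables (S : 'I_m.+1 -> D) (fS : ck_family A S).

(* Twisting [sw] by [Ww] changes the class of the last generator of the reduced
   family by [- cl Ww], so [Ww] can be chosen to make the obstruction vanish. *)
Lemma contract_expand sA su sv sw U k : expansion A S sA su sv sw U k ->
  exists Ww Y, [/\ punit (sw * star sw) Ww, punit (rproj sA N) Y, cl (rproj sA N) Y = 0,
    last_gen A mu sA su sv (Ww * sw) = Y * (U * S N * star U) &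
    forall e : R, 0 < e -> exists2 u, unitary u &
      forall i, cnorm (u * reduced_fam A mu sA su sv (Ww * sw) i * star u - S i) <= e].
Proof.
move=> hx; have [h U1 U2 hA US qN kk wk] := hx.
have [ju jv jw] := And3 (br_pu h) (br_pv h) (br_pw h).
have jq := br_pA h N.
have [q [qE jqq]] : exists q, q = rproj sA N /\ is_proj q by exists (rproj sA N).
rewrite -!qE.
have hk : piso q (k * star k) k by split; rewrite ?qE.
have jQ := rel_src_proj A01 h N.
have qj j : rproj sA j = U * rproj S j * star U.
  have [->|jN] := eqVneq j N; first exact: qN.
  rewrite /rproj hA // starM starK -mulrA (mulKx1 U1).
  by rewrite mulrA US // -mulrA -starM US.
have QE : src_proj A (rproj sA) N = U * (star (S N) * S N) * star U.
  have [_ _ ->] := fS; rewrite /src_proj mulr_sumr mulr_suml; apply: eq_bigr => j _.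
  by rewrite qj mulrzAr mulrzAl.
have hM : piso (src_proj A (rproj sA) N) q (U * S N * star U).
  by rewrite QE qE qN /rproj; split; rewrite !starM starK -!mulrA (mulKx1 U1).
have hv := rel_last_gen A01 h hmu; rewrite -qE in hv.
have pW0 := piso_punit jQ hv hM.
have [M ME] : exists M, M = U * S N * star U by exists (U * S N * star U).
rewrite -ME in hM pW0 *.
have [W0 [{}pW0 W0E]] : exists W0, punit q W0 /\ last_gen A mu sA su sv sw = W0 * M.
  exists (last_gen A mu sA su sv sw * star M); split=> //.
  by rewrite -mulrA (proj1 hM); have [-> _ _] := piso_proj jQ hv.
have [pu [puE {}ju pus]] : exists p, [/\ p = su * star su, is_proj p & p * su = su].
  by exists (su * star su); split=> //; exact: proj_pi.
have [pv [pvE {}jv pvs]] : exists p, [/\ p = sv * star sv, is_proj p & p * sv = sv].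
  by exists (sv * star sv); split=> //; exact: proj_pi.
have tw Ww hW := last_gen_twist (Ww := Ww) h (punit_proj (br_pu h)) (punit_proj (br_pv h)) hW.
rewrite -puE -pvE pus pvs -qE in tw.
have h'E Ww hW := bar_rel_twist (Ww := Ww) h (punit_proj (br_pu h)) (punit_proj (br_pv h)) hW.
rewrite -puE -pvE pus pvs in h'E.
have [pw [pwE {}jw]] : exists p, p = sw * star sw /\ is_proj p by exists (sw * star sw).
rewrite -!pwE in tw wk h'E *.
have kw : pw * (k * star k) = k * star k by rewrite mulrA wk.
have [kp [kpE jkp]] : exists kp, kp = k * star k /\ is_proj kp.
  by exists (k * star k); split=> //; exact: piso_proj_r jqq hk.
have pk := piso_conj hk pW0; have clk := cl_piso ha hb hab hk pW0.
rewrite -kpE in kw pk clk.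
have jd : is_proj (pw - kp) by apply: projB => //; exact: proj_leC.
have kd : kp * (pw - kp) = 0 by rewrite mulrBr (proj_leC jw jkp kw) (proj2 jkp) subrr.
(* Transporting [W0] along [k] and completing by the identity realizes its class on [pw]. *)
have [Ww [pWw clWw]] : exists Ww, punit pw Ww /\ cl pw Ww = cl q W0.
  exists (k * W0 * star k + (pw - kp)); rewrite -{1 3}(subrKC kp pw); split.
    by apply: punitD => //; exact: punit_proj.
  by rewrite cl_extend.
have [W [pW WE clW]] := tw Ww pWw.
exists Ww, (W * W0); have pY := punitM pW pW0.
have clY : cl q (W * W0) = 0.
  by rewrite pclM // clW pcl_proj clWw sub0r addNr.
have vE : last_gen A mu sA su sv (Ww * sw) = W * W0 * M by rewrite WE W0E mulrA.
split=> //; move: (W * W0) pY clY vE => Y pY clY vE.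
have h' := h'E Ww pWw.
have [V1 V2] := rel_shrink_iso A01 h' hmu.
have [F [FE FN FA]] : exists F, [/\ F = reduced_gen A mu sA su sv (Ww * sw), F N = Y * M &
    forall i, i != N -> F i = S i * star U].
  exists (reduced_gen A mu sA su sv (Ww * sw)); split; rewrite // /reduced_gen ?eqxx ?vE // => i iN.
  by rewrite (negPf iN) hA.
rewrite /reduced_fam -FE.
have eq : eA sA * q = q by rewrite qE (rel_e_q h).
move: (shrink_iso mu sA su sv (Ww * sw)) V1 V2 => V V1 V2.
move: (eA sA) U2 V2 eq => e U2 V2 eq.
have [p [pE jp pS pS0]] : exists p, [/\ p = rproj S N, is_proj p, p * S N = S N &
    forall i, i != N -> p * S i = 0].
  exists (rproj S N); split=> //; [exact: ck_proj fS N|exact: ck_pS fS N|].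
  by move=> i iN; rewrite (ck_pS0 fS) // eq_sym.
have eU : e * U = U by rewrite -U2 -mulrA U1 mulr1.
have eV : star V * e = star V by rewrite -V2 mulrA V1 mul1r.
have Uq : U * (star U * q) = q by rewrite mulrA U2.
have [x xE] : exists x, x = star U * Y * U by exists (star U * Y * U).
have qp : star U * q * U = p.
  by rewrite qE qN -pE -!mulrA U1 mulr1 (mulKx1 U1).
have pYU : punit (star U * q * star (star U)) (star U * Y * star (star U)).
  by apply: punit_conj => //; rewrite starK.
have clx := pcl_conj ha hb hab (y := star U) pY.
rewrite starK qp -xE in pYU clx; have {}clx := clx Uq; rewrite clY in clx.
have [px xp] := punit_mul pYU.
(* [X] differs from [1] only in the corner of [p], and the reduced family is the conjugate of
   [X * S i] by the unitary [star V * U]. *)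
have [X XE] : exists X, X = fullu p x by exists (fullu p x).
have XS i : X * S i = if i == N then x * S N else S i.
  rewrite XE /fullu mulrDl mulrBl mul1r; case: eqVneq => [->|iN].
    by rewrite pS subrr addr0.
  by rewrite (pS0 _ iN) subr0 -xp -mulrA (pS0 _ iN) mulr0 add0r.
have Xp j : X * rproj S j = (if j == N then x else rproj S j) /\
    rproj S j * X = if j == N then x else rproj S j.
  rewrite XE /fullu; case: eqVneq => [->|jN].
    by rewrite -pE mulrDl mulrDr mulrBl mulrBr mul1r mulr1 (proj2 jp) subrr !addr0.
  have h0 : p * rproj S j = 0 by rewrite pE (ck_ortho fS) // eq_sym.
  have h1 : rproj S j * p = 0 by rewrite pE (ck_ortho fS).
  rewrite mulrDl mulrDr mulrBl mulrBr mul1r mulr1 h0 h1 !subr0.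
  by rewrite -{1}xp -mulrA h0 -{2}px mulrA h1 mul0r mulr0 !add0r.
have uX : unitary X by rewrite XE; exact: fullu_unitary.
have PX : pcomm S X by move=> j; have [-> ->] := Xp j.
have aX : aeq S X 1.
  apply: (class_aeq A01 gA (a := a) (b := b) fS uX PX) => j; rewrite (proj1 (Xp j)).
  by case: eqVneq => [->|_]; rewrite -?pE ?pcl_proj.
move=> d d0; have [u uu hu] := aeq_conj A01 fS aX d0.
have uW : unitary (star V * U).
  split; rewrite starM starK -mulrA; first by rewrite (mulKx V2) eU U1.
  by rewrite (mulKx U2) mulrA eV V1.
exists (u * star (star V * U)); first by apply: unitaryM => //; exact: unitaryV.
have FX i : star V * F i * V = star V * U * (X * S i) * star (star V * U).
  rewrite XS starM starK; case: eqVneq => [->|iN].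
    rewrite FN ME xE -!mulrA (mulKx U2) (mulrA (star V) e) eV.
    by [].
  by rewrite FA // -!mulrA; congr (_ * _); rewrite (mulrA U) US.
move=> i; rewrite FX; move: (star V * U) uW => Z [Z1 Z2]; rewrite starM starK.
by rewrite -!mulrA (mulKx1 Z1) (mulKx1 Z1) !mulrA; have := hu i; rewrite !mulrA.
Qed.

End Twist.

(** * Comparison of projections and rigidity *)

Section Equivalence.
Variables (R : realType) (D : cstarAlgType R).
Implicit Types (p q r x y b c : D).

(* In the Murray-von Neumann semigroup: [r = r + r']. *)
Lemma o2_absorb r r' b c x : is_proj r -> is_proj r' -> o2pair r' b c ->
  star x * x = r' -> r * x = x ->
  exists y z, [/\ piso r (y * star y) y, piso r' (z * star z) z,
    y * star y * (z * star z) = 0 & y * star y + z * star z = r].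
Proof.
move=> jr jr' o2 xx rx; have hx : piso r' (x * star x) x by [].
have jx := piso_proj_r jr' hx.
have [xr _ _] := piso_proj jr' hx.
have le : r * (x * star x) = x * star x by rewrite mulrA rx.
have jd : is_proj (r - x * star x) by apply: projB => //; exact: proj_leC.
have dx0 : (r - x * star x) * x = 0 by rewrite mulrBl rx -mulrA xx xr subrr.
have d0 : (r - x * star x) * (x * star x) = 0 by rewrite mulrA dx0 mul0r.
have jb := piso_proj_r jr' (ob o2); have jc := piso_proj_r jr' (oc o2).
have [sum po] := (osum o2, pair_ortho o2).
have hb := ob o2; have hc := oc o2.
move: (b * star b) (c * star c) jb jc sum po hb hc => f g jf jg sum po hb hc.
have fr : r' * f = f by rewrite -sum mulrDl (proj2 jf) (proj_ortho_sym jf jg po) addr0.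
have gr : r' * g = g by rewrite -sum mulrDl (proj2 jg) po add0r.
have h1 := pisoM jx (pisoM jx (piso_sym hx) hb) (piso_sub jr' jf fr hx).
have h2 := pisoM jr' hc (piso_sub jr' jg gr hx).
have dP y : (r - x * star x) * (x * y) = 0 by rewrite mulrA dx0 mul0r.
have h3 := pisoD jd jx (piso_id jd) h1 d0; rewrite subrK in h3.
have {}h3 := h3 (etrans (congr1 _ (esym (mulrA _ _ _))) (dP _)).
eexists; eexists; split.
- by split; [exact: (proj1 h3)|].
- by split; [exact: (proj1 h2)|].
- rewrite (proj2 h3) (proj2 h2) mulrDl -!mulrA dP add0r.
  by rewrite (mulKx xx) (mulKx gr) (mulKx0 po) mulr0.
rewrite (proj2 h3) (proj2 h2) -addrA -mulrDl -mulrDr sum -mulrA.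
by rewrite -(proj1 jr') -starM xr subrK.
Qed.

(** Each projection absorbs the other, so both split into a copy of [r] and a copy of [r']. *)
Lemma o2_equiv r r' b c b' c' x x' : is_proj r -> is_proj r' ->
  o2pair r b c -> o2pair r' b' c' ->
  star x * x = r' -> r * x = x -> star x' * x' = r -> r' * x' = x' ->
  exists y, piso r r' y.
Proof.
move=> jr jr' o2 o2' h1 h2 h3 h4.
have [y [z [yh zh yz rE]]] := o2_absorb jr jr' o2' h1 h2.
have [y' [z' [yh' zh' yz' rE']]] := o2_absorb jr' jr o2 h3 h4.
have jy := piso_proj_r jr yh; have jz := piso_proj_r jr' zh.
have jy' := piso_proj_r jr' yh'; have jz' := piso_proj_r jr zh'.
exists (z' * star y + y' * star z); rewrite -{1}rE -rE' [X in piso _ X _]addrC.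
apply: pisoD => //; [exact: (pisoM jy (piso_sym yh))|exact: (pisoM jz (piso_sym zh))|].
exact: (proj_ortho_sym jy' jz').
Qed.

(* In the Murray-von Neumann semigroup: [w = w + v = w + v' = w + u + v + w' =
   v + w' = w']. *)
Lemma absorbing_equiv (pu pv pw pu' pv' pw' sv sw sv' sw' yu yv : D) :
  is_proj pu -> is_proj pv -> is_proj pw -> is_proj pu' -> is_proj pv' -> is_proj pw' ->
  pu * pv = 0 -> pu * pw = 0 -> pv * pw = 0 ->
  pu' * pv' = 0 -> pu' * pw' = 0 -> pv' * pw' = 0 ->
  piso (pu + pv + pw) pv sv -> piso (pv + pw) pw sw ->
  piso (pu' + pv' + pw') pv' sv' -> piso (pv' + pw') pw' sw' ->
  piso pu pu' yu -> piso pv pv' yv -> exists yw, piso pw pw' yw.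
Proof.
move=> ju jv jw ju' jv' jw' uv uw vw uv' uw' vw' hv hw hv' hw' hyu hyv.
have jt' := proj_uvw ju' jv' jw' uv' uw' vw'.
have juv : is_proj (pu + pv) by apply: projD.
have juv' : is_proj (pu' + pv') by apply: projD.
have hk := pisoM jv hyv (piso_sym hv'); move: (_ * _) hk => k hk.
have hk' := piso_sym hk.
have uvw' : (pu' + pv') * pw' = 0 by rewrite mulrDl uw' vw' addr0.
have le1 : (pu' + pv' + pw') * (pu' + pv') = pu' + pv'.
  by rewrite mulrDl (proj2 juv') (proj_ortho_sym juv' jw' uvw') addr0.
have le2 : (pu' + pv' + pw') * pw' = pw' by rewrite mulrDl (proj2 jw') uvw' add0r.
have g1 := piso_sub jt' juv' le1 hk'; have g2 := piso_sub jt' jw' le2 hk'.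
have [P1 [P1E {}g1]] : exists P1, P1 = star k * (pu' + pv') * star (star k) /\
    piso (pu' + pv') P1 (star k * (pu' + pv')).
  by exists (star k * (pu' + pv') * star (star k)).
have [P2 [P2E {}g2]] : exists P2, P2 = star k * pw' * star (star k) /\
    piso pw' P2 (star k * pw').
  by exists (star k * pw' * star (star k)).
move: (star k * (pu' + pv')) (star k * pw') g1 g2 => x1 x2 g1 g2.
have [kt _ _] := piso_proj jt' hk'.
have P12 : P1 + P2 = pv by rewrite P1E P2E -mulrDl -mulrDr kt; case: hk'.
have jP1 := piso_proj_r juv' g1; have jP2 := piso_proj_r jw' g2.
have P12o : P1 * P2 = 0.
  rewrite P1E P2E -!mulrA (mulrA (star (star k))) (proj1 hk').
  by rewrite (mulKx le2) (mulKx0 uvw') mulr0.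
have wP1 : pw * P1 = 0.
  have : pv * P1 = P1 by rewrite -P12 mulrDl (proj2 jP1) (proj_ortho_sym jP1 jP2 P12o) addr0.
  by move=> <-; rewrite mulrA (proj_ortho_sym jv jw vw) mul0r.
have wP2 : pw * P2 = 0.
  have : pv * P2 = P2 by rewrite -P12 mulrDl (proj2 jP2) P12o add0r.
  by move=> <-; rewrite mulrA (proj_ortho_sym jv jw vw) mul0r.
have ha := pisoD ju' jv' (piso_sym hyu) (piso_sym hyv) uv' uv.
have hb := pisoM jP1 (piso_sym g1) ha.
have uvw : (pu + pv) * pw = 0 by rewrite mulrDl uw vw addr0.
have hc := pisoD jw jP1 (piso_id jw) hb wP1 (proj_ortho_sym juv jw uvw).
rewrite [pw + (pu + pv)]addrC in hc.
have jwP : is_proj (pw + P1) by apply: projD.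
have hd := pisoM jwP (pisoM jwP hc hv) hyv.
have he := pisoD jwP jP2 hd (piso_sym g2) _ vw'.
rewrite -addrA P12 [pw + pv]addrC in he.
have wP12 : (pw + P1) * P2 = 0 by rewrite mulrDl wP2 P12o addr0.
by eexists; exact: (pisoM jw (pisoM jw (piso_sym hw) (he wP12)) hw').
Qed.

End Equivalence.

Section ClassTwist.
Variables (R : realType) (D : cstarAlgType R) (n : nat) (M : 'M[int]_n).
Hypotheses (M01 : mx01 M) (gM : ck_graph M).
Variables (a b : D) (ha : star a * a = 1) (hb : star b * b = 1) (hab : star a * b = 0).
Local Notation cl := (pcl ha hb hab).

Lemma punit_comm (z p : D) : unitary z -> is_proj p -> z * p = p * z -> punit p (z * p).
Proof.
move=> [z1 z2] [sp pp] zp; split=> //; split; rewrite starM sp -mulrA.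
  by rewrite (mulKx1 z1).
by rewrite (mulKx pp) mulrA zp -mulrA z2 mulr1.
Qed.

(** Conjugation by [star z] replaces [W] by [star z * W * lam S z]. In the corner of [rproj S x],
    [lam S z] is [z] carried over from the source of [S x], so the equations say that all classes of
    the new twist vanish. *)
Lemma class_aeq_twist (S : 'I_n -> D) W z : ck_family M S -> unitary W -> pcomm S W ->
  unitary z -> pcomm S z ->
  (forall x, cl (rproj S x) (W * rproj S x) + cl (star (S x) * S x) (z * (star (S x) * S x))
     = cl (rproj S x) (z * rproj S x)) -> aeq S W 1.
Proof.
move=> fS uW PW uz Pz h; have sa := pcomm_sa fS; have Pz' := saS sa Pz.
have ul := lam_unitary M01 fS Pz uz.
have uX : unitary (star z * W * lam S z).
  by apply: unitaryM => //; apply: unitaryM => //; exact: unitaryV.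
have Pl := lam_pcomm fS z.
have PX : pcomm S (star z * W * lam S z) by do 2 (apply: (saM sa) => //).
have aX : aeq S (star z * W * lam S z) 1.
  apply: (class_aeq M01 gM (a := a) (b := b) fS uX PX) => x.
  have [p [pE jp]] : exists p, p = rproj S x /\ is_proj p.
    by exists (rproj S x); split=> //; exact: (ck_proj fS x).
  have hx := h x; rewrite -pE in hx *.
  have cx y : pcomm S y -> y * p = p * y by rewrite pE; apply.
  have [pW pz] := (punit_comm uW jp (cx _ PW), punit_comm uz jp (cx _ Pz)).
  have pl := punit_comm ul jp (cx _ Pl).
  have E : star z * W * lam S z * p = star (z * p) * (W * p * (lam S z * p)).
    rewrite starM (proj1 jp) -(cx _ Pz') -!mulrA; congr (_ * _).
    by rewrite (cx _ Pl) (mulKx (proj2 jp)) (mulrA W) (cx _ PW) -!mulrA (mulKx (proj2 jp)).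
  have [r [rE jr hS]] : exists r, [/\ r = star (S x) * S x, is_proj r & piso r p (S x)].
    have hs : piso (star (S x) * S x) p (S x) by rewrite pE.
    by exists (star (S x) * S x); split=> //; exact: piso_proj_r jp (piso_sym hs).
  have zr : z * r = r * z by rewrite rE; apply/esym/(pcomm_src M01 fS).
  have lE : lam S z * p = S x * (z * r) * star (S x).
    have [Sr _ _] := piso_proj jr hS.
    by rewrite pE /rproj mulrA (lamS M01 fS) // zr mulrA Sr.
  have pr := punit_comm uz jr zr.
  rewrite E (pclM ha hb hab (punit_star pz) (punitM pW pl)) pcl_star // (pclM ha hb hab pW pl).
  by rewrite lE (cl_piso ha hb hab hS pr) rE hx addNr.
move=> e e0; have [u [uu Pu hu]] := aX e e0; exists (u * star z); split.
- by apply: unitaryM => //; exact: unitaryV.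
- exact: (saM sa).
by rewrite (lamM M01 fS) // (lam_star S) starM starK !mulrA in hu *.
Qed.

End ClassTwist.

(** * Aligning two families for the extended matrix *)

Section Alignment.
Variables (R : realType) (D : cstarAlgType R) (m : nat) (A : 'M[int]_m.+1).
Hypotheses (A01 : mx01 A) (gB : ck_graph (bar_mx A)).
Local Notation N := (@ord_max m).

Lemma rel_o2pair (sA : 'I_m.+1 -> D) (su sv sw : D) : bar_rel A sA su sv sw ->
  exists b c, o2pair (sv * star sv) b c.
Proof.
move=> h; have [uv uw vw] := rel_rr h.
have hv : piso (su * star su + sv * star sv + sw * star sw) (sv * star sv) sv.
  by split; rewrite ?(br_v h).
have hw : piso (sv * star sv + sw * star sw) (sw * star sw) sw by split; rewrite ?(br_w h).
have [h1 h2 h3 h4 _] := o2_facts (br_pu h) (br_pv h) (br_pw h) uv uw vw hv hw.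
by eexists; eexists; split; [exact: h1|exact: h2|exact: h3|exact: h4].
Qed.

Lemma rel_into_v (sA : 'I_m.+1 -> D) (su sv sw p : D) : bar_rel A sA su sv sw -> is_proj p ->
  exists x, star x * x = p /\ sv * star sv * x = x.
Proof.
move=> h [sp pp]; have fs := bar_rel_family h.
have [c [c1 c2]] := corner_isometry (bar_mx01 A01) gB fs (iv m).
have E : rproj (bar_fam sA su sv sw) (iv m) = sv * star sv by rewrite /rproj bar_famr.
rewrite E in c2; exists (c * p); split; last by rewrite mulrA c2.
by rewrite starM sp -mulrA (mulKx1 c1).
Qed.

Lemma unitary_intertwine (Z x y : D) : unitary Z -> Z * x = y * Z -> Z * star x = star y * Z.
Proof.
move=> [Z1 Z2] h; have := congr1 star h; rewrite !starM => h'.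
by rewrite -[LHS]mulr1 -Z1 !mulrA -(mulrA Z) h' !mulrA Z2 mul1r.
Qed.

Lemma conj_piso (Z p q p' q' y : D) : unitary Z -> Z * p = p' * Z -> Z * q = q' * Z ->
  piso p' q' y -> piso p q (star Z * y * Z).
Proof.
move=> [Z1 Z2] hp hq [y1 y2].
by split; rewrite !starM starK -!mulrA (mulKx1 Z2);
  [rewrite (mulrA (star y)) y1 -hp|rewrite (mulrA y) y2 -hq]; rewrite mulrA Z1 mul1r.
Qed.

Lemma compare_pisos (p q s s' : D) : is_proj p -> piso p q s -> piso p q s' ->
  exists W, punit q W /\ W * s = s'.
Proof.
move=> jp hs hs'; exists (s' * star s); split; first exact: (piso_punit jp hs' hs).
by rewrite -mulrA (proj1 hs); have [] := piso_proj jp hs'.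
Qed.

Variables (sA tA : 'I_m.+1 -> D) (su sv sw tu tv tw r : D).
Hypotheses (hs : bar_rel A sA su sv sw) (ht : bar_rel A tA tu tv tw).
Hypotheses (hr : piso (eA sA) (eA tA) r) (rA : forall i, i != N -> r * sA i = tA i * r).
Hypothesis rN : r * rproj sA N * star r = rproj tA N.

(** [r] is completed to a unitary by equivalences of the new projections: for [u] through the
    generators at [N], for [v] by mutual absorption, for [w] by [absorbing_equiv]. The choice at [u]
    makes [Z] intertwine the generators at [N] exactly; the three new generators then differ by
    twists in their range corners. *)
Lemma align : exists Z Wu Wv Ww,
  [/\ unitary Z, forall x, eA sA * x = x -> Z * x = r * x, forall i, Z * sA i = tA i * Z,
    [/\ punit (su * star su) Wu, punit (sv * star sv) Wv & punit (sw * star sw) Ww] &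
    [/\ Z * (Wu * su) = tu * Z, Z * (Wv * sv) = tv * Z & Z * (Ww * sw) = tw * Z]].
Proof.
have [ju jv jw] := And3 (br_pu hs) (br_pv hs) (br_pw hs).
have [ju' jv' jw'] := And3 (br_pu ht) (br_pv ht) (br_pw ht).
have [uv uw vw] := rel_rr hs; have [uv' uw' vw'] := rel_rr ht.
have [b [c o2]] := rel_o2pair hs; have [b' [c' o2']] := rel_o2pair ht.
have [x [x1 x2]] := rel_into_v hs jv'; have [x' [x1' x2']] := rel_into_v ht jv.
have [yv hyv] := o2_equiv jv jv' o2 o2' x1 x2 x1' x2'.
have [eu ev ew] := rel_e_r hs; have [eu' ev' ew'] := rel_e_r ht.
have jq := br_pA hs N; have jq' := br_pA ht N; have je := rel_e_proj hs; have je' := rel_e_proj ht.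
have hsN : piso (su * star su) (rproj sA N) (sA N) by split; rewrite ?(br_N hs).
have htN : piso (tu * star tu) (rproj tA N) (tA N) by split; rewrite ?(br_N ht).
have hrN := piso_sub je jq (rel_e_q hs N) hr; rewrite rN in hrN.
have hyu := pisoM ju (pisoM ju hsN hrN) (piso_sym htN).
have hv : piso (su * star su + sv * star sv + sw * star sw) (sv * star sv) sv.
  by split; rewrite ?(br_v hs).
have hw : piso (sv * star sv + sw * star sw) (sw * star sw) sw by split; rewrite ?(br_w hs).
have hu : piso (src_proj A (rproj sA) N + sv * star sv) (su * star su) su.
  by split; rewrite ?(br_u hs).
have hv' : piso (tu * star tu + tv * star tv + tw * star tw) (tv * star tv) tv.
  by split; rewrite ?(br_v ht).
have hw' : piso (tv * star tv + tw * star tw) (tw * star tw) tw by split; rewrite ?(br_w ht).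
have hu' : piso (src_proj A (rproj tA) N + tv * star tv) (tu * star tu) tu.
  by split; rewrite ?(br_u ht).
have [yw hyw] := absorbing_equiv ju jv jw ju' jv' jw' uv uw vw uv' uw' vw' hv hw hv' hw' hyu hyv.
have qs : rproj sA N * sA N = sA N by have [] := piso_proj ju hsN.
have jQ := rel_src_proj A01 hs N; have [_ Qv _] := rel_src_r A01 hs N.
have sum1 := br_sum hs; have sum1' := br_sum ht; rewrite -!/(eA _) in sum1 sum1'.
have tsrc i : i != N -> tA i * src_proj A (rproj tA) i = tA i.
  by move=> iN; have [] := piso_proj (rel_src_proj A01 ht i) (rel_pA ht iN).
have srcr i := rel_src_r A01 ht i.
have yuE : tA N * (star (tA N) * (r * rproj sA N * sA N)) = r * sA N.
  have [_ h _] := piso_proj jq hrN.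
  by rewrite mulrA -/(rproj tA N) mulrA h -mulrA qs.
move: (star (tA N) * _) hyu yuE => yu hyu yuE.
have eq j : eA sA * rproj sA j = rproj sA j := rel_e_q hs j.
have tNs : tA N * (tu * star tu) = tA N by have [] := piso_proj ju' htN.
have [pu [puE {}ju]] : exists p, p = su * star su /\ is_proj p by exists (su * star su).
have [pv [pvE {}jv]] : exists p, p = sv * star sv /\ is_proj p by exists (sv * star sv).
have [pw [pwE {}jw]] : exists p, p = sw * star sw /\ is_proj p by exists (sw * star sw).
have [pu' [puE' {}ju']] : exists p, p = tu * star tu /\ is_proj p by exists (tu * star tu).
have [pv' [pvE' {}jv']] : exists p, p = tv * star tv /\ is_proj p by exists (tv * star tv).
have [pw' [pwE' {}jw']] : exists p, p = tw * star tw /\ is_proj p by exists (tw * star tw).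
rewrite -?puE -?pvE -?pwE -?puE' -?pvE' -?pwE' in uv uw vw uv' uw' vw' hyv hyu hyw eu ev ew
  eu' ev' ew' hv hw hu hv' hw' hu' Qv srcr sum1 sum1' tNs *.
have sE i : src_proj A (rproj tA) i * eA tA = src_proj A (rproj tA) i.
  by apply: proj_leC => //; [exact: (rel_src_proj A01 ht i)|exact: (rel_e_src A01 ht i)].
move: (eA sA) (eA tA) hr je je' eu ev ew eu' ev' ew' sum1 sum1' eq sE => e e' hr' je je'
  eu ev ew eu' ev' ew' sum1 sum1' eq sE.
have yp : [/\ yu * pu = yu, yv * pv = yv & yw * pw = yw].
  by split; [have [] := piso_proj ju hyu|have [] := piso_proj jv hyv|have [] := piso_proj jw hyw].
have py : [/\ pu' * yu = yu, pv' * yv = yv & pw' * yw = yw].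
  by split; [have [] := piso_proj ju hyu|have [] := piso_proj jv hyv|have [] := piso_proj jw hyw].
have [re er _] := piso_proj je hr'.
have uvw : (pu + pv) * pw = 0 by rewrite mulrDl uw vw addr0.
have uvw' : (pu' + pv') * pw' = 0 by rewrite mulrDl uw' vw' addr0.
have jt0 := proj_uvw ju jv jw uv uw vw; have jt' := proj_uvw ju' jv' jw' uv' uw' vw'.
have ey := pisoD (projD ju jv uv) jw (pisoD ju jv hyu hyv uv uv') hyw uvw uvw'.
have et : e * (pu + pv + pw) = 0 by rewrite !mulrDr eu ev ew !addr0.
have et' : e' * (pu' + pv' + pw') = 0 by rewrite !mulrDr eu' ev' ew' !addr0.
have hZ := pisoD je jt0 hr' ey et et'; rewrite sum1 sum1' in hZ.
have [[yup yvp ywp] [pyu pyv pyw]] := (yp, py).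
have sym := proj_ortho_sym.
have [[ue ve we] [ue' ve' we']] : [/\ pu * e = 0, pv * e = 0 & pw * e = 0] /\
  [/\ pu' * e' = 0, pv' * e' = 0 & pw' * e' = 0] by do 2 split; exact: sym.
have Ze y : e * y = y -> (r + (yu + yv + yw)) * y = r * y.
  move=> ey'; rewrite -{1}ey' !mulrDl -yup -yvp -ywp -!mulrA !(mulrA _ e).
  by rewrite ue ve we !mul0r !mulr0 !addr0 re.
have tZ y : y * e' = y -> y * (r + (yu + yv + yw)) = y * r.
  move=> ey'; rewrite -{1}ey' -mulrA !mulrDr er -pyu -pyv -pyw !(mulrA e').
  by rewrite eu' ev' ew' !mul0r ?mulr0 !addr0.
have [vu wu wv] : [/\ pv * pu = 0, pw * pu = 0 & pw * pv = 0] by split; exact: sym.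
have [vu' wu' wv'] : [/\ pv' * pu' = 0, pw' * pu' = 0 & pw' * pv' = 0] by split; exact: sym.
have Zu : (r + (yu + yv + yw)) * pu = yu /\ pu' * (r + (yu + yv + yw)) = yu.
  split; rewrite !(mulrDl, mulrDr).
    by rewrite -re -{1}yvp -{1}ywp -!mulrA eu vu wu !mulr0 !addr0 add0r yup.
  by rewrite -er -{1}pyv -{1}pyw !mulrA ue' uv' uw' !mul0r !addr0 add0r pyu.
have Zv : (r + (yu + yv + yw)) * pv = yv /\ pv' * (r + (yu + yv + yw)) = yv.
  split; rewrite !(mulrDl, mulrDr).
    by rewrite -re -{1}yup -{1}ywp -!mulrA ev uv wv !mulr0 !addr0 !add0r yvp.
  by rewrite -er -{1}pyu -{1}pyw !mulrA ve' vu' vw' !mul0r !addr0 !add0r pyv.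
have Zw : (r + (yu + yv + yw)) * pw = yw /\ pw' * (r + (yu + yv + yw)) = yw.
  split; rewrite !(mulrDl, mulrDr).
    by rewrite -re -{1}yup -{1}yvp -!mulrA ew uw vw !mulr0 !add0r ywp.
  by rewrite -er -{1}pyu -{1}pyv !mulrA we' wu' wv' !mul0r !add0r pyw.
have tNZ : tA N * (r + (yu + yv + yw)) = tA N * yu.
  by rewrite -tNs -!mulrA (proj2 Zu) pyu.
move: (r + (yu + yv + yw)) hZ Ze tZ Zu Zv Zw tNZ => Z uZ Ze tZ [Zu Zu'] [Zv Zv'] [Zw Zw'] tNZ.
have es i : e * sA i = sA i.
  by rewrite -(proj_pi (br_pA hs i)) -/(rproj sA i) mulrA eq.
have ZA i : Z * sA i = tA i * Z.
  have [->|iN] := eqVneq i N; first by rewrite tNZ yuE Ze.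
  by rewrite Ze // rA // tZ // -tsrc // -mulrA sE.
have Zq i : Z * rproj sA i = rproj tA i * Z.
  by rewrite /rproj mulrA ZA -mulrA (unitary_intertwine uZ (ZA i)) mulrA.
have Zs i : Z * src_proj A (rproj sA) i = src_proj A (rproj tA) i * Z.
  rewrite /src_proj mulr_sumr mulr_suml; apply: eq_bigr => j _.
  by rewrite mulrzAr mulrzAl Zq.
have Zpu : Z * pu = pu' * Z by rewrite Zu Zu'.
have Zpv : Z * pv = pv' * Z by rewrite Zv Zv'.
have Zpw : Z * pw = pw' * Z by rewrite Zw Zw'.
have ZD a1 a2 b1 b2 : Z * a1 = b1 * Z -> Z * a2 = b2 * Z -> Z * (a1 + a2) = (b1 + b2) * Z.
  by move=> h1 h2; rewrite mulrDr mulrDl h1 h2.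
have [Wu [pWu WuE]] := compare_pisos (projD jQ jv Qv) hu (conj_piso uZ (ZD _ _ _ _ (Zs N) Zpv) Zpu hu').
have [Wv [pWv WvE]] := compare_pisos jt0 hv (conj_piso uZ (ZD _ _ _ _ (ZD _ _ _ _ Zpu Zpv) Zpw) Zpv hv').
have [Ww [pWw WwE]] := compare_pisos (proj_vw jv jw vw) hw (conj_piso uZ (ZD _ _ _ _ Zpv Zpw) Zpw hw').
exists Z, Wu, Wv, Ww; split=> //.
by rewrite WuE WvE WwE -!(mulrA (star Z)); split; rewrite (mulKx1 (proj2 uZ)).
Qed.

End Alignment.

(** * The round trip on the extended algebra *)

Section Rigidity.
Variables (R : realType) (D : cstarAlgType R) (m : nat) (A : 'M[int]_m.+1).
Hypotheses (A01 : mx01 A) (gB : ck_graph (bar_mx A)).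
Local Notation N := (@ord_max m).
Variables (a b : D) (ha : star a * a = 1) (hb : star b * b = 1) (hab : star a * b = 0).
Local Notation cl := (pcl ha hb hab).
Variables (sA : 'I_m.+1 -> D) (su sv sw : D).
Hypothesis hs : bar_rel A sA su sv sw.

Lemma block_unitary (e pu pv pw x y z : D) : is_proj e -> e * pu = 0 -> e * pv = 0 ->
  e * pw = 0 -> pu * pv = 0 -> pu * pw = 0 -> pv * pw = 0 -> e + (pu + pv + pw) = 1 ->
  punit pu x -> punit pv y -> punit pw z -> let X := e + (x + y + z) in
  [/\ unitary X, forall q, e * q = q -> X * q = q,
    X * pu = x /\ pu * X = x, X * pv = y /\ pv * X = y & X * pw = z /\ pw * X = z].
Proof.
move=> je eu ev ew uv uw vw sum hx hy hz X.
have [[ux xu] [vy yv]] := (punit_mul hx, punit_mul hy); have [wz zw] := punit_mul hz.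
have [ju jv jw] := And3 (proj1 hx) (proj1 hy) (proj1 hz).
have [ue ve we] := And3 (proj_ortho_sym je ju eu) (proj_ortho_sym je jv ev)
  (proj_ortho_sym je jw ew).
have [vu wu wv] := And3 (proj_ortho_sym ju jv uv) (proj_ortho_sym ju jw uw)
  (proj_ortho_sym jv jw vw).
split.
- have uvw : (pu + pv) * pw = 0 by rewrite mulrDl uw vw addr0.
  have et : e * (pu + pv + pw) = 0 by rewrite !mulrDr eu ev ew !addr0.
  by have := punitD (punit_proj je) (punitD (punitD hx hy uv) hz uvw) et; rewrite sum => -[_].
- move=> q eq; rewrite -eq mulrA; congr (_ * _).
  by rewrite !mulrDl (proj2 je) -xu -yv -zw -!mulrA ue ve we !mulr0 !addr0.
- split; rewrite !(mulrDl, mulrDr).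
    by rewrite eu xu -yv -zw -!mulrA vu wu !mulr0 !addr0 add0r.
  by rewrite ue ux -vy -wz !mulrA uv uw !mul0r !addr0 add0r.
- split; rewrite !(mulrDl, mulrDr).
    by rewrite ev yv -xu -zw -!mulrA uv wv !mulr0 !addr0 !add0r.
  by rewrite ve vy -ux -wz !mulrA vu vw !mul0r !addr0 !add0r.
split; rewrite !(mulrDl, mulrDr).
  by rewrite ew zw -xu -yv -!mulrA uw vw !mulr0 !add0r.
by rewrite we wz -ux -vy !mulrA wu wv !mul0r !add0r.
Qed.

(* A unitary [z] equal to [1] except on [pv] and [pw] changes the classes of
   [(Wu, Wv, Ww)] by [(zv, zw, zv)], where [zv], [zw] are arbitrary: a triple with
   equal first and last classes can be killed. *)
Lemma twist_aeq Wu Wv Ww : punit (su * star su) Wu -> punit (sv * star sv) Wv ->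
  punit (sw * star sw) Ww -> cl (su * star su) Wu = cl (sw * star sw) Ww ->
  forall d : R, 0 < d -> exists2 u, unitary u & forall x,
    cnorm (u * bar_fam sA (Wu * su) (Wv * sv) (Ww * sw) x * star u -
      bar_fam sA su sv sw x) <= d.
Proof.
move=> hWu hWv hWw clW d d0; have fs := bar_rel_family hs.
have b01 := bar_mx01 A01.
have pA i : rproj (bar_fam sA su sv sw) (li i) = rproj sA i by rewrite /rproj bar_famA.
have pU : rproj (bar_fam sA su sv sw) (iu m) = su * star su by rewrite /rproj bar_famr.
have pV : rproj (bar_fam sA su sv sw) (iv m) = sv * star sv by rewrite /rproj bar_famr.
have pW : rproj (bar_fam sA su sv sw) (iw m) = sw * star sw by rewrite /rproj bar_famr.
have [ju jv jw] := And3 (br_pu hs) (br_pv hs) (br_pw hs).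
have [uv uw vw] := rel_rr hs; have [eu ev ew] := rel_e_r hs.
have je := rel_e_proj hs; have sum1 := br_sum hs; rewrite -/(eA sA) in sum1.
have esrc := rel_e_src A01 hs; have eq := rel_e_q hs; have jq := br_pA hs.
have jsrc := rel_src_proj A01 hs; have [_ Qv _] := rel_src_r A01 hs N.
have hv : piso (su * star su + sv * star sv + sw * star sw) (sv * star sv) sv.
  by split; rewrite ?(br_v hs).
have hw : piso (sv * star sv + sw * star sw) (sw * star sw) sw by split; rewrite ?(br_w hs).
have [su_ sv_ sw_] := And3 (proj_pi ju) (proj_pi jv) (proj_pi jw).
have es i : eA sA * sA i = sA i by rewrite -(proj_pi (jq i)) -/(rproj sA i) mulrA eq.
have [srcA srcN] := (br_A hs, br_N hs); have [srcu srcv srcw] := And3 (br_u hs) (br_v hs) (br_w hs).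
set s := bar_fam _ _ _ _ in fs pA pU pV pW *.
have sAE i : s (li i) = sA i by exact: bar_famA.
have suE : s (iu m) = su by exact: bar_famr.
have svE : s (iv m) = sv by exact: bar_famr.
have swE : s (iw m) = sw by exact: bar_famr.
clearbody s.
have [pu [puE {}ju]] : exists p, p = su * star su /\ is_proj p by exists (su * star su).
have [pv [pvE {}jv]] : exists p, p = sv * star sv /\ is_proj p by exists (sv * star sv).
have [pw [pwE {}jw]] : exists p, p = sw * star sw /\ is_proj p by exists (sw * star sw).
rewrite -puE -?pvE -?pwE in hWu hWv hWw clW pU pV pW uv uw vw eu ev ew sum1 Qv hv hw su_ sv_ sw_
  srcN srcu srcv srcw *.
have uvw : (pu + pv) * pw = 0 by rewrite mulrDl uw vw addr0.
have [q [qE {}jq]] : exists q : 'I_m.+1 -> D, q = rproj sA /\ forall i, is_proj (q i).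
  by exists (rproj sA).
rewrite -qE in pA eq jsrc esrc srcA srcu Qv.
move: (eA sA) eu ev ew je sum1 esrc eq es => e eu ev ew je sum1 esrc eq es.
have hWt : punit (pu + pv + pw) (pu + pv + star Ww).
  by apply: punitD; [exact/punit_proj/projD|exact: punit_star|].
have hWs : punit (pv + pw) (star Wv + pw).
  by apply: punitD; [exact: punit_star|exact: punit_proj|].
(* The class equations at [u], [v], [w] read [cl Wu + cl zv = 0], [cl Wv + cl zw = 0] and
   [cl Ww + cl zv = 0]; the first and the last agree by [clW]. *)
have [zv [hzv clzv]] : exists zv, punit pv zv /\ cl pv zv = - cl pw Ww.
  exists (sv * (pu + pv + star Ww) * star sv); split; first exact: (piso_conj hv hWt).
  rewrite (cl_piso ha hb hab hv hWt) pclD ?pcl_proj ?add0r ?pcl_star //.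
    exact/punit_proj/projD.
  exact: punit_star.
have [zw [hzw clzw]] : exists zw, punit pw zw /\ cl pw zw = - cl pv Wv.
  exists (sw * (star Wv + pw) * star sw); split; first exact: (piso_conj hw hWs).
  rewrite (cl_piso ha hb hab hw hWs) pclD ?pcl_proj ?addr0 ?pcl_star //.
    exact: punit_star.
  exact: punit_proj.
have [uX Xq [Xu Xu'] [Xv Xv'] [Xw Xw']] := block_unitary je eu ev ew uv uw vw sum1 hWu hWv hWw.
have [uz zq [zu zu'] [zv1 zv1'] [zw1 zw1']] := block_unitary je eu ev ew uv uw vw sum1 (punit_proj ju) hzv hzw.
have star_q Z i : (forall q, e * q = q -> Z * q = q) -> (forall q, e * q = q -> star Z * q = q) ->
    q i * Z = q i.
  by move=> _ h; rewrite -[Z]starK -{1}(proj1 (jq i)) -starM h // (proj1 (jq i)).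
have Vq Z : unitary Z -> (forall q, e * q = q -> Z * q = q) -> forall q, e * q = q -> star Z * q = q.
  by move=> [z1 _] h y ey; rewrite -{1}(h y ey) mulrA z1 mul1r.
move: (e + _) uX Xq Xu Xu' Xv Xv' Xw Xw' => X uX Xq Xu Xu' Xv Xv' Xw Xw'.
move: (e + _) uz zq zu zu' zv1 zv1' zw1 zw1' => z uz zq zu zu' zv1 zv1' zw1 zw1'.
have PX : pcomm s X.
  apply: (@bar_ind m (fun j => X * rproj s j = rproj s j * X)) => [i _||||];
    rewrite ?pA ?pU ?pV ?pW ?Xu ?Xv ?Xw //; by rewrite Xq // star_q //; exact: Vq.
have Pz : pcomm s z.
  apply: (@bar_ind m (fun j => z * rproj s j = rproj s j * z)) => [i _||||];
    rewrite ?pA ?pU ?pV ?pW ?zu ?zv1 ?zw1 //; by rewrite zq // star_q //; exact: Vq.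
have aX : aeq s X 1.
  apply: (class_aeq_twist b01 gB (a := a) (b := b) fs uX PX uz Pz).
  apply: (@bar_ind m (fun x => cl (rproj s x) (X * rproj s x) +
     cl (star (s x) * s x) (z * (star (s x) * s x)) = cl (rproj s x) (z * rproj s x))) => [i iN||||].
  - by rewrite pA sAE srcA // !Xq // !zq // !pcl_proj addr0.
  - by rewrite pA sAE srcN (Xq _ (eq N)) (zq _ (eq N)) zu !pcl_proj addr0.
  - rewrite pU suE srcu Xu zu mulrDr zq // zv1 pclD ?pcl_proj //; last exact: punit_proj.
    by rewrite add0r clzv clW subrr.
  - rewrite pV svE srcv Xv zv1 !mulrDr zu zv1 zw1 pclD //; last first.
      by apply: punitD => //; exact: punit_proj.
    by rewrite pclD //; [rewrite pcl_proj clzw; abel|exact: punit_proj].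
  rewrite pW swE srcw Xw zw1 !mulrDr zv1 zw1 pclD // clzv.
  by abel.
have [u uu hu] := aeq_conj b01 fs aX d0; exists u => // x.
have -> : bar_fam sA (Wu * su) (Wv * sv) (Ww * sw) x = X * s x; last exact: hu.
elim/(@bar_ind m): x => [i _||||].
- by rewrite bar_famA sAE Xq.
- by rewrite bar_famA sAE Xq.
- by rewrite bar_famr suE /= -Xu -mulrA su_.
- by rewrite bar_famr svE /= -Xv -mulrA sv_.
by rewrite bar_famr swE /= -Xw -mulrA sw_.
Qed.

Variables (mu : seq 'I_m.+1) (hmu : first_return A mu).
Variables (tA : 'I_m.+1 -> D) (tu tv tw r : D).
Hypotheses (ht : bar_rel A tA tu tv tw).
Hypotheses (hr : piso (eA sA) (eA tA) r) (rA : forall i, i != N -> r * sA i = tA i * r).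
Hypothesis rN : r * rproj sA N * star r = rproj tA N.

(** After alignment the second family is a twist of the first. By naturality the last generators
    then differ by [star Z * Y * Z], of class zero, and also by a unitary of class [cl Wu - cl Ww];
    equating the two gives the hypothesis of [twist_aeq]. *)
Lemma expand_contract Y : punit (rproj tA N) Y -> cl (rproj tA N) Y = 0 ->
  last_gen A mu tA tu tv tw = Y * (r * last_gen A mu sA su sv sw * star r) ->
  forall d : R, 0 < d -> exists2 u, unitary u & forall x,
    cnorm (u * bar_fam tA tu tv tw x * star u - bar_fam sA su sv sw x) <= d.
Proof.
move=> pY clY vE d d0.
have [Z [Wu [Wv [Ww [uZ Ze ZA [hWu hWv hWw] [ZU ZV ZW]]]]]] := align A01 gB hs ht hr rA rN.
have [Z1 Z2] := uZ.
pose f (x : D) := star Z * x * Z.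
have fZ x y : Z * x = y * Z -> f y = x by move=> h; rewrite /f -mulrA -h mulrA Z1 mul1r.
have fD : {morph f : x y / x + y} by move=> x y; rewrite /f mulrDr mulrDl.
have fM : {morph f : x y / x * y}.
  by move=> x y; rewrite /f -!mulrA (mulKx1 Z2).
have f1 : f 1 = 1 by rewrite /f mulr1.
have fS : star_morphism f by move=> x; rewrite /f !starM starK mulrA.
have fA : f \o tA = sA by apply: funext => i; exact: fZ.
have := last_gen_map A fD fM f1 fS mu tA tu tv tw.
rewrite fA (fZ _ _ ZU) (fZ _ _ ZV) (fZ _ _ ZW) vE.
have [W [pW -> clW]] := last_gen_twist A01 ha hb hab hmu hs hWu hWv hWw.
have hv := rel_last_gen A01 hs hmu.
have ve : last_gen A mu sA su sv sw * eA sA = last_gen A mu sA su sv sw /\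
    eA sA * last_gen A mu sA su sv sw = last_gen A mu sA su sv sw.
  by have := reduced_gen_e A01 hs hmu N; rewrite /reduced_gen eqxx.
have jq := br_pA hs N.
have Zq : Z * rproj sA N = rproj tA N * Z.
  by rewrite /rproj mulrA ZA -mulrA (unitary_intertwine uZ (ZA N)) mulrA.
move: (last_gen A mu sA su sv sw) hv ve => v hv [ve ev].
have re : r * eA sA = r by have [] := piso_proj (rel_e_proj hs) hr.
have eZ : Z * eA sA = r by rewrite Ze ?re //; exact: (proj2 (rel_e_proj hs)).
have rZ : star r * Z = eA sA by rewrite -eZ starM (proj1 (rel_e_proj hs)) -mulrA Z1 mulr1.
have -> : f (Y * (r * v * star r)) = star Z * Y * Z * v.
  rewrite /f -!mulrA rZ; congr (_ * (_ * _)).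
  by rewrite ve Ze.
have [q [qE {}jq]] : exists q, q = rproj sA N /\ is_proj q by exists (rproj sA N).
have [q' qE'] : exists q, q = rproj tA N by exists (rproj tA N).
rewrite -?qE -?qE' in Zq pY clY pW hv clW *.
have Zq' : star Z * q' * Z = q by rewrite -mulrA -Zq mulrA Z1 mul1r.
have clf := pcl_conj ha hb hab (y := star Z) pY.
rewrite starK (mulrA Z) Z2 mul1r Zq' in clf; have {}clf := clf erefl.
move=> h; have WY : W = star Z * Y * Z.
  have [_ Wq] := punit_mul pW; have [v1 v2] := hv.
  have qY : star Z * Y * Z * q = star Z * Y * Z.
    by rewrite -!mulrA Zq (mulrA Y); have [_ ->] := punit_mul pY.
  by rewrite -Wq -qY -v2 !mulrA h.
have clWW : cl (su * star su) Wu = cl (sw * star sw) Ww.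
  by apply/eqP; rewrite -subr_eq0 -clW WY clf clY.
have [u uu hu] := twist_aeq hWu hWv hWw clWW d0.
exists (u * star Z); first by apply: unitaryM => //; exact: unitaryV.
move=> x; have := hu x.
have -> : bar_fam sA (Wu * su) (Wv * sv) (Ww * sw) x = star Z * bar_fam tA tu tv tw x * Z.
  elim/(@bar_ind m): x => [i _||||]; rewrite ?bar_famA ?bar_famr /= -?(fZ _ _ (ZA _)) //.
  - by rewrite -(fZ _ _ ZU).
  - by rewrite -(fZ _ _ ZV).
  by rewrite -(fZ _ _ ZW).
by rewrite starM starK !mulrA.
Qed.

End Rigidity.

(** * The isomorphism and the determinant *)

Section ClassMap.
Variables (R : realType) (D D' : cstarAlgType R) (phi : {lrmorphism D -> D'}).
Hypothesis hphi : star_morphism phi.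

Lemma piso_map (p q x : D) : piso p q x -> piso (phi p) (phi q) (phi x).
Proof. by move=> [h1 h2]; split; rewrite -hphi -rmorphM /= ?h1 ?h2. Qed.

Lemma proj_map (p : D) : is_proj p -> is_proj (phi p).
Proof. by move=> [h1 h2]; split; rewrite -?hphi -?rmorphM /= ?h1 ?h2. Qed.

Lemma punit_map (p x : D) : punit p x -> punit (phi p) (phi x).
Proof. by move=> [h1 h2]; split; [exact: proj_map|exact: piso_map]. Qed.

Variables (a b : D) (ha : star a * a = 1) (hb : star b * b = 1) (hab : star a * b = 0).
Variables (ha' : star (phi a) * phi a = 1) (hb' : star (phi b) * phi b = 1)
  (hab' : star (phi a) * phi b = 0).

(** Contractive homomorphisms map chains to chains with the same step bound. *)
Lemma pcl_map p x : punit p x -> pcl ha hb hab p x = 0 -> pcl ha' hb' hab' (phi p) (phi x) = 0.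
Proof.
move=> px h0; have h := proj1 (kcl_eq0 ha hb hab (fullu_unitary px)) h0.
apply/kcl_eq0; first exact/fullu_unitary/punit_map.
move=> e /h [n [w [w0 wn wu we]]]; exists n, (fun k => phi (w k)); split.
- by rewrite w0 /corner /fullu !(rmorphD, rmorphN, rmorphM, rmorph1) /= !hphi.
- by rewrite wn rmorph1.
- by move=> k; have [uk _] := wu k; split=> //; exact: rmorph_unitary.
by move=> k; rewrite -raddfB; apply: le_trans (contractive hphi _) (we k).
Qed.

End ClassMap.

Section Isomorphism.
Variables (R : realType) (m : nat) (A : 'M[int]_m.+1).
Hypotheses (A01 : mx01 A) (gA : ck_graph A) (gB : ck_graph (bar_mx A)).
Local Notation N := (@ord_max m).
Variables (mu : seq 'I_m.+1) (hmu : first_return A mu).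

Lemma bar_fam_eta (D : cstarAlgType R) (s : 'I_(m.+1 + 3) -> D) x :
  bar_fam (fun i => s (li i)) (s (iu m)) (s (iv m)) (s (iw m)) x = s x.
Proof. by elim/(@bar_ind m): x => [i _||||]; rewrite ?bar_famA ?bar_famr. Qed.

Lemma cuntz_splice (OA OB : cstarAlgType R) : is_cuntz_krieger A OA ->
  is_cuntz_krieger (bar_mx A) OB -> cstar_isomorphic OA OB.
Proof.
move=> [S [fS gS uS]] [s [fs gs us]].
have [x [Px xo]] := room A01 gA fS 1 2.
have {xo} xo i j : star (x i) * x j = (i == j)%:R by have := xo i j 0%N isT.
have [a [b [ha [hb hab]]]] : exists a b : OA, star a * a = 1 /\ star b * b = 1 /\ star a * b = 0.
  by exists (x ord0), (x ord_max); rewrite !xo.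
have [sA [su [sv [sw [U [k hx]]]]]] := expansion_exists A01 fS gA.
have [Ww [Y [pWw pY clY vE apx]]] := contract_expand A01 ha hb hab hmu gA fS hx.
have [h U1 U2 hA US qN _ _] := hx.
have h' : bar_rel A sA su sv (Ww * sw).
  have := bar_rel_twist h (punit_proj (br_pu h)) (punit_proj (br_pv h)) pWw.
  by rewrite (proj_pi (br_pu h)) (proj_pi (br_pv h)).
move: (Ww * sw) h' vE apx => sw' h' vE apx.
(* [psi] realizes the twisted expansion of [S], and [phi] below the reduction of [s]; by naturality
   [psi \o phi] is the round trip treated by [contract_expand]. *)
have [psi [hpsi psiE]] := us _ _ (bar_rel_family h').
have hs := bar_family_rel fs.
have [phi [hphi phiE]] := uS _ _ (reduced_fam_family A01 hs hmu).
apply: (intertwining fS fs gS gs uS us hphi hpsi) => d d0.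
  have [u uu hu] := apx d d0; exists u => // i.
  rewrite /= phiE -(reduced_fam_map A (f := psi) (raddfD psi) (rmorphM psi) (rmorph1 psi) hpsi).
  have -> : psi \o (fun i => s (li i)) = sA.
    by apply: funext => j; rewrite -[RHS](bar_famA sA su sv sw' j) -psiE.
  by rewrite !psiE !bar_famr /=; exact: hu.
have ht := bar_rel_map (f := phi) (raddfD phi) (rmorphM phi) (rmorph1 phi) hphi h'.
have [ha' [hb' hab']] : star (phi a) * phi a = 1 /\ star (phi b) * phi b = 1 /\
    star (phi a) * phi b = 0.
  by rewrite -!hphi -!rmorphM /= ha hb hab rmorph1 rmorph0.
have hU0 := rel_shrink_iso A01 hs hmu.
have hF0 := reduced_gen_e A01 hs hmu.
have hF i : phi (S i) = star (shrink_iso mu (fun i => s (li i)) (s (iu m)) (s (iv m)) (s (iw m))) *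
    reduced_gen A mu (fun i => s (li i)) (s (iu m)) (s (iv m)) (s (iw m)) i *
    shrink_iso mu (fun i => s (li i)) (s (iu m)) (s (iv m)) (s (iw m)) by rewrite phiE.
have hFp := reduced_fam_piso A01 hs hmu.
have F0A i : i != N -> reduced_gen A mu (fun i => s (li i)) (s (iu m)) (s (iv m)) (s (iw m)) i = s (li i).
  by move=> iN; rewrite /reduced_gen (negPf iN).
have F0N : reduced_gen A mu (fun i => s (li i)) (s (iu m)) (s (iv m)) (s (iw m)) N =
  last_gen A mu (fun i => s (li i)) (s (iu m)) (s (iv m)) (s (iw m)) by rewrite /reduced_gen eqxx.
have eE : eA (phi \o sA) = phi (eA sA).
  by rewrite /eA rmorph_sum; apply: eq_bigr => j _; rewrite /rproj /= rmorphM /= hphi.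
have qE : rproj (phi \o sA) N = phi (rproj sA N) by rewrite /rproj /= rmorphM /= hphi.
have pN : star (shrink_iso mu (fun i => s (li i)) (s (iu m)) (s (iv m)) (s (iw m))) *
    rproj (fun i => s (li i)) N * shrink_iso mu (fun i => s (li i)) (s (iu m)) (s (iv m)) (s (iw m))
    = phi (rproj S N).
  by have [_ <-] := hFp N; rewrite -phiE /rproj rmorphM /= hphi.
have e0 := rel_e_proj hs.
move: (shrink_iso _ _ _ _ _) hU0 hF pN {hFp} => V hV hF pN.
have [V1 V2] := hV.
(* [star V] spreads the old part of [s] over the whole algebra, and [phi U] shrinks it to the old
   part of the expanded image of [S]. *)
have hr : piso (eA (fun i => s (li i))) (eA (phi \o sA)) (phi U * star V).
  apply: (pisoM e0 (piso_sym hV)); rewrite eE -U2 -(rmorph1 phi).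
  exact: (piso_map hphi (conj U1 erefl)).
have FV i : star V * reduced_gen A mu (fun i => s (li i)) (s (iu m)) (s (iv m)) (s (iw m)) i =
    phi (S i) * star V.
  by rewrite hF -!mulrA V2 (proj1 (hF0 i)).
have rA i : i != N -> phi U * star V * s (li i) = (phi \o sA) i * (phi U * star V).
  move=> iN; rewrite -F0A // -mulrA FV mulrA -rmorphM US //= hA //.
  by rewrite mulrA -rmorphM -mulrA U1 mulr1.
have rN : phi U * star V * rproj (fun i => s (li i)) N * star (phi U * star V) =
    rproj (phi \o sA) N.
  rewrite starM starK qE qN (rmorphM phi (U * rproj S N)) (rmorphM phi U) /= hphi -pN.
  by rewrite !mulrA.
have vE' : last_gen A mu (phi \o sA) (phi su) (phi sv) (phi sw') =
    phi Y * (phi U * star V * last_gen A mu (fun i => s (li i)) (s (iu m)) (s (iv m)) (s (iw m)) *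
      star (phi U * star V)).
  rewrite (last_gen_map A (f := phi) (raddfD phi) (rmorphM phi) (rmorph1 phi) hphi) vE -F0N starM starK.
  rewrite -(mulrA (phi U) (star V)) FV !rmorphM /= hphi -!mulrA; congr (_ * (_ * (_ * _))).
  by rewrite (mulrA (star V)) V1 mul1r.
have pY' := punit_map hphi pY; have clY' := pcl_map hphi ha' hb' hab' pY clY.
rewrite -qE in pY' clY'.
have [u uu hu] := expand_contract A01 gB hs hmu ht hr rA rN pY' clY' vE' d0.
exists u => // y; have := hu y; rewrite bar_fam_eta.
have <- : phi (psi (s y)) = bar_fam (phi \o sA) (phi su) (phi sv) (phi sw') y => //.
by rewrite psiE; elim/(@bar_ind m): y => [i _||||]; rewrite ?bar_famA ?bar_famr.
Qed.

End Isomorphism.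

(** Shortening a path back to [N] to one without repetitions makes its inner vertices avoid [N]. *)
Lemma first_return_exists m (A : 'M[int]_m.+1) : (forall i j, connect (edge A) i j) ->
  (exists j, edge A ord_max j) -> exists mu, first_return A mu.
Proof.
move=> conn [j eNj]; have /connectP[p pp lp] := conn j ord_max.
move: lp; case: (shortenP pp) => q pq uq _ lq; exists (belast j q).
have E : rcons (belast j q) ord_max = j :: q by rewrite lq -lastI.
split; first by rewrite E /= eNj.
by move: uq; rewrite -E rcons_uniq => /andP[].
Qed.

Section Irreducible.
Variables (n : nat) (M : 'M[int]_n.+1).
Hypotheses (M01 : mx01 M) (irr : irreducible_mx M).

Lemma mx01_edge i j : M i j != 0 -> edge M i j.
Proof. by rewrite /edge; case: (M01 i j) => ->. Qed.

Lemma mx_sum_neq0 (f : 'I_n.+1 -> int) : \sum_l f l != 0 -> exists l, f l != 0.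
Proof.
move=> h; apply/existsP; rewrite -negb_forall; apply: contra h => /forallP h.
by rewrite big1 // => l _; apply/eqP.
Qed.

Lemma exp_connect k i j : (M ^+ k) i j != 0 -> connect (edge M) i j.
Proof.
elim: k i => [|k ih] i.
  by rewrite expr0 mxE; case: (eqVneq i j) => [-> _|_]; [exact: connect0|rewrite eqxx].
rewrite exprS mxE => /mx_sum_neq0[l]; rewrite mulf_eq0 negb_or => /andP[h1 /ih].
exact/connect_trans/connect1/mx01_edge.
Qed.

Lemma irreducible_connect i j : connect (edge M) i j.
Proof. by have [k _ h] := irr i j; apply: (@exp_connect k); rewrite gt_eqF. Qed.

Lemma irreducible_out i : exists j, edge M i j.
Proof.
have [[//|k] _] := irr i i; rewrite exprS mxE => /gt_eqF/negbT/mx_sum_neq0[l].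
by rewrite mulf_eq0 negb_or => /andP[/mx01_edge h _]; exists l.
Qed.

Lemma irreducible_in j : exists i, edge M i j.
Proof.
have [[//|k] _] := irr j j; rewrite exprSr mxE => /gt_eqF/negbT/mx_sum_neq0[l].
by rewrite mulf_eq0 negb_or => /andP[_ /mx01_edge h]; exists l.
Qed.

(** Without branching the edges form the graph of a function, which is onto since every vertex has
    an incoming edge, hence a permutation. *)
Lemma irreducible_ck_graph : ~~ is_perm_mx M -> ck_graph M.
Proof.
move=> nperm; split; first exact: irreducible_connect.
apply: contrapT => nb; case/negP: nperm.
have out1 i j k : edge M i j -> edge M i k -> j = k.
  move=> e1 e2; apply/eqP; apply: contrapT => /negP jk; apply: nb.
  by exists i, j, k.
have [f hf] := boolp.choice irreducible_out.
have [g hg] := boolp.choice irreducible_in.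
have fg j : f (g j) = j by apply: (out1 (g j)).
have gf : cancel f g by apply/(bij_can_sym (injF_bij (can_inj fg))).
apply/is_perm_mxP; exists (perm (can_inj gf)); apply/matrixP => i j.
rewrite !mxE permE; case: eqVneq => [<-|fij]; first exact/eqP/hf.
by case: (M01 i j) => // /eqP Mij; case/eqP: fij; exact: out1 (hf i) Mij.
Qed.

End Irreducible.

Section BarGraph.
Variables (m : nat) (A : 'M[int]_m.+1).
Local Notation N := (@ord_max m).
Local Notation e := (edge (bar_mx A)).

Lemma bar_edges : [/\ forall i j, i != N -> edge A i j -> e (li i) (li j),
  e (li N) (iu m), forall j, edge A N j -> e (iu m) (li j), e (iu m) (iv m) &
  [/\ e (iv m) (iu m), e (iv m) (iv m), e (iv m) (iw m) & e (iw m) (iv m)]].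
Proof.
rewrite /edge /bar_mx /li /iu /iv /iw /ri.
split; [|by rewrite block_mxEur !mxE !eqxx| | |].
- by move=> i j iN; rewrite block_mxEul mxE (negPf iN).
- by move=> j; rewrite block_mxEdl mxE eqxx.
- by rewrite block_mxEdr mxE.
by rewrite !block_mxEdr !mxE.
Qed.

(** An old edge from [N] to [j] becomes the detour [N -> u -> j], and the new vertices communicate
    with [N] through [u]. *)
Lemma bar_ck_graph : (forall i j, connect (edge A) i j) -> (exists j, edge A N j) ->
  ck_graph (bar_mx A).
Proof.
move=> conn [j0 ej0]; have [eA eN eu uv [vu vv vw wv]] := bar_edges.
split; last by exists (iv m), (iu m), (iv m); split; rewrite // /iu /iv /ri (inj_eq (@rshift_inj _ _)).
have step i j : edge A i j -> connect e (li i) (li j).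
  move=> eij; have [iN|iN] := eqVneq i N; last exact/connect1/eA.
  rewrite iN in eij *; exact: connect_trans (connect1 eN) (connect1 (eu _ eij)).
have cA i j : connect e (li i) (li j).
  have /connectP[p pp ->] := conn i j; elim: p i pp => [|k p ih] i /=.
    by move=> _; exact: connect0.
  by move=> /andP[/step h /ih]; exact: connect_trans.
have Nu := connect1 eN; have uN := connect_trans (connect1 (eu _ ej0)) (cA j0 N).
have [cuv cvu cvw cwv] := And4 (connect1 uv) (connect1 vu) (connect1 vw) (connect1 wv).
have fromN y : connect e (li N) y.
  elim/(@bar_ind m): y => [i _||||]; rewrite ?cA //.
  - exact: connect_trans Nu cuv.
  exact: connect_trans (connect_trans Nu cuv) cvw.
have toN y : connect e y (li N).
  elim/(@bar_ind m): y => [i _||||]; rewrite ?cA //.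
  - exact: connect_trans cvu uN.
  exact: connect_trans cwv (connect_trans cvu uN).
by move=> x y; exact: connect_trans (toN x) (fromN y).
Qed.

(* Subtracting from the first block column the last one multiplied by the
   solution of [T X = - R] clears the lower left block [R]. *)
Lemma bar_det : \det (1 - A) = - \det (1 - bar_mx A).
Proof.
pose P : 'M[int]_m.+1 := \matrix_(i, j) ((i == j)%:R - if i == N then 0 else A i j).
pose Q : 'M[int]_(m.+1, 3) := - delta_mx N 0.
pose R : 'M[int]_(3, m.+1) := \matrix_(i, j) (- if i == 0 then A N j else 0).
pose T : 'M[int]_3 := \matrix_(i, j)
  (nth [::] [:: [:: 1; -1; 0]; [:: -1; 0; -1]; [:: 0; -1; 0]] i)`_j.
pose X : 'M[int]_(3, m.+1) := \matrix_(i, j) ([:: A N j; 0; - A N j]`_i).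
have barE : 1 - bar_mx A = block_mx P Q R T.
  rewrite -[1]/(1%:M) (scalar_mx_block m.+1 3) /bar_mx opp_block_mx add_block_mx.
  congr block_mx; apply/matrixP => i j; rewrite !mxE ?sub0r //.
  by case: i => [[|[|[|i]]] hi] //; case: j => [[|[|[|j]]] hj].
have QX : P + Q *m X = 1 - A.
  apply/matrixP => i j; rewrite !mxE (bigD1 0) //= big1 => [|k k0]; rewrite !mxE.
    rewrite eqxx andbT; case: (eqVneq i N) => [->|_]; last by rewrite /= ?mulr0n oppr0 mul0r !addr0.
    by rewrite subr0 mulN1r addr0.
  by rewrite (negPf k0) andbF /= ?mulr0n oppr0 mul0r.
have TX : R + T *m X = 0.
  apply/matrixP => i j; rewrite !mxE !big_ord_recl big_ord0 !mxE /=.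
  by case: i => [[|[|[|i]]] hi] //=; ring.
have detT : \det T = -1.
  rewrite (expand_det_row _ 0) !big_ord_recl big_ord0 /cofactor.
  by rewrite !(expand_det_row _ 0) !big_ord_recl !big_ord0 /cofactor !det_mx11 !mxE.
have : \det (block_mx P Q R T *m block_mx 1 0 X 1) = \det T * \det (1 - A).
  by rewrite mulmx_block !mulmx1 !mulmx0 !add0r QX TX det_ublock mulrC.
rewrite det_mulmx det_lblock !det1 !mulr1 detT mulN1r => h.
by rewrite barE h opprK.
Qed.

End BarGraph.

Theorem corollary4 (R : realType) (m : nat) (A : 'M[int]_m.+1)
    (hA01 : mx01 A) (hAirr : irreducible_mx A) (hAperm : ~~ is_perm_mx A) :
  (forall OA ObarA : cstarAlgType R,
      is_cuntz_krieger A OA -> is_cuntz_krieger (bar_mx A) ObarA ->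
      cstar_isomorphic OA ObarA) /\
  \det (1 - A) = - \det (1 - bar_mx A).
Proof.
split; last exact: bar_det.
have gA := irreducible_ck_graph hA01 hAirr hAperm.
have out := irreducible_out hA01 hAirr ord_max.
have [mu hmu] := first_return_exists (proj1 gA) out.
by move=> OA ObarA; apply: (cuntz_splice hA01 gA (bar_ck_graph (proj1 gA) out) hmu).
Qed.
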